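(* Let $X$ be a compact metrizable abelian group and $T:X\to X$ a continuous group automorphism which is ergodic with respect to the Haar measure on $X$, and suppose $(X,T)$ satisfies the descending chain condition. Then $(X,T)$ satisfies partial specification.
   Context: $(X,T)$ satisfies the descending chain condition if every non-increasing chain $X\ge X_1\ge X_2\ge\cdots$ of closed subgroups with $TX_k=X_k$ for all $k$ stabilizes. A point $y$ is ''of period $n$'' if $T^ny=y$ (not necessarily least period). Fix a metric $d_X$ compatible with the topology of $X$ (the property below does not depend on this choice). For $M\in\mathbb{N}$, an $M$-spaced specification is a collection $\xi=\{(x_i;a_i,b_i)\}_{i=1}^r$ with $x_i\in X$ and integers $0\le a_1<b_1<a_2<b_2<\cdots<a_r<b_r$ such that $a_{i+1}-b_i\ge M$ for all $i$. For $\varepsilon>0$, $\xi$ is $\varepsilon$-partially traced by $y\in X$ if for every $i$, $|\Lambda_i|/(b_i-a_i)>1-\varepsilon$, where $\Lambda_i=\{a_i\le n<b_i: d_X(T^nx_i,T^ny)<\varepsilon\}$. For a set $\mathcal{P}\subseteq\mathbb{N}$ with bounded gaps, $(X,T)$ satisfies partial specification with periods $\mathcal{P}$ if for every $\varepsilon>0$ there exist $N,M\in\mathbb{N}$ such that for every $M$-spaced specification $\xi$ and every $n\in\mathcal{P}$ with $n\ge\max\{N,(1+\varepsilon)b_r\}$ there is $y\in X$ with $T^ny=y$ that $\varepsilon$-partially traces $\xi$. $(X,T)$ satisfies partial specification if for every $c\in\mathbb{N}$ there exists $\mathcal{P}\subseteq c\mathbb{N}$ (with bounded gaps) such that $(X,T)$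 satisfies partial specification with periods $\mathcal{P}$. *)

(* Defs.v *)
From HB Require Import structures.
From mathcomp Require Import all_boot all_order all_algebra.
From mathcomp Require Import all_classical all_reals all_analysis.
Set Implicit Arguments. Unset Strict Implicit. Unset Printing Implicit Defensive.
Import Order.TTheory GRing.Theory Num.Theory.
Local Open Scope classical_set_scope.
Local Open Scope ring_scope.

(** A topological abelian group is pointed by its neutral element; [ptd X]
    is [X] itself with this pointed structure (needed to build the Borel
    sigma-algebra with [g_sigma_algebraType]). *)
Definition ptd (X : topologicalZmodType) : Type := X.
HB.instance Definition _ (X : topologicalZmodType) := Topological.on (ptd X).
HB.instance Definition _ (X : topologicalZmodType) :=
  isPointed.Build (ptd X) (0 : X).
Notation borel X := (g_sigma_algebraType (@open (ptd X))).

Definition compatible_metric (R : realType) (X : topologicalType)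
    (d : X -> X -> R) : Prop :=
  [/\ (forall x y, d x y = 0 <-> x = y),
      (forall x y, d x y = d y x),
      (forall x y z, d x z <= d x y + d y z) &
      (forall (x : X) (A : set X),
          nbhs x A <-> exists2 e : R, 0 < e & [set y | d x y < e] `<=` A)].

Definition metrizable (R : realType) (X : topologicalType) : Prop :=
  exists d : X -> X -> R, compatible_metric d.

Definition cont_automorphism (X : topologicalZmodType) (T : X -> X) : Prop :=
  [/\ (forall x y, T (x + y) = T x + T y), bijective T & continuous T].

Definition haar_measure (R : realType) (X : topologicalZmodType)
    (mu : {measure set (borel X) -> \bar R}) : Prop :=
  mu setT = 1%E /\
  forall (x : X) (A : set X), (@open (ptd X)).-sigma.-measurable A ->
    mu [set x + a | a in A] = mu A.

Definition ergodic (R : realType) (X : topologicalZmodType)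
    (mu : {measure set (borel X) -> \bar R}) (T : X -> X) : Prop :=
  forall A : set X, (@open (ptd X)).-sigma.-measurable A -> T @^-1` A = A ->
    mu A = 0%E \/ mu A = 1%E.

Definition is_subgroup (X : zmodType) (A : set X) : Prop :=
  A 0 /\ forall x y, A x -> A y -> A (x - y).

Definition dcc (X : topologicalZmodType) (T : X -> X) : Prop :=
  forall Xs : nat -> set X,
    (forall k, [/\ closed (Xs k), is_subgroup (Xs k) & T @` Xs k = Xs k]) ->
    (forall k, Xs k.+1 `<=` Xs k) ->
    exists K, forall k, (K <= k)%N -> Xs k = Xs K.

Definition bounded_gaps (P : set nat) : Prop :=
  exists g : nat, forall m : nat, exists n, P n /\ (m <= n < m + g)%N.

(** An [M]-spaced specification with [r >= 1] pieces, indexed by [i < r]: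
    orbit segments of [x i] over the times [a i <= n < b i]. *)
Definition spaced_spec (M r : nat) (a b : nat -> nat) : Prop :=
  (0 < r)%N /\
  (forall i, (i < r)%N -> (a i < b i)%N) /\
  (forall i, (i.+1 < r)%N -> (b i + M <= a i.+1)%N).

Definition partially_traces (R : realType) (X : Type) (d : X -> X -> R)
    (T : X -> X) (eps : R) (r : nat) (x : nat -> X) (a b : nat -> nat)
    (y : X) : Prop :=
  forall i, (i < r)%N ->
    1 - eps < (count (fun n => d (iter n T (x i)) (iter n T y) < eps)
                     (index_iota (a i) (b i)))%:R / (b i - a i)%:R.

Definition partial_spec_periods (R : realType) (X : Type) (d : X -> X -> R)
    (T : X -> X) (P : set nat) : Prop :=
  forall eps : R, 0 < eps ->
  exists N M : nat, (0 < N)%N /\ (0 < M)%N /\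
    forall (r : nat) (x : nat -> X) (a b : nat -> nat) (n : nat),
      spaced_spec M r a b -> P n -> (N <= n)%N ->
      (1 + eps) * (b r.-1)%:R <= n%:R ->
      exists y : X, iter n T y = y /\ partially_traces d T eps r x a b y.

Definition partial_spec (R : realType) (X : Type) (d : X -> X -> R)
    (T : X -> X) : Prop :=
  forall c : nat, (0 < c)%N ->
    exists P : set nat, (forall n, P n -> (c %| n)%N) /\ bounded_gaps P /\
      partial_spec_periods d T P.

(* Main.v *)
(* Ergodicity makes [T^n - 1] surjective for all [n >= 1].  Call a closed invariant subgroup [Y]
   good if all [T^n - 1] are surjective on it and orbits of [X] can be traced modulo [Y] by
   points that are [n]-periodic modulo [Y], for all [n] outside finitely many sparse sets.  By
   the descending chain condition some good [Y] is minimal; if it were not [0], a character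
   [gam] nontrivial on [Y] would give the smaller subgroup [K] of the points of [Y] at which all
   [gam \o T^k], [k] in Z, are trivial, and applying products of the [T^j - 1] to [K] makes it
   good again, since partial specification passes to factors and lifts through extensions.

   By Kronecker's theorem, an [n]-periodic sequence of phases is the orbit of a point under [gam]
   as soon as it satisfies the integral relations [\sum_k a_k theta_(j+k) = 0 mod 1] valid for
   all orbits.  If all relations follow from [p gam = 0], phases may be prescribed freely.
   Otherwise [gam] is chosen with a relation [f] of minimal degree; all relations are then
   multiples of the primitive part of [f], whose complex roots are simple and not roots of unity.
   Phases become the output of a linear system driven by an integer input, split into one mode
   for each root [l].  Modes with [|l| <> 1] forget their initial or final state; modes with
   [|l| = 1] are steered in the gaps between blocks, because the values of integer polynomials
   at these roots are dense, and the solution can be closed up periodically when no [l^n] is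
   close to 1. *)
Require Import Defs.
From HB Require Import structures.
From mathcomp Require Import all_boot all_order all_algebra.
From mathcomp Require Import all_classical all_reals all_analysis.
From mathcomp Require Import complex separable.
From mathcomp Require Import zify ring lra.
Import Order.TTheory GRing.Theory Num.Theory.
Import Normc.
Import numFieldNormedType.Exports.
Set Implicit Arguments. Unset Strict Implicit. Unset Printing Implicit Defensive.
Local Open Scope classical_set_scope.
Local Open Scope ring_scope.

Arguments normc {R} x : simpl never.

(** Orbits are traced without any loss modulo the kernel of one character; the loss occurs in
    extensions. There a block traced modulo a subgroup is cut into chunks whose starting
    discrepancies are lifted separately. The gaps between chunks are given up, and so are the chunks
    that start badly. Periods are restricted because closing up a mode with [|l| = 1] divides by
    [1 - l ^+ n]. For each such root the bad [n] are at mutual distance at least [J] once the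
    tolerance is small in terms of [J]. The number of roots does not depend on [J], and this is what
    leaves good multiples of any [c] with bounded gaps. Minimality of the relation is imposed over
    all continuous characters nontrivial on [Y], not over the relations of one of them. The
    characters [gam \o pev g] then compete too, so the relations of [gam] behave like a prime ideal.
    Characters are built by hand: [X] is approximated by finite groups, a counting argument gives a
    large Fourier coefficient, and an ultralimit turns approximate characters into an exact one. *)

Section Modulus.
Variable R : realType.
Implicit Types z w : R[i].

Lemma normc_ge0 z : 0 <= normc z.
Proof. by case: z => a b; exact: sqrtr_ge0. Qed.

Lemma normcD z w : normc (z + w) <= normc z + normc w.
Proof. exact: le_normcD. Qed.

Lemma normcNE z : normc (- z) = normc z.
Proof. exact: normcN. Qed.

Lemma normc0E : normc (0 : R[i]) = 0.
Proof. exact: normc0. Qed.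

Lemma normc1E : normc (1 : R[i]) = 1.
Proof. exact: normc1. Qed.

Lemma normc_sum (I : Type) (s : seq I) (P : pred I) (F : I -> R[i]) :
  normc (\sum_(i <- s | P i) F i) <= \sum_(i <- s | P i) normc (F i).
Proof.
elim/big_rec2: _ => [|i x y _ le_yx]; first by rewrite normc0.
by apply: le_trans (normcD _ _) _; rewrite lerD2l.
Qed.

Lemma normc_prod (I : Type) (s : seq I) (P : pred I) (F : I -> R[i]) :
  normc (\prod_(i <- s | P i) F i) = \prod_(i <- s | P i) normc (F i).
Proof. by elim/big_rec2: _ => [|i x y _ <-]; rewrite ?normc1 ?normcM. Qed.

Lemma normcX z n : normc (z ^+ n) = normc z ^+ n.
Proof. by elim: n => [|n IH]; rewrite ?expr0 ?normc1 // !exprS normcM IH. Qed.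

Lemma normcB z w : normc (z - w) = normc (w - z).
Proof. by rewrite -normcNE opprB. Qed.

Lemma normc_distD w z t : normc (z - t) <= normc (z - w) + normc (w - t).
Proof. by rewrite -(subrKA w); exact: normcD. Qed.

Lemma normcJE z : normc z^*%C = normc z.
Proof. by case: z => a b; rewrite /normc /= sqrrN. Qed.

Lemma normcR (x : R) : normc x%:C%C = `|x|.
Proof. by rewrite /normc /= expr0n addr0 sqrtr_sqr. Qed.

Lemma normc_nat n : normc n%:R = n%:R :> R.
Proof. by rewrite -[RHS]normr_nat -normcR rmorph_nat. Qed.

Lemma normc_eq0 z : (normc z == 0) = (z == 0).
Proof. by apply/eqP/eqP => [/eq0_normc //|->]; rewrite normc0. Qed.

Lemma normc_gt0 z : (0 < normc z) = (z != 0).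
Proof. by rewrite lt_def normc_ge0 andbT normc_eq0. Qed.

Lemma mul_conjc z : z * z^*%C = (normc z ^+ 2)%:C%C.
Proof.
case: z => a b; rewrite /normc /= sqr_sqrtr ?addr_ge0 ?sqr_ge0 //.
by apply/eqP; rewrite eq_complex /= ; apply/andP; split; apply/eqP; ring.
Qed.

Lemma unit_conjc z : normc z = 1 -> z * z^*%C = 1.
Proof. by move=> h; rewrite mul_conjc h expr1n. Qed.

Lemma ler_Re_normc z : `|complex.Re z| <= normc z.
Proof. by case: z => a b; rewrite /normc /= -sqrtr_sqr ler_wsqrtr // lerDl sqr_ge0. Qed.

Lemma ler_Im_normc z : `|complex.Im z| <= normc z.
Proof. by case: z => a b; rewrite /normc /= -sqrtr_sqr ler_wsqrtr // lerDr sqr_ge0. Qed.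

Lemma normc_le_ReIm z : normc z <= `|complex.Re z| + `|complex.Im z|.
Proof.
case: z => a b; rewrite /normc /= -(ler_pXn2r (n := 2)) ?nnegrE ?addr_ge0 ?sqrtr_ge0 //.
rewrite sqr_sqrtr ?addr_ge0 ?sqr_ge0 // -[a ^+ 2]real_normK ?num_real //.
rewrite -[b ^+ 2]real_normK ?num_real //.
have := normr_ge0 a; have := normr_ge0 b; nra.
Qed.

End Modulus.

(** * The circle exponential and its inverse *)

Section CircleExponential.
Variable R : realType.

Definition cis (t : R) : R[i] := (cos (2 * pi * t) +i* sin (2 * pi * t))%C.

Lemma cisD s t : cis (s + t) = cis s * cis t.
Proof.
rewrite /cis mulrDr cosD sinD; apply/eqP; rewrite eq_complex /=.
by rewrite eqxx /= addrC mulrC.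
Qed.

Lemma cis0 : cis 0 = 1.
Proof. by rewrite /cis mulr0 cos0 sin0. Qed.

Lemma normc_cis t : normc (cis t) = 1.
Proof. by rewrite /normc /cis /= cos2Dsin2 sqrtr1. Qed.

Lemma cis_neq0 t : cis t != 0.
Proof. by rewrite -normc_eq0 normc_cis oner_eq0. Qed.

Lemma cisN t : cis (- t) = (cis t)^-1.
Proof. by apply: (mulIf (cis_neq0 t)); rewrite -cisD addNr cis0 mulVf ?cis_neq0. Qed.

Lemma cisB s t : cis (s - t) = cis s / cis t.
Proof. by rewrite cisD cisN. Qed.

Lemma cisM_nat t n : cis (n%:R * t) = cis t ^+ n.
Proof.
elim: n => [|n IH]; first by rewrite mul0r cis0.
by rewrite exprS -IH -cisD -nat1r mulrDl mul1r.
Qed.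

Lemma cisM_int t (m : int) : cis (m%:~R * t) = cis t ^ m.
Proof.
case: m => n; first by rewrite -pmulrn cisM_nat.
by rewrite NegzE mulrNz mulNr cisN -pmulrn cisM_nat.
Qed.

Lemma cis1 : cis 1 = 1.
Proof. by rewrite /cis mulr1 mulr_natl cos2pi sin2pi. Qed.

Lemma cis_int (m : int) : cis m%:~R = 1.
Proof. by rewrite -[_%:~R]mulr1 cisM_int cis1 exp1rz. Qed.

Lemma cos2pi_inj01 (t : R) : 0 <= t < 1 -> cos (2 * pi * t) = 1 -> t = 0.
Proof.
move=> /andP[t0 t1] ct; have pi0 := pi_gt0 R.
have [th|th] := leP t (2^-1).
  have : 2 * pi * t = 0.
    apply: cos_inj; rewrite ?in_itv /= ?cos0 ?lexx ?pi_ge0 //.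
    by rewrite !mulr_ge0 ?pi_ge0 //=; nra.
  by move/eqP; rewrite mulf_eq0 mulf_eq0 pnatr_eq0 /= gt_eqF //= => /eqP.
have : 2 * pi * (1 - t) = 0.
  apply: cos_inj; rewrite ?in_itv /= ?cos0 ?lexx ?pi_ge0 //.
    by rewrite !mulr_ge0 ?pi_ge0 //= ?subr_ge0 ?(ltW t1) //; nra.
  rewrite -[LHS]cosN -[RHS]ct -[LHS]cosD2pi; congr cos; rewrite -mulr_natl; ring.
by nra.
Qed.

Lemma cis_eq1 t : cis t = 1 -> exists m : int, t = m%:~R.
Proof.
move=> e1; exists (Num.floor t).
have f0 : 0 <= t - (Num.floor t)%:~R < 1.
  by rewrite subr_ge0 ?ge_floor ?floor_le /= ltrBlDr -[1]/(1%:~R) addrC -intrD lt_succ_floor.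
have: cis (t - (Num.floor t)%:~R) = 1 by rewrite cisB e1 cis_int divr1.
by case=> /(cos2pi_inj01 f0)/eqP; rewrite subr_eq0 => /eqP.
Qed.

Lemma cis_surj z : normc z = 1 -> exists2 t, cis t = z & 0 <= t <= 1.
Proof.
case: z => a b; rewrite /normc /= => hn; have pi0 := pi_gt0 R.
have ab1 : a ^+ 2 + b ^+ 2 = 1.
  by rewrite -[LHS]sqr_sqrtr ?addr_ge0 ?sqr_ge0 // hn expr1n.
have ha : -1 <= a <= 1 by nra.
have P0 : 2 * pi != 0 :> R by rewrite mulf_neq0 // gt_eqF.
have a0 := acos_ge0 ha; have a1 := acos_lepi ha.
have ca : cos (acos a) = a by rewrite acosK.
have sa : sin (acos a) = `|b|.
  by rewrite sin_acos // -sqrtr_sqr; congr Num.sqrt; lra.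
case: (leP 0 b) => hb.
  exists (acos a / (2 * pi)).
    by rewrite /cis mulrC divfK // ca sa ger0_norm.
  by rewrite divr_ge0 ?mulr_ge0 ?pi_ge0 //= ler_pdivrMr; nra.
exists (1 - acos a / (2 * pi)).
  rewrite cisB cis1 div1r -cisN /cis mulrN cosN sinN mulrC divfK // ca sa.
  by rewrite ltr0_norm // opprK.
have h : 0 <= acos a / (2 * pi) <= 1.
  by rewrite divr_ge0 ?mulr_ge0 ?pi_ge0 //= ler_pdivrMr; nra.
by lra.
Qed.

Lemma cis_cont0 (e : R) : 0 < e -> exists2 r, 0 < r & forall t : R, `|t| < r -> normc (cis t - 1) < e.
Proof.
move=> e0; have e2 : 0 < e / 2 by rewrite divr_gt0.
have hc : (fun t : R => cos (2 * pi * t)) t @[t --> (0 : R)] --> (1 : R).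
  rewrite -[X in _ --> X]cos0 -[X in cos X](mulr0 (2 * pi)).
  apply: continuous_comp; last exact: continuous_cos.
  by apply: cvgM; [exact: cvg_cst | exact: cvg_id].
have hs : (fun t : R => sin (2 * pi * t)) t @[t --> (0 : R)] --> (0 : R).
  rewrite -[X in _ --> X]sin0 -[X in sin X](mulr0 (2 * pi)).
  apply: continuous_comp; last exact: continuous_sin.
  by apply: cvgM; [exact: cvg_cst | exact: cvg_id].
have /cvgrPdist_lt/(_ _ e2) := hc; have /cvgrPdist_lt/(_ _ e2) := hs.
move=> h1 h2; have h3 := filterI h1 h2.
have {h1 h2}[r /= r0 hr] := h3.
exists r => // t tr; apply: le_lt_trans (normc_le_ReIm _) _ => /=; have [] := hr t; first by rewrite /ball_ /= sub0r normrN.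
rewrite sub0r normrN distrC => h1 h2.
rewrite subr0; lra.
Qed.

Lemma cis_ucont (e : R) : 0 < e ->
  exists2 r, 0 < r & forall s t : R, `|s - t| < r -> normc (cis s - cis t) < e.
Proof.
move=> /cis_cont0[r r0 hr]; exists r => // s t /hr.
have -> : cis s - cis t = cis t * (cis (s - t) - 1).
  by rewrite mulrBr mulr1 -cisD addrCA subrr addr0.
by rewrite normcM normc_cis mul1r.
Qed.

Definition arg (z : R[i]) : R :=
  if pselect (exists2 t, cis t = z & 0 <= t <= 1) is left h
  then sval (cid2 h) else 0.

Lemma cis_arg z : normc z = 1 -> cis (arg z) = z.
Proof.
by move=> /cis_surj h; rewrite /arg; case: pselect => // h'; case: cid2.
Qed.

Lemma arg01 z : 0 <= arg z <= 1.
Proof. by rewrite /arg; case: pselect => [h|_]; [case: cid2|rewrite lexx ler01]. Qed.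

End CircleExponential.

(** * Deciding identities in abelian groups by reflection *)

Inductive zexp := ZVar of nat | ZZero | ZAdd of zexp & zexp | ZOpp of zexp.

Section AbelianGroupReflection.
Variable V : zmodType.

Fixpoint zeval (env : seq V) e : V :=
  match e with
  | ZVar i => nth 0 env i
  | ZZero => 0
  | ZAdd e1 e2 => zeval env e1 + zeval env e2
  | ZOpp e1 => - zeval env e1
  end.

Fixpoint zcoef e i : int :=
  match e with
  | ZVar j => if eqn i j then 1 else 0
  | ZZero => 0
  | ZAdd e1 e2 => zcoef e1 i + zcoef e2 i
  | ZOpp e1 => - zcoef e1 i
  end.

Lemma zevalE env e : zeval env e = \sum_(i < size env) env`_i *~ zcoef e i.
Proof.
elim: e => [j||e1 IH1 e2 IH2|e1 IH1] /=; rewrite ?IH1 ?IH2.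
- have [hj|hj] := ltnP j (size env); last first.
    rewrite nth_default // big1 // => i _; case: eqnP => // e.
    by move: (ltn_ord i); rewrite e ltnNge hj.
  rewrite (bigD1 (Ordinal hj)) //= big1 ?addr0; first by case: eqnP.
  by move=> i; rewrite -val_eqE /= => /negbTE hi; case: eqnP => [/eqP|]; rewrite ?hi.
- by rewrite big1 // => i _; rewrite mulr0z.
- by rewrite -big_split; apply: eq_bigr => i _; rewrite mulrzDr.
- by rewrite -sumrN; apply: eq_bigr => i _; rewrite mulrNz.
Qed.

Lemma zeval_eq env e1 e2 :
  all (fun i => zcoef e1 i == zcoef e2 i) (iota 0 (size env)) ->
  zeval env e1 = zeval env e2.
Proof.
move=> /allP h; rewrite !zevalE; apply: eq_bigr => i _.
by rewrite (eqP (h i _)) // mem_iota ltn_ord.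
Qed.

End AbelianGroupReflection.

Ltac zfind x l :=
  match l with
  | x :: _ => constr:(O)
  | _ :: ?l' => let n := zfind x l' in constr:(S n)
  end.

(** The doubled wildcard is backtracking: the second branch is reached when [zfind] fails, that is,
    when the atom is new. *)
Ltac zatoms t l :=
  match t with
  | GRing.add ?a ?b => let l1 := zatoms a l in zatoms b l1
  | GRing.opp ?a => zatoms a l
  | GRing.zero => l
  | _ => match l with
         | _ => let n := zfind t l in l
         | _ => constr:(t :: l)
         end
  end.

Ltac zreify t l :=
  match t with
  | GRing.add ?a ?b => let e1 := zreify a l in let e2 := zreify b l in constr:(ZAdd e1 e2)
  | GRing.opp ?a => let e := zreify a l in constr:(ZOpp e)
  | GRing.zero => constr:(ZZero)
  | _ => let n := zfind t l in constr:(ZVar n)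
  end.

(* decides equalities in abelian groups; atoms are compared syntactically *)
Ltac zmod :=
  lazymatch goal with
  | |- @eq ?T ?a ?b =>
    let l1 := zatoms a (@nil T) in let l := zatoms b l1 in
    let e1 := zreify a l in let e2 := zreify b l in
    exact: (@zeval_eq _ l e1 e2 isT)
  end.

(** * Simultaneous approximation by characters *)

Section Growth.
Variable R : realType.

Lemma bernoulli_ineq (x : R) n : 0 <= x -> 1 + n%:R * x <= (1 + x) ^+ n.
Proof.
move=> x0; elim: n => [|n IH]; first by rewrite mul0r addr0 expr0.
rewrite exprS -nat1r mulrDl mul1r.
have := ler_wpM2l (addr_ge0 ler01 x0) IH; have : 0 <= n%:R * x ^+ 2 by rewrite mulr_ge0 ?sqr_ge0.
nra.
Qed.

(** Bernoulli's inequality for the exponent [t] is raised to the power [M.+1], one more than the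
    polynomial degree; the surplus factor [1 + t%:R * x] beats the constant [D]. *)
Lemma poly_lt_exp (q : R) M : 1 < q -> exists p, (p.+1)%:R ^+ M < q ^+ p.
Proof.
move=> q1; pose x := Num.min (q - 1) 1.
have x0 : 0 < x by rewrite lt_min subr_gt0 q1 ltr01.
have x1 : x <= 1 by rewrite ge_min lexx orbT.
have xq : 1 + x <= q by rewrite -lerBrDl ge_min lexx.
pose k := M.+1; pose D := (k%:R / x) ^+ M.
have D0 : 0 <= D by rewrite exprn_ge0 // divr_ge0 // ltW.
pose t := (Num.truncn (D / x)).+1.
have tD : D < 1 + t%:R * x.
  have : D / x < t%:R by rewrite truncnS_gt.
  by rewrite ltr_pdivrMr //; lra.
exists (k * t)%N.
have h1 : (1 + t%:R * x) ^+ k <= q ^+ (k * t).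
  rewrite mulnC exprM lerXn2r ?nnegrE ?addr_ge0 ?mulr_ge0 ?exprn_ge0 ?(ltW x0) //.
    by rewrite (le_trans _ xq) // addr_ge0 // ltW.
  apply: le_trans (bernoulli_ineq _ (ltW x0)) _.
  by rewrite lerXn2r ?nnegrE ?addr_ge0 ?(ltW x0) // (le_trans _ xq) // addr_ge0 // ltW.
apply: lt_le_trans h1.
have h2 : ((k * t).+1)%:R <= k%:R / x * (1 + t%:R * x).
  have -> : k%:R / x * (1 + t%:R * x) = k%:R / x + k%:R * t%:R.
    by field; rewrite gt_eqF.
  rewrite -nat1r natrM lerD2r ler_pdivlMr // mul1r.
  by apply: le_trans x1 _; rewrite ler1n.
apply: (@le_lt_trans _ _ (D * (1 + t%:R * x) ^+ M)).
  rewrite /D -exprMn lerXn2r ?nnegrE //.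
  by rewrite !mulr_ge0 ?invr_ge0 ?addr_ge0 ?mulr_ge0 // ltW.
rewrite exprS ltr_pM2r // exprn_gt0 // ltr_pwDl //.
by rewrite mulr_ge0 // ltW.
Qed.

End Growth.

Section Kronecker.
Variables (R : realType) (V : zmodType).
Implicit Types (Y : set V) (g : V -> R[i]).

(** Purely algebraic; continuity is kept apart in [small_char], so that Kronecker's theorem also
    applies to groups without topology, such as the integer polynomials. *)
Definition unit_char g :=
  (forall x y, g (x + y) = g x * g y) /\ (forall x, normc (g x) = 1).

Lemma unit_char_neq0 g x : unit_char g -> g x != 0.
Proof. by case=> _ h; rewrite -normc_eq0 h oner_eq0. Qed.

Lemma unit_char0 g : unit_char g -> g 0 = 1.
Proof.
move=> hg; apply: (mulfI (unit_char_neq0 0 hg)).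
by rewrite mulr1 -hg.1 addr0.
Qed.

Lemma unit_charMn g x n : unit_char g -> g (x *+ n) = g x ^+ n.
Proof.
move=> hg; elim: n => [|n IH]; first by rewrite mulr0n unit_char0.
by rewrite mulrS hg.1 IH exprS.
Qed.

Lemma unit_charN g x : unit_char g -> g (- x) = (g x)^-1.
Proof.
move=> hg; apply: (mulIf (unit_char_neq0 x hg)).
by rewrite -hg.1 addNr unit_char0 // mulVf ?unit_char_neq0.
Qed.

Lemma unit_charB g x y : unit_char g -> g (x - y) = g x / g y.
Proof. by move=> hg; rewrite hg.1 unit_charN. Qed.

Lemma unit_charMz g x (m : int) : unit_char g -> g (x *~ m) = g x ^ m.
Proof.
move=> hg; case: m => n; first exact: unit_charMn.
by rewrite NegzE mulrNz unit_charN // -pmulrn unit_charMn.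
Qed.

Lemma unit_char_sum g (I : Type) (s : seq I) (P : pred I) (F : I -> V) :
  unit_char g -> g (\sum_(i <- s | P i) F i) = \prod_(i <- s | P i) g (F i).
Proof.
move=> hg; elim/big_rec2: _ => [|i x y _ <-]; first exact: unit_char0.
by rewrite hg.1.
Qed.

Lemma subgroupN Y x : is_subgroup Y -> Y x -> Y (- x).
Proof. by move=> [Y0 hY] Yx; rewrite -sub0r; exact: hY. Qed.

Lemma subgroupD Y x y : is_subgroup Y -> Y x -> Y y -> Y (x + y).
Proof. by move=> hY Yx Yy; rewrite -[y]opprK; apply: hY.2 => //; exact: subgroupN. Qed.

Lemma subgroupMn Y x n : is_subgroup Y -> Y x -> Y (x *+ n).
Proof.
move=> hY Yx; elim: n => [|n IH]; first by rewrite mulr0n; exact: hY.1.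
by rewrite mulrS; exact: subgroupD.
Qed.

Lemma geometric_sum_bound (q : R[i]) N : normc q = 1 -> q != 1 ->
  normc (\sum_(n < N) q ^+ n) <= 2 / normc (1 - q).
Proof.
move=> q1 qn1; have q0 : 0 < normc (1 - q) by rewrite normc_gt0 subr_eq0 eq_sym.
rewrite ler_pdivlMr // -normcM mulrC -opprB mulNr -subrX1 normcNE.
apply: le_trans (normcD _ _) _; rewrite normcNE normcX q1 expr1n normc1E; lra.
Qed.

(* Averaging over multiples of an element separating two characters damps one of
   them while fixing the other; iterating isolates the wanted coefficients. *)
Lemma char_coef_bound Y (I : finType) (chi : I -> V -> R[i]) (c : I -> R[i]) i0 (B : R) :
  is_subgroup Y -> (forall i, unit_char (chi i)) ->
  (forall y, Y y -> normc (\sum_i c i * chi i y) <= B) ->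
  normc (\sum_(i | `[< forall y, Y y -> chi i y = chi i0 y >]) c i) <= B.
Proof.
move=> hY hchi hB.
set same := fun i => `[< forall y, Y y -> chi i y = chi i0 y >].
have step (js : seq I) (eta : R) : 0 < eta -> (forall j, j \in js -> ~~ same j) ->
  exists kap : I -> R[i], [/\ forall i, normc (kap i) <= 1,
    forall i, same i -> kap i = 1, forall j, j \in js -> normc (kap j) <= eta &
    forall y, Y y -> normc (\sum_i kap i * c i * chi i y) <= B].
  move=> eta0; elim: js => [|j js IH] hjs.
    exists (fun=> 1); split => //; first by move=> i; rewrite normc1E.
    by move=> y Yy; under eq_bigr do rewrite mul1r; exact: hB.
  have [kap [k1 k2 k3 k4]] := IH (fun j' hj' => hjs j' (@mem_behead _ (j :: js) j' hj')).
  have /asboolPn/existsNP[v /not_implyP[Yv /eqP hv]] := hjs j (mem_head _ _).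
  pose q i := chi i v / chi i0 v.
  have q1 i : normc (q i) = 1.
    by rewrite normcM normcV (hchi i).2 (hchi i0).2 divr1.
  have qj : q j != 1.
    rewrite -subr_eq0 -[1](divff (unit_char_neq0 v (hchi i0))) -mulrBl.
    by rewrite mulf_neq0 ?invr_neq0 ?unit_char_neq0 // subr_eq0.
  pose b := normc (1 - q j).
  have b0 : 0 < b by rewrite normc_gt0 subr_eq0 eq_sym.
  pose N := (Num.truncn (2 / b / eta)).+1.
  have N0 : 0 < N%:R :> R by [].
  pose A i := (\sum_(n < N) q i ^+ n) / N%:R.
  have A1 i : normc (A i) <= 1.
    rewrite normcM normcV normc_nat ler_pdivrMr // mul1r.
    apply: le_trans (normc_sum _ _ _) _.
    by under eq_bigr do rewrite normcX q1 expr1n; rewrite sumr_const card_ord.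
  exists (fun i => A i * kap i); split.
  - by move=> i; rewrite normcM mulr_ile1 ?normc_ge0.
  - move=> i si; rewrite k2 // mulr1 /A.
    have -> : q i = 1 by rewrite /q (asboolP _ si) // divff ?unit_char_neq0.
    under eq_bigr do rewrite expr1n.
    by rewrite sumr_const card_ord divff // pnatr_eq0.
  - move=> j'; rewrite inE => /orP[/eqP->|hj']; rewrite normcM; last first.
      by rewrite -[eta]mul1r ler_pM ?normc_ge0 // k3.
    rewrite -[eta]mulr1 ler_pM ?normc_ge0 //.
    rewrite normcM normcV normc_nat ler_pdivrMr //.
    apply: le_trans (geometric_sum_bound _ (q1 _) qj) _.
    by rewrite -/b -ler_pdivrMl // mulrC ltW // truncnS_gt.
  - move=> y Yy.
    have -> : \sum_i A i * kap i * c i * chi i y =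
      (\sum_(n < N) (chi i0 v) ^- n * \sum_i kap i * c i * chi i (y + v *+ n)) / N%:R.
      under [in RHS]eq_bigr do rewrite mulr_sumr.
      rewrite exchange_big /= mulr_suml; apply: eq_bigr => i _.
      have -> : A i * kap i * c i * chi i y =
        (\sum_(n < N) q i ^+ n) * (kap i * c i * chi i y) / N%:R by rewrite /A; ring.
      rewrite mulr_suml; congr (_ / _); apply: eq_bigr => n _.
      by rewrite (hchi i).1 unit_charMn // /q expr_div_n; ring.
    rewrite normcM normcV normc_nat ler_pdivrMr //.
    apply: le_trans (normc_sum _ _ _) _.
    have -> : B * N%:R = \sum_(n < N) B by rewrite sumr_const card_ord mulr_natr.
    apply: ler_sum => n _; rewrite normcM normcV normcX (hchi i0).2 expr1n invr1 mul1r.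
    by apply: k4; apply: subgroupD => //; exact: subgroupMn.
apply/ler_addgt0Pr => eps eps0.
pose S := \sum_(i | ~~ same i) normc (c i).
have S0 : 0 <= S by apply: sumr_ge0 => i _; exact: normc_ge0.
pose eta := eps / (S + 1).
have eta0 : 0 < eta by rewrite divr_gt0 // ltr_wpDl.
have [kap [k1 k2 k3 k4]] := step (enum [pred i | ~~ same i]) eta eta0
  (fun j => fun h => etrans (esym (mem_enum _ _)) h).
(* At [0] all characters equal 1, so the damped sum is the wanted sum of coefficients up to an error
   [eta * S <= eps]. *)
have /k4 := hY.1; under eq_bigr do rewrite unit_char0 // mulr1.
rewrite (bigID same) /= => h.
have -> : \sum_(i | same i) c i = \sum_(i | same i) kap i * c i.
  by apply: eq_bigr => i si; rewrite k2 // mul1r.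
have h2 : normc (\sum_(i | ~~ same i) kap i * c i) <= eps.
  apply: le_trans (normc_sum _ _ _) _; apply: (@le_trans _ _ (eta * S)).
    rewrite mulr_sumr; apply: ler_sum => i si; rewrite normcM ler_wpM2r ?normc_ge0 //.
    by apply: k3; rewrite mem_enum.
  by rewrite /eta -mulrA ler_piMr ?ltW // mulrC ltr_pdivrMr ?ltr_wpDl // mul1r ltrDl.
set a := \sum_(i | same i) _ in h *; set b := \sum_(i | ~~ same i) _ in h h2 *.
have : normc a <= normc (a + b) + normc b by have := normcB (a + b) b; have := normc_distD 0 (a + b) b; rewrite addrK sub0r subr0 normcNE => + _.
lra.
Qed.

(* Bohr's proof: the coefficients of the [p]-th power of [1 + \sum_j g j * (z j)^*]
   bound its supremum below, which forces the supremum to be [m.+1]. *)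
Lemma kronecker_approx Y m (g : 'I_m -> V -> R[i]) (z : 'I_m -> R[i]) :
  is_subgroup Y -> (forall j, unit_char (g j)) -> (forall j, normc (z j) = 1) ->
  (forall al be : 'I_m -> nat,
    (forall y, Y y -> \prod_j g j y ^+ al j = \prod_j g j y ^+ be j) ->
    \prod_j z j ^+ al j = \prod_j z j ^+ be j) ->
  forall eps : R, 0 < eps ->
  exists2 y, Y y & forall j, normc (g j y - z j) < eps.
Proof.
move=> hY hg hz hrel eps eps0; apply: contrapT => hno.
have far y : Y y -> exists j, eps <= normc (g j y - z j).
  move=> Yy; apply: contrapT => h; apply: hno; exists y => // j.
  by rewrite ltNge; apply/negP => h'; apply: h; exists j.
have m0 : (0 < m)%N by have [[i hi] _] := far 0 hY.1; exact: leq_ltn_trans hi.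
pose I := option 'I_m.
pose G (j : I) := if j is Some j' then g j' else fun=> 1.
pose Z (j : I) := if j is Some j' then (z j')^*%C else 1.
have hG j : unit_char (G j).
  case: j => [j|]; first exact: hg.
  by split => [x y|x] /=; rewrite ?mulr1 ?normc1E.
have hZ j : normc (Z j) = 1 by case: j => [j|]; [rewrite normcJE hz | exact: normc1E].
pose F y := \sum_j Z j * G j y.
have cI : #|{: I}| = m.+1 by rewrite card_option card_ord.
pose M : R := m.+1%:R.
(* By the parallelogram law, two unit numbers at distance at least [eps] have a sum of modulus at
   most [Num.sqrt (4 - eps ^+ 2)]. [del] is the resulting loss, capped so that [M - del] stays at
   least 1. *)
pose del := Num.min 1 (2 - Num.sqrt (4 - eps ^+ 2)).
have del0 : 0 < del.
  rewrite lt_min ltr01 subr_gt0.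
  have -> : 2 = Num.sqrt (2 ^+ 2) :> R by rewrite sqrtr_sqr ger0_norm.
  rewrite ltr_sqrt ?exprn_gt0 //.
  have -> : 2 ^+ 2 = 4 :> R by ring.
  by rewrite ltrBlDr ltrDl exprn_gt0.
have del1 : del <= 1 by rewrite ge_min lexx.
have FB y : Y y -> normc (F y) <= M - del.
  move=> Yy; have [j hj] := far y Yy.
  rewrite /F (bigD1 None) // (bigD1 (Some j)) //= mul1r addrA.
  apply: le_trans (normcD _ _) _.
  have h1 : normc (1 + (z j)^*%C * g j y) <= 2 - del.
    set r := _ * _; have r1 : normc r = 1 by rewrite normcM normcJE hz (hg j).2 mulr1.
    have r2 : normc (r - 1) = normc (g j y - z j).
      have -> : r - 1 = (z j)^*%C * (g j y - z j).
        by rewrite mulrBr -/r (mulrC _ (z j)) unit_conjc.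
      by rewrite normcM normcJE hz mul1r.
    have par : normc (1 + r) ^+ 2 + normc (r - 1) ^+ 2 = 4.
      case: (r) r1 => a b; rewrite /normc /= => r1.
      have ab1 : a ^+ 2 + b ^+ 2 = 1.
        by rewrite -[LHS]sqr_sqrtr ?addr_ge0 ?sqr_ge0 // r1 expr1n.
      by rewrite !sqr_sqrtr ?addr_ge0 ?sqr_ge0 //; nra.
    have : normc (1 + r) <= Num.sqrt (4 - eps ^+ 2).
      rewrite -[normc (1 + r)]ger0_norm ?normc_ge0 // -sqrtr_sqr ler_wsqrtr //.
      rewrite r2 in par; nra.
    have : del <= 2 - Num.sqrt (4 - eps ^+ 2) by rewrite ge_min lexx orbT.
    lra.
  have h2 : normc (\sum_(i | (i != None) && (i != Some j)) Z i * G i y) <= M - 2.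
    apply: le_trans (normc_sum _ _ _) _.
    under eq_bigr do rewrite normcM hZ (hG _).2 mulr1.
    rewrite sumr_const.
    have : (#|[pred i : I | (i != None) && (i != Some j)]| + 2 = m.+1)%N.
      rewrite addn2 -cI (cardD1 None predT) (cardD1 (Some j) [predD1 predT & None]).
      rewrite !inE /= !add1n; congr _.+2.
      by apply: eq_card => i; rewrite !inE andbC andbT.
    by move=> e; rewrite /M -e natrD addrK.
  lra.
pose B := M - del.
have M2 : 2 <= M by rewrite /M ler_nat.
have B1 : 1 <= B by rewrite /B; lra.
have MB1 : 1 < M / B.
  by rewrite ltr_pdivlMr ?mul1r /B ?ltrBlDr ?ltrDl //; lra.
(* The power [p] is so large that [(M / B) ^+ p] exceeds [p.+1 ^ m.+1], the size of the type of
   exponent vectors; one vector must then collect too many of the [m.+1 ^ p] words. *)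
have [p hp] := poly_lt_exp m.+1 MB1.
pose W := {ffun 'I_p -> I}; pose Cn := {ffun I -> 'I_p.+1}.
pose cnt (w : W) : Cn := [ffun j => inord #|[pred i | w i == j]|].
have cntE w j : cnt w j = #|[pred i | w i == j]| :> nat.
  by rewrite ffunE inordK // ltnS -[X in (_ <= X)%N]card_ord max_card.
have prodcnt (H : I -> R[i]) (w : W) : \prod_i H (w i) = \prod_j H j ^+ cnt w j.
  rewrite (partition_big w predT) //=; apply: eq_bigr => j _.
  by rewrite (eq_bigr (fun=> H j)) => [|i /eqP->//]; rewrite prodr_const cntE.
pose chi (w : W) y := \prod_i G (w i) y.
pose c (w : W) := \prod_i Z (w i).
have hchi w : unit_char (chi w).
  split => [x y|x].
    by rewrite /chi -big_split; apply: eq_bigr => i _; exact: (hG _).1.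
  by rewrite /chi normc_prod big1 // => i _; exact: (hG _).2.
have hc w : normc (c w) = 1 by rewrite /c normc_prod big1.
have FE y : \sum_w c w * chi w y = F y ^+ p.
  rewrite -[p in RHS]card_ord -prodr_const bigA_distr_bigA /=.
  by apply: eq_bigr => w _; rewrite /c /chi -big_split.
have [w0 hw0] : exists w0, (m.+1 ^ p <= #|[pred w | cnt w == cnt w0]| * p.+1 ^ m.+1)%N.
  apply: contrapT => h; have : (m.+1 ^ p * p.+1 ^ m.+1 <= (m.+1 ^ p).-1 * p.+1 ^ m.+1)%N.
    have cC : #|{: Cn}| = (p.+1 ^ m.+1)%N by rewrite card_ffun card_ord cI.
    have cW : #|{: W}| = (m.+1 ^ p)%N by rewrite card_ffun card_ord cI.
    rewrite -{1}cW -sum1_card (partition_big cnt predT) //= big_distrl /=.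
    rewrite [X in (_ <= X)%N]mulnC -[X in (_ <= X * _)%N]cC -sum_nat_const; apply: leq_sum => v _.
    rewrite sum1_card; case: (pickP [pred w | cnt w == v]) => [w /= /eqP <-|h0].
      rewrite -ltnS prednK ?expn_gt0 // ltnNge; apply/negP => h'; apply: h.
      by exists w.
    by rewrite (eq_card0 h0).
  by rewrite leqNgt ltn_mul2r expn_gt0 /= prednK ?expn_gt0 // leqnn.
have FBp y : Y y -> normc (\sum_w c w * chi w y) <= B ^+ p.
  move=> Yy; rewrite FE normcX lerXn2r ?nnegrE ?normc_ge0 ?FB //.
  by apply: le_trans B1.
have := char_coef_bound w0 hY hchi FBp.
(* Words with the same character on [Y] have the same coefficient by [hrel], so nothing cancels in
   this sum. *)
have -> : \sum_(w | `[< forall y, Y y -> chi w y = chi w0 y >]) c w =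
  c w0 * #|[pred w | `[< forall y, Y y -> chi w y = chi w0 y >]]|%:R.
  rewrite mulr_natr -sumr_const; apply: eq_bigr => w /asboolP hw.
  rewrite /c !prodcnt (bigD1 None) //= [RHS](bigD1 None) //= !expr1n !mul1r.
  have red (H : I -> R[i]) : \prod_(i | i != None) H i = \prod_(j < m) H (Some j).
    rewrite (reindex_omap (Some : 'I_m -> I) id) //=; last by case.
    by apply: eq_bigl => j; rewrite eqxx.
  rewrite !red -[LHS]conjcK -[RHS]conjcK; congr (conjc _); rewrite !rmorph_prod /=.
  rewrite (eq_bigr (fun j => z j ^+ cnt w (Some j))); last first.
    by move=> j _; rewrite rmorphXn /= conjcK.
  rewrite [RHS](eq_bigr (fun j => z j ^+ cnt w0 (Some j))); last first.
    by move=> j _; rewrite rmorphXn /= conjcK.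
  apply: hrel => y Yy; have := hw y Yy; rewrite /chi.
  rewrite !(prodcnt (fun j => G j y)) (bigD1 None) //= [X in _ = X](bigD1 None) //=.
  by rewrite !expr1n !mul1r !red.
rewrite normcM hc mul1r normc_nat => h.
have {h} h : #|[pred w | cnt w == cnt w0]|%:R <= B ^+ p.
  apply: le_trans _ h; rewrite ler_nat.
  apply: subset_leq_card; apply/fintype.subsetP => w.
  rewrite unfold_in => /eqP e; rewrite unfold_in /=.
  apply/asboolP => y Yy.
  by rewrite /chi !(prodcnt (fun j => G j y)) e.
have : M ^+ p <= B ^+ p * (p.+1)%:R ^+ m.+1.
  apply: (@le_trans _ _ (#|[pred w | cnt w == cnt w0]| * p.+1 ^ m.+1)%:R).
    by rewrite -natrX ler_nat.
  by rewrite natrM natrX ler_wpM2r // exprn_ge0.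
rewrite leNgt => /negP; apply.
have B0 : 0 < B ^+ p by rewrite exprn_gt0 //; apply: lt_le_trans B1.
by rewrite mulrC -ltr_pdivlMr // -expr_div_n.
Qed.

End Kronecker.

(** * Metrizable compact groups *)

Lemma pigeonhole_lt n (I : finType) (F : 'I_n -> I) : (#|I| < n)%N ->
  exists i j : 'I_n, (i < j)%N /\ F i = F j.
Proof.
move=> In; have /injectivePn[i [j ij e]] : ~~ injectiveb F.
  by apply/negP => /injectiveP/leq_card; rewrite card_ord leqNgt In.
have [lt|] := ltnP i j; first by exists i, j.
by rewrite leq_eqVlt val_eqE eq_sym (negbTE ij) /= => lt; exists j, i.
Qed.

(** Limits along one such ultrafilter replace all extractions of subsequences. *)
Lemma ultra_nat : exists U : set_system nat, UltraFilter U /\ \oo `<=` U.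
Proof. exact: ultraFilterLemma. Qed.

Lemma ultra_fmap T S (u : T -> S) (U : set_system T) :
  UltraFilter U -> UltraFilter (u @ U).
Proof.
move=> UF; have PF := @ultra_proper _ _ UF; split => [|G GP sG]; first exact: fmap_proper_filter.
rewrite predeqE => A; split; last exact: sG.
move=> GA; have [//|UnA] := in_ultra_setVsetC (u @^-1` A) UF.
have /sG GnA : (u @ U) (~` A) by [].
have hI : G (A `&` ~` A) by exact: filterI.
by have /filter_ex[x []] := hI.
Qed.

Lemma ultraI T (U : set_system T) A B : UltraFilter U -> U A -> U B -> U (A `&` B).
Proof. by move=> UF; have PF := @ultra_proper _ _ UF; exact: filterI. Qed.

Lemma ultra_ex T (U : set_system T) A : UltraFilter U -> U A -> exists x, A x.
Proof. by move=> UF; have PF := @ultra_proper _ _ UF; exact: filter_ex. Qed.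

Section MetricGroup.
Variables (R : realType) (X : topologicalZmodType) (d : X -> X -> R).
Hypothesis hd : compatible_metric d.
Implicit Types (x y : X) (e r : R).

(* the maximum makes [sz] symmetric *)
Definition sz x := Num.max (d x 0) (d (- x) 0).

Lemma dist_sym x y : d x y = d y x. Proof. by case: hd. Qed.

Lemma dist_tri x y z : d x z <= d x y + d y z. Proof. by case: hd. Qed.

Lemma distxx x : d x x = 0. Proof. by case: hd => h _ _ _; apply/h. Qed.

Lemma dist_eq0 x y : d x y = 0 -> x = y. Proof. by case: hd => h _ _ _ /h. Qed.

Lemma dist_ge0 x y : 0 <= d x y.
Proof. by have := dist_tri x y x; rewrite distxx (dist_sym y x); lra. Qed.

Lemma nbhs_dist x (A : set X) :
  nbhs x A <-> exists2 e, 0 < e & forall y, d x y < e -> A y.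
Proof. by case: hd. Qed.

Lemma sz0 : sz 0 = 0. Proof. by rewrite /sz oppr0 distxx maxxx. Qed.

Lemma szN x : sz (- x) = sz x. Proof. by rewrite /sz opprK maxC. Qed.

Lemma dist0_sz x : d x 0 <= sz x. Proof. by rewrite le_max lexx. Qed.

Lemma sz_eq0 x : (forall e, 0 < e -> sz x < e) -> x = 0.
Proof.
move=> h; apply/dist_eq0/eqP; rewrite eq_le dist_ge0 andbT.
rewrite leNgt; apply/negP => /h; rewrite ltNge => /negP; apply; exact: dist0_sz.
Qed.

Lemma nbhs_sz (A : set X) :
  nbhs (0 : X) A <-> exists2 e, 0 < e & forall y, sz y < e -> A y.
Proof.
rewrite nbhs_dist; split=> -[e e0 h].
  exists e => // y hy; apply: h.
  by rewrite dist_sym; apply: le_lt_trans hy; exact: dist0_sz.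
have [t t0 ht] : exists2 t, 0 < t & forall y, d 0 y < t -> d 0 (- y) < e.
  apply/nbhs_dist; apply: (@opp_continuous X 0 [set y | d 0 y < e]).
  by rewrite oppr0; apply/nbhs_dist; exists e.
exists (Num.min e t) => [|y]; first by rewrite lt_min e0.
rewrite lt_min => /andP[y1 y2]; apply: h.
by rewrite /sz gt_max !(dist_sym _ 0) y1 ht.
Qed.

Lemma sz_nbhs0 e : 0 < e -> nbhs (0 : X) [set x | sz x < e].
Proof. by move=> e0; apply/nbhs_sz; exists e. Qed.

Lemma sz_sub e : 0 < e ->
  exists2 r, 0 < r & forall x y, sz x < r -> sz y < r -> sz (x - y) < e.
Proof.
move=> e0; have := @sub_continuous X (0, 0) [set x | sz x < e].
rewrite /= subr0 => /(_ (sz_nbhs0 e0)) [[A B] /= [nA nB] hAB].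
have [r r0 hr] := (nbhs_sz _).1 (filterI nA nB).
exists r => // x y hx hy; apply: (hAB (x, y)).
by split; [have [] := hr _ hx | have [] := hr _ hy].
Qed.

Lemma sz_add e : 0 < e ->
  exists2 r, 0 < r & forall x y, sz x < r -> sz y < r -> sz (x + y) < e.
Proof.
move=> /sz_sub[r r0 h]; exists r => // x y hx hy.
by rewrite -[y]opprK; apply: h => //; rewrite szN.
Qed.

Lemma sz_sum n e : 0 < e -> exists2 r, 0 < r &
  forall F : 'I_n -> X, (forall i, sz (F i) < r) -> sz (\sum_i F i) < e.
Proof.
elim: n e => [|n IH] e e0.
  by exists 1 => // F _; rewrite big_ord0 sz0.
have [r r0 hr] := sz_add e0; have [t t0 ht] := IH _ r0.
exists (Num.min r t) => [|F hF]; first by rewrite lt_min r0.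
rewrite big_ord_recr /=; apply: hr.
  by apply: ht => i; have := hF (widen_ord (leqnSn n) i); rewrite lt_min => /andP[].
by have := hF ord_max; rewrite lt_min => /andP[].
Qed.

Hypothesis cX : compact [set: X].

Lemma compact_ulim (U : set_system nat) (u : nat -> X) : UltraFilter U ->
  exists l, (forall e, 0 < e -> U [set k | sz (u k - l) < e]) /\
    (forall e, 0 < e -> U [set k | d l (u k) < e]) /\
    (forall C, closed C -> U [set k | C (u k)] -> C l).
Proof.
move=> UF; have PF := @ultra_proper _ _ UF.
have cC := cX; rewrite compact_ultra in cC.
have [l [_ ul]] := cC (u @ U) (ultra_fmap u UF) filterT.
exists l; split; [|split].
- move=> e e0; have : (fun k => u k - l) @ U --> l - l.
    apply: (@continuous_cvg _ _ _ U _ u (fun x => x - l) l) ul.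
    move=> A; rewrite -{1}[l]/(l, l).1 => hA.
    have := @sub_continuous X (l, l) A hA => -[[P Q] /= [nP nQ] h].
    by apply: filterS nP => x Px; apply: (h (x, l)); split => //; exact: nbhs_singleton.
  by rewrite subrr => /(_ _ (sz_nbhs0 e0)).
- move=> e e0; apply: (ul [set y | d l y < e]).
  by apply/nbhs_dist; exists e.
- by move=> C cl uC; exact: (@closed_cvg _ _ U _ u C cl uC l ul).
Qed.

(** The metric need not be translation invariant, but on a compact group smallness of the difference
    controls it uniformly: two sequences whose differences tend to 0 have the same ultralimit, so
    they cannot stay [e] apart. *)
Lemma sz_dist e : 0 < e -> exists2 r, 0 < r & forall x y, sz (x - y) < r -> d x y < e.
Proof.
move=> e0; apply: contrapT => hno.
have /choice[u hu] : forall k : nat, exists p : X * X,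
    sz (p.1 - p.2) < k.+1%:R^-1 /\ e <= d p.1 p.2.
  move=> k; apply: contrapT => h; apply: hno; exists k.+1%:R^-1 => // x y hxy.
  by rewrite ltNge; apply/negP => h'; apply: h; exists (x, y).
have [U [UF oU]] := ultra_nat; have PF := @ultra_proper _ _ UF.
have [l [h1 [h2 _]]] := compact_ulim (fun k => (u k).1) UF.
have [m [g1 [g2 _]]] := compact_ulim (fun k => (u k).2) UF.
have small r : 0 < r -> U [set k | sz ((u k).1 - (u k).2) < r].
  move=> r0; apply: oU; exists (Num.truncn r^-1) => // k /= hk.
  apply: lt_trans (hu k).1 _; rewrite invf_plt ?posrE //.
  by apply: lt_le_trans (truncnS_gt _) _; rewrite ler_nat ltnS.
have lm : l = m.
  apply/eqP; rewrite -subr_eq0; apply/eqP/sz_eq0 => t' lm0.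
  have [r r0 hr] := sz_sub lm0; have [t t0 ht] := sz_sub r0.
  have := ultraI UF (h1 _ t0) (ultraI UF (g1 _ t0) (small _ t0)).
  move=> /(ultra_ex UF)[k [/= k1 [k2 k3]]].
  have t00 : sz 0 < t by rewrite sz0.
  have := hr _ _ (ht _ _ k3 k1) (ht _ _ t00 k2).
  suff -> : (u k).1 - (u k).2 - ((u k).1 - l) - (0 - ((u k).2 - m)) = l - m.
    by [].
  by zmod.
have /(ultra_ex UF)[k [/= hk1 hk2]] := ultraI UF (h2 (e / 2) ltac:(lra)) (g2 (e / 2) ltac:(lra)).
have := (hu k).2; have := dist_tri (u k).1 l (u k).2.
by rewrite (dist_sym _ l) {2}lm; lra.
Qed.

Lemma totally_bounded e : 0 < e ->
  exists s : seq X, forall x, exists2 g, g \in s & sz (x - g) < e.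
Proof.
move=> e0; apply: contrapT => hno.
have far (s : seq X) : exists x, forall g, g \in s -> e <= sz (x - g).
  apply: contrapT => h; apply: hno; exists s => x.
  apply: contrapT => h'; apply: h; exists x => g gs.
  by rewrite leNgt; apply/negP => h''; apply: h'; exists g.
have [nxt hnxt] := choice far.
pose S k := iter k (fun s => nxt s :: s) [::].
pose u k := nxt (S k).
have uS j k : (j < k)%N -> u j \in S k.
  elim: k => // k IH; rewrite ltnS leq_eqVlt => /orP[/eqP->|/IH h]; rewrite inE ?eqxx //.
  by rewrite h orbT.
have [U [UF oU]] := ultra_nat; have PF := @ultra_proper _ _ UF.
have [l [h1 _]] := compact_ulim u UF.
have [r r0 hr] := sz_sub e0.
have /(ultra_ex UF)[j /= uj] := h1 _ r0.
have : U ([set k | sz (u k - l) < r] `&` [set k | (j < k)%N]).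
  by apply: ultraI => //; [exact: h1|apply: oU; exists j.+1].
move=> /(ultra_ex UF)[k [/= uk jk]].
have := hr _ _ uk uj.
have -> : u k - l - (u j - l) = u k - u j by zmod.
by rewrite ltNge hnxt // uS.
Qed.

(** Dirichlet's box argument: for two distinct exponents, the multiples of every element of [s] have
    the same neighbour in a finite net, and the difference of the exponents works. *)
Lemma recurrence (s : seq X) e : 0 < e ->
  exists N, forall g, g \in s -> sz (g *+ N.+1) < e.
Proof.
move=> /sz_sub[r r0 hr]; have [t ht] := totally_bounded r0.
have [nr hnr] := choice (fun x => let: ex_intro2 y y1 y2 := ht x in
  ex_intro (fun y => y \in t /\ sz (x - y) < r) y (conj y1 y2)).
pose F (n : 'I_(#|{ffun 'I_(size s) -> 'I_(size t).+1}|).+1) :=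
  [ffun i : 'I_(size s) => inord (index (nr (s`_i *+ n)) t) : 'I_(size t).+1].
have [|n1 [n2 [lt12 eF]]] := pigeonhole_lt F; first by rewrite ?card_ord.
exists (n2 - n1).-1 => g gs; rewrite prednK ?subn_gt0 // mulrnBr ?(ltnW lt12) //.
have ig : (index g s < size s)%N by rewrite index_mem.
have := congr1 (fun f : {ffun 'I_(size s) -> 'I_(size t).+1} => nat_of_ord (f (Ordinal ig))) eF; rewrite !ffunE /= nth_index //.
have [a1 a2] := hnr (g *+ n1); have [b1 b2] := hnr (g *+ n2).
rewrite !inordK ?ltnS ?index_size // => /(congr1 (nth 0 t)); rewrite !nth_index // => e1.
have := hr _ _ b2 a2; rewrite e1.
by have -> : g *+ n2 - nr (g *+ n2) - (g *+ n1 - nr (g *+ n2)) = g *+ n2 - g *+ n1 by zmod.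
Qed.

Section Automorphism.
Variable T : X -> X.
Hypotheses (TD : forall x y, T (x + y) = T x + T y) (Tc : continuous T).

Lemma auto0 : T 0 = 0.
Proof. by apply: (addrI (T 0)); rewrite -TD !addr0. Qed.

Lemma sz_auto e : 0 < e -> exists2 r, 0 < r & forall x, sz x < r -> sz (T x) < e.
Proof.
move=> e0; have := @Tc 0 [set x | sz x < e].
by rewrite auto0 => /(_ (sz_nbhs0 e0)) /nbhs_sz.
Qed.

Lemma sz_iter k e : 0 < e -> exists2 r, 0 < r &
  forall x, sz x < r -> forall j, (j <= k)%N -> sz (iter j T x) < e.
Proof.
elim: k e => [|k IH] e e0.
  by exists e => // x hx j; rewrite leqn0 => /eqP->.
have [r r0 hr] := sz_auto e0; have [t t0 ht] := IH _ r0.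
exists (Num.min t e) => [|x]; first by rewrite lt_min t0.
rewrite lt_min => /andP[x1 x2] [_ //|j]; rewrite ltnS => jk.
by rewrite iterS; apply: hr; exact: ht.
Qed.

End Automorphism.

End MetricGroup.

(** * Characters separate points *)

Section FiniteFourier.
Variables (R : realType) (A : finZmodType) (Psi : finType) (psi : Psi -> A -> R[i]).
Hypothesis hpsi : forall xi, unit_char (psi xi).
Hypothesis orth : forall n, \sum_xi psi xi n = if n == 0 then #|A|%:R else 0.

Definition fourier (G : A -> R[i]) xi := \sum_n G n * psi xi (- n).

Lemma psiN xi n : psi xi (- n) = (psi xi n)^*%C.
Proof.
rewrite unit_charN //; apply: (mulfI (unit_char_neq0 n (hpsi xi))).
by rewrite divff ?unit_char_neq0 // unit_conjc // (hpsi xi).2.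
Qed.

Lemma parseval G :
  \sum_xi normc (fourier G xi) ^+ 2 = #|A|%:R * \sum_n normc (G n) ^+ 2.
Proof.
apply: (@complexI R); rewrite rmorph_sum /=.
under eq_bigr do rewrite -mul_conjc.
have -> : \sum_xi fourier G xi * (fourier G xi)^*%C =
  \sum_n \sum_m G n * (G m)^*%C * \sum_xi psi xi (m - n).
  under eq_bigr do rewrite /fourier rmorph_sum /= mulr_suml.
  rewrite exchange_big; apply: eq_bigr => n _ /=.
  under eq_bigr do rewrite mulr_sumr.
  rewrite exchange_big; apply: eq_bigr => m _ /=.
  rewrite mulr_sumr; apply: eq_bigr => xi _.
  by rewrite rmorphM /= -psiN opprK addrC (hpsi xi).1; ring.
rewrite rmorphM rmorph_sum /= mulr_sumr; apply: eq_bigr => n _.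
rewrite (bigD1 n) //= subrr orth eqxx big1 => [|m mn]; last first.
  by rewrite orth subr_eq0 (negbTE mn) mulr0.
by rewrite addr0 mul_conjc mulrC rmorph_nat.
Qed.

Definition autocorr (D : A -> R[i]) n := \sum_m D (m + n) * (D m)^*%C.

Lemma fourier_autocorr D xi : fourier (autocorr D) xi = (normc (fourier D xi) ^+ 2)%:C%C.
Proof.
rewrite -mul_conjc /fourier rmorph_sum /= mulr_suml.
under eq_bigr do rewrite /autocorr mulr_suml.
under [RHS]eq_bigr do rewrite mulr_sumr.
rewrite exchange_big /= [RHS]exchange_big /=; apply: eq_bigr => m _.
rewrite [RHS](reindex_onto (fun n => m + n) (fun n => n - m)) /=; last by move=> n _; rewrite addrC subrK.
apply: eq_big => [n|n _]; first by rewrite [m + n]addrC addrK eqxx.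
rewrite rmorphM /= -(psiN xi (- m)) opprK opprD (hpsi xi).1 (unit_charN m) //.
by have h := unit_char_neq0 m (hpsi xi); field.
Qed.

(* Two applications of Parseval: the fourth moment of the Fourier transform of [D]
   is the second moment of the autocorrelation. *)
Lemma large_fourier (D : A -> R[i]) (B c : R) (k : nat) (S : pred A) :
  0 < c -> 0 < B -> (0 < k)%N -> (forall n, normc (D n) <= B) ->
  (#|A| <= k * #|S|)%N -> (forall n, n \in S -> c * #|A|%:R <= normc (autocorr D n)) ->
  exists xi, c / (k.+1%:R * B) * #|A|%:R <= normc (fourier D xi).
Proof.
move=> c0 B0 k0 DB AS hS; apply: contrapT => hno.
set t := c / (k.+1%:R * B) * #|A|%:R.
have A0 : 0 < #|A|%:R :> R by rewrite ltr0n; apply/card_gt0P; exists 0.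
have t0 : 0 < t by rewrite mulr_gt0 // divr_gt0 // mulr_gt0.
have small xi : normc (fourier D xi) <= t.
  by apply/ltW; rewrite ltNge; apply/negP => h; apply: hno; exists xi.
have h1 : \sum_xi normc (fourier (autocorr D) xi) ^+ 2 <= t ^+ 2 * (#|A|%:R ^+ 2 * B ^+ 2).
  apply: (@le_trans _ _ (t ^+ 2 * \sum_xi normc (fourier D xi) ^+ 2)).
    rewrite mulr_sumr; apply: ler_sum => xi _.
    rewrite fourier_autocorr normcR ger0_norm ?sqr_ge0 // expr2.
    by rewrite ler_wpM2r ?sqr_ge0 // lerXn2r ?nnegrE ?normc_ge0 // ltW.
  rewrite ler_wpM2l ?sqr_ge0 // parseval expr2 -mulrA ler_wpM2l ?(ltW A0) //.
  have -> : #|A|%:R * B ^+ 2 = \sum_(n : A) B ^+ 2 by rewrite sumr_const mulr_natl.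
  by apply: ler_sum => n _; rewrite lerXn2r ?nnegrE ?normc_ge0 // ltW.
rewrite parseval in h1.
have h2 : #|S|%:R * (c * #|A|%:R) ^+ 2 <= \sum_n normc (autocorr D n) ^+ 2.
  rewrite (bigID (mem S)) /= -[X in X <= _]addr0 lerD //; last first.
    by apply: sumr_ge0 => n _; exact: sqr_ge0.
  rewrite mulr_natl -sumr_const; apply: ler_sum => n nS.
  by apply: lerXn2r; rewrite ?nnegrE ?normc_ge0 ?mulr_ge0 ?(ltW c0) ?(ltW A0) //; exact: hS.
have h3 := le_trans (ler_wpM2l (ltW A0) h2) h1.
have h4 : t ^+ 2 * (#|A|%:R ^+ 2 * B ^+ 2) * (k.+1%:R ^+ 2) = c ^+ 2 * #|A|%:R ^+ 4.
  have b0 : B != 0 by rewrite gt_eqF.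
  have k1 : k.+1%:R != 0 :> R by rewrite pnatr_eq0.
  rewrite /t; move: (k.+1%:R : R) k1 => K k1; move: (#|A|%:R : R) => a.
  by field; rewrite k1 b0.
(* If all coefficients are at most [t], the two moments give this bound, which contradicts
   [#|A| <= k * #|S|]; hence the [k.+1] in the choice of [t]. *)
have h5 : k.+1%:R ^+ 2 * #|S|%:R <= #|A|%:R :> R.
  have P : 0 < #|A|%:R * (c * #|A|%:R) ^+ 2 :> R by rewrite mulr_gt0 // exprn_gt0 // mulr_gt0.
  rewrite -(ler_pM2r P).
  have := ler_wpM2r (sqr_ge0 k.+1%:R) h3; rewrite h4.
  by congr (_ <= _); ring.
have : (k.+1 ^ 2 * #|S| <= k * #|S|)%N by apply: leq_trans AS; rewrite -(ler_nat R) natrM natrX.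
rewrite leq_pmul2r; last by case: #|S| AS => //; rewrite muln0 leqn0 => /eqP h; move: A0; rewrite h ltxx.
by apply/negP; rewrite -ltnNge -mulnn; nia.
Qed.

End FiniteFourier.

(** Joins the finite and the group structure, so that functions into a finite group form a
    [finZmodType]. *)
HB.instance Definition _ (I : finType) (V : finZmodType) :=
  GRing.Zmodule.on {ffun I -> V}.

Section CyclicPowers.
Variables (R : realType) (r N : nat).
Local Notation A := {ffun 'I_r -> 'I_N.+1}.

Definition cyc_char (xi n : A) : R[i] :=
  \prod_i cis ((xi i * n i)%:R / N.+1%:R).

Lemma cis_div_mod a : cis ((a %% N.+1)%:R / N.+1%:R) = cis (a%:R / N.+1%:R) :> R[i].
Proof.
rewrite [in RHS](divn_eq a N.+1) natrD natrM mulrDl mulfK ?pnatr_eq0 //.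
by rewrite cisD -[X in cis X * _]/((Posz _)%:~R) cis_int mul1r.
Qed.

Lemma cyc_char_unit xi : unit_char (cyc_char xi).
Proof.
split => [x y|x].
  rewrite /cyc_char -big_split; apply: eq_bigr => i _ /=; rewrite ffunE /=.
  rewrite -cisD -mulrDl -natrD -mulnDr -cis_div_mod modnMmr cis_div_mod //.
by rewrite /cyc_char normc_prod big1 // => i _; exact: normc_cis.
Qed.

Lemma cyc_char_orth n : \sum_xi cyc_char xi n = if n == 0 then #|{: A}|%:R else 0.
Proof.
rewrite /cyc_char -(bigA_distr_bigA (fun i (x : 'I_N.+1) => cis ((x * n i)%:R / N.+1%:R))).
case: eqP => [->|/eqP n0].
  rewrite card_ffun !card_ord natrX -[r in RHS]card_ord -prodr_const.
  apply: eq_bigr => i _; rewrite -[N.+1 in RHS]card_ord -sumr_const.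
  by apply: eq_bigr => x _; rewrite ffunE muln0 mul0r cis0.
have [i ni] : exists i, n i != 0.
  by apply/existsP; apply: contraNT n0 => /existsPn h; apply/eqP/ffunP => i; rewrite ffunE; apply/eqP; have := h i; rewrite negbK.
rewrite (bigD1 i) //=; set s := \sum_j _; suff -> : s = 0 by rewrite mul0r.
pose w : R[i] := cis ((n i)%:R / N.+1%:R).
have -> : s = \sum_(x < N.+1) w ^+ x.
  by apply: eq_bigr => x _; rewrite natrM -mulrA cisM_nat.
have w1 : w != 1.
  apply/eqP => /cis_eq1[m hm].
  have n1 : 0 < ((n i)%:R / N.+1%:R : R) < 1.
    by rewrite divr_gt0 ?ltr0n ?lt0n //= ltr_pdivrMr // mul1r ltr_nat ltn_ord.
  by move: n1; rewrite hm ltr0z ltrz1; lia.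
have : (w - 1) * \sum_(x < N.+1) w ^+ x = 0.
  rewrite -subrX1 /w -cisM_nat mulrC divfK ?pnatr_eq0 //.
  by rewrite -[X in cis X]/((Posz _)%:~R) cis_int subrr.
by move/eqP; rewrite mulf_eq0 subr_eq0 (negbTE w1) /= => /eqP.
Qed.

End CyclicPowers.

Section UltraLimits.
Variables (R : realType) (U : set_system nat).
Hypotheses (UF : UltraFilter U) (oU : \oo `<=` U).
Implicit Types (u v : nat -> R[i]) (l m : R[i]).

Definition ucvg u l := forall e : R, 0 < e -> U [set k | normc (u k - l) < e].

Lemma ultraS (A B : set nat) : A `<=` B -> U A -> U B.
Proof. by have PF := @ultra_proper _ _ UF => AB; apply: filterS. Qed.

Lemma ultra_ge K : U [set k | (K <= k)%N].
Proof. by apply: oU; exists K. Qed.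

Lemma ulim_real (u : nat -> R) B : (forall k, `|u k| <= B) ->
  exists l : R, forall e : R, 0 < e -> U [set k | `|u k - l| < e].
Proof.
move=> uB; have cB := @segment_compact R (- B) B; rewrite compact_ultra in cB.
have PF := @ultra_proper _ _ UF.
have hu : (u @ U) `[- B, B]%classic.
  by apply: (@filterE _ U) => k; rewrite /= in_itv /= -ler_norml.
have [l [_ ul]] := cB _ (ultra_fmap u UF) hu; exists l => e e0.
have /cvgrPdist_lt/(_ e e0) := (ul : u @ U --> l).
by apply: filterS => k; rewrite distrC.
Qed.

Lemma ulim_complex u (B : R) : (forall k, normc (u k) <= B) -> exists l, ucvg u l.
Proof.
move=> uB.
have [a ha] := @ulim_real (fun k => complex.Re (u k)) B (fun k => le_trans (ler_Re_normc _) (uB k)).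
have [b hb] := @ulim_real (fun k => complex.Im (u k)) B (fun k => le_trans (ler_Im_normc _) (uB k)).
exists (a +i* b)%C => e e0; have e2 : 0 < e / 2 by lra.
apply: ultraS (ultraI UF (ha _ e2) (hb _ e2)) => k [/= h1 h2].
apply: le_lt_trans (normc_le_ReIm _) _.
by case: (u k) h1 h2 => x y /=; lra.
Qed.

Lemma ucvgB u v l m : ucvg u l -> ucvg v m -> ucvg (fun k => u k - v k) (l - m).
Proof.
move=> ul vm e e0; have e2 : 0 < e / 2 by lra.
apply: ultraS (ultraI UF (ul _ e2) (vm _ e2)) => k [/= h1 h2].
have -> : u k - v k - (l - m) = (u k - l) + (m - v k) by ring.
by apply: le_lt_trans (normcD _ _) _; rewrite (normcB m); lra.
Qed.

Lemma ucvgM u v l m : ucvg u l -> ucvg v m -> ucvg (fun k => u k * v k) (l * m).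
Proof.
move=> ul vm e e0; pose D := normc l + normc m + 2.
have D0 : 0 < D by have := normc_ge0 l; have := normc_ge0 m; rewrite /D; lra.
pose t := Num.min 1 (e / D).
have t0 : 0 < t by rewrite lt_min ltr01 divr_gt0.
have t1 : t <= 1 by rewrite ge_min lexx.
have tD : t * D <= e by rewrite -ler_pdivlMr // ge_min lexx orbT.
apply: ultraS (ultraI UF (ul _ t0) (vm _ t0)) => k [/= h1 h2].
have -> : u k * v k - l * m = u k * (v k - m) + (u k - l) * m by ring.
apply: le_lt_trans (normcD _ _) _; rewrite !normcM.
have h3 : normc (u k) <= normc l + 1 by have := normc_distD l (u k) 0; rewrite !subr0; lra.
have := normc_ge0 (u k); have := normc_ge0 (v k - m); have := normc_ge0 m.
have := normc_ge0 l; have := normc_ge0 (u k - l); rewrite /D in tD; nra.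
Qed.

Lemma ucvg_normc_le u l (b : R) : ucvg u l -> U [set k | normc (u k) <= b] -> normc l <= b.
Proof.
move=> ul ub; apply/ler_addgt0Pr => e e0.
have [k [/= h1 h2]] := ultra_ex UF (ultraI UF (ul _ e0) ub).
by have := normc_distD (u k) l 0; rewrite !subr0 (normcB l); lra.
Qed.

Lemma ucvg_normc_ge u l (b : R) : ucvg u l -> U [set k | b <= normc (u k)] -> b <= normc l.
Proof.
move=> ul ub; apply/ler_addgt0Pr => e e0.
have [k [/= h1 h2]] := ultra_ex UF (ultraI UF (ul _ e0) ub).
by have := normc_distD l (u k) 0; rewrite !subr0; lra.
Qed.

End UltraLimits.

Section Characters.
Variables (R : realType) (X : topologicalZmodType) (d : X -> X -> R).
Hypotheses (hd : compatible_metric d) (cX : compact [set: X]).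
Implicit Types (e r t : R) (x y z : X).
Local Notation sz := (sz d).

(** For finite [A] this is a finite model of [X], on which Fourier analysis is elementary. *)
Definition almost_hom (A : zmodType) e (pi : A -> X) :=
  (forall m n, sz (pi (m + n) - (pi m + pi n)) < e) /\
  (forall x, exists n, sz (x - pi n) < e).

Lemma almost_homS (A : zmodType) e r (pi : A -> X) :
  r <= e -> almost_hom r pi -> almost_hom e pi.
Proof.
move=> re [h1 h2]; split => [m n|x]; first exact: lt_le_trans re.
by have [n hn] := h2 x; exists n; exact: lt_le_trans re.
Qed.

(* The modulus is chosen by simultaneous recurrence, which makes the carries in
   the addition of [{ffun 'I_r -> 'I_N.+1}] invisible in [X]. *)
Lemma almost_hom_ex e : 0 < e ->
  exists p N (pi : {ffun 'I_p -> 'I_N.+1} -> X), almost_hom e pi.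
Proof.
move=> e0; have [s hs] := totally_bounded hd cX e0.
have [r1 r10 h1] := sz_sum hd (size s) e0.
have [r2 r20 h2] := sz_add hd r10.
have [N0 hN0] := recurrence hd cX s r20.
(* Doubling the return time gives [N.+1 = 2 * N0.+1], so [N] is positive and [inord 1] really is 1
   in ['I_N.+1]. *)
pose N := (N0.*2.+1).
have hN g : g \in s -> sz (g *+ N.+1) < r1.
  by move=> gs; rewrite /N -doubleS -addnn mulrnDr; apply: h2; exact: hN0.
exists (size s), N, (fun n : {ffun 'I_(size s) -> 'I_N.+1} => \sum_(i < size s) s`_i *+ n i); split => [m n|x].
  rewrite -big_split -sumrB /=; apply: h1 => i; rewrite ffunE /=.
  have [lt|ge] := ltnP (m i + n i) N.+1.
    by rewrite modn_small // mulrnDr subrr (sz0 hd).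
  rewrite -mulrnDr -{2}(subnK ge) -{1}(subnK ge) modnDr modn_small; last first.
    by have := ltn_ord (m i); have := ltn_ord (n i); lia.
  rewrite [in X in _ - X]mulrnDr.
  have -> : forall a b : X, a - (a + b) = - b by move=> a b; zmod.
  by rewrite (szN d); apply: hN; exact: mem_nth.
have [g gs hg] := hs x.
have ig : (index g s < size s)%N by rewrite index_mem.
exists [ffun i => if i == Ordinal ig then inord 1 else 0].
rewrite (bigD1 (Ordinal ig)) //= big1 ?addr0 => [|i /negbTE ni]; last by rewrite ffunE ni.
by rewrite ffunE eqxx nth_index // inordK.
Qed.

(** A finite net splits [A] into at most [k] fibres, and each fibre can be translated inside [A]
    into the set of points that [pi] sends near [x]. The constant [k] depends on [e] only, not on
    the finite group. *)
Lemma return_density e : 0 < e -> exists k r, 0 < r /\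
  forall (A : finZmodType) (pi : A -> X), almost_hom r pi ->
  forall x, (#|A| <= k * #|[pred n | (sz (pi n - x) < e)%R]|)%N.
Proof.
move=> e0; have [t t0 ht] := sz_sum hd 5 e0.
have [s hs] := totally_bounded hd cX t0.
have [nr hnr] := choice (fun x => let: ex_intro2 y y1 y2 := hs x in
  ex_intro (fun y => y \in s /\ sz (x - y) < t) y (conj y1 y2)).
exists (size s), t; split => // A pi [h1 h2] x.
pose F (y : X) := [pred a | nr (pi a) == y].
have [b hb] := h2 x.
have hF y : (#|F y| <= #|[pred n | (sz (pi n - x) < e)%R]|)%N.
  have [a1 /eqP a1y|F0] := pickP (F y); last by rewrite (eq_card0 F0).
rewrite -(card_imset (F y) (addrI (b - a1))).
  apply: subset_leq_card; apply/fintype.subsetP => n /imsetP[a].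
  rewrite !inE => /eqP ay ->; pose c := a - a1.
  have -> : b - a1 + a = c + b by rewrite /c; zmod.
  pose v := [:: pi (c + b) - (pi c + pi b); - (pi (c + a1) - (pi c + pi a1));
     pi a - y; - (pi a1 - y); - (x - pi b)].
  have -> : pi (c + b) - x = \sum_(i < 5) v`_i.
    have ca : c + a1 = a by rewrite /c; zmod.
    by rewrite !big_ord_recl big_ord0 /= ca; zmod.
  have sm m' n' : sz (pi (m' + n') - (pi m' + pi n')) < t by exact: h1.
  apply: ht => -[i hi]; rewrite /v.
  case: i hi => [|[|[|[|[|i]]]]] hi //=; rewrite ?(szN d) //.
  - by rewrite -ay; exact: (hnr _).2.
  - by rewrite -a1y; exact: (hnr _).2.
have : (#|A| <= \sum_(y <- s) #|F y|)%N.
  rewrite -sum1_card.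
  have -> : (\sum_(y <- s) #|F y| = \sum_(y <- s) \sum_(a : A) (nr (pi a) == y))%N.
    apply: eq_bigr => y _; rewrite -sum1_card big_mkcond /=.
    by apply: eq_bigr => a _; rewrite unfold_in /=; case: eqP.
  rewrite exchange_big /=; apply: leq_sum => a _.
  have [ms _] := hnr (pi a).
  rewrite (big_rem _ ms) /= eqxx; exact: leq_addr.
move=> h; apply: leq_trans h _.
apply: (@leq_trans (\sum_(y <- s) #|[pred n | (sz (pi n - x) < e)%R]|)%N).
  exact: leq_sum.
by rewrite big_const_seq iter_addn_0 count_predT mulnC.
Qed.

Lemma dist0_bounded : exists2 B, 0 < B & forall x, d x 0 <= B.
Proof.
have [r r0 hr] := sz_dist hd cX (ltr01 : (0 : R) < 1).
have [s hs] := totally_bounded hd cX r0.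
exists (1 + \sum_(g <- s) d g 0).
  by rewrite ltr_pwDl // sumr_ge0 // => g _; exact: dist_ge0.
move=> x; have [g gs hg] := hs x.
apply: le_trans (dist_tri hd x g 0) _; apply: lerD; first exact/ltW/hr.
rewrite (big_rem _ gs) /= lerDl sumr_ge0 // => y _; exact: dist_ge0.
Qed.

Lemma dist0_ucont e : 0 < e ->
  exists2 r, 0 < r & forall x y, sz (x - y) < r -> `|d x 0 - d y 0| <= e.
Proof.
move=> e0; have [r r0 hr] := sz_dist hd cX e0; exists r => // x y /hr xy.
rewrite ler_norml; have := dist_tri hd x y 0; have := dist_tri hd y x 0.
by rewrite (dist_sym hd y x); lra.
Qed.

Lemma fourier_le (A : finZmodType) (Psi : finType) (psi : Psi -> A -> R[i]) G xi (b : R) :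
  (forall xi, unit_char (psi xi)) -> (forall n, normc (G n) <= b) ->
  normc (fourier psi G xi / #|A|%:R) <= b.
Proof.
move=> hpsi hG; have A0 : 0 < #|A|%:R :> R by rewrite ltr0n; apply/card_gt0P; exists 0.
rewrite normcM normcV normc_nat ler_pdivrMr //.
apply: le_trans (normc_sum _ _ _) _; rewrite mulr_natr -sumr_const.
by apply: ler_sum => n _; rewrite normcM (hpsi xi).2 mulr1.
Qed.

Lemma fourierB (A : finZmodType) (Psi : finType) (psi : Psi -> A -> R[i]) G H xi :
  fourier psi G xi - fourier psi H xi = fourier psi (fun n => G n - H n) xi.
Proof. by rewrite /fourier -sumrB; apply: eq_bigr => n _; rewrite mulrBl. Qed.

(** [L y] is the normalized Fourier coefficient, at one frequency [xi] of a finite model, of the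
    function sending [n] to [d (pi n + y) 0]. Translating [y] by [z] multiplies it approximately by
    [psi xi a], where [pi a] is near [z]. The frequency is one at which the difference function [DX]
    has a large coefficient, and that coefficient is [L x0 - L 0]. As [B] and [c] come before [eta],
    the bounds survive the limit. *)
Lemma approximate_character x0 : x0 != 0 -> exists (B c : R), [/\ 0 < B, 0 < c &
  forall eta, 0 < eta -> exists L : X -> R[i], [/\ forall y, normc (L y) <= B,
    forall e t, (forall w w', sz (w - w') < t -> `|d w 0 - d w' 0| <= e) ->
      forall y y', sz (y - y') < t -> normc (L y - L y') <= e,
    forall z y, normc (L (z + y) * L 0 - L z * L y) <= eta &
    c <= normc (L x0 - L 0)]].
Proof.
move=> x00; have [B B0 hB] := dist0_bounded.
pose del := d x0 0.
have del0 : 0 < del.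
  by rewrite lt_def dist_ge0 // andbT; apply: contra x00 => /eqP/(dist_eq0 hd)->.
pose DX x := d (x + x0) 0 - d x 0.
have DXc e t : (forall w w', sz (w - w') < t -> `|d w 0 - d w' 0| <= e) ->
    forall w w', sz (w - w') < t -> `|DX w - DX w'| <= 2 * e.
  move=> h w w' hw; have h1 := h _ _ hw.
  have h2 : `|d (w + x0) 0 - d (w' + x0) 0| <= e.
    by apply: h; have -> : w + x0 - (w' + x0) = w - w' by zmod.
  by move: h1 h2; rewrite /DX !ler_norml; lra.
have DXB x : `|DX x| <= B.
  have := hB x; have := hB (x + x0); have := dist_ge0 hd x 0.
  by have := dist_ge0 hd (x + x0) 0; rewrite ler_norml /DX; lra.
have e40 : 0 < del / 4 by lra.
have [t2 t20 ht2] := dist0_ucont e40.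
have [k2 [r2 [r20 dens2]]] := return_density t20.
have k20 : (0 < k2)%N.
  have [r [N [pi hpi]]] := almost_hom_ex r20.
  have := dens2 _ pi hpi 0; case: (k2) => //.
  by rewrite mul0n leqn0 => /eqP/card0_eq/(_ 0).
have k2R : 0 < k2%:R :> R by rewrite ltr0n.
(* The mean square of [DX] over the model is at least [del ^+ 2 / (4 * k2)]. A variation of [DX] by
   [2 * e1] costs half of this in the autocorrelation, and [c1] is what remains. *)
pose e1 := del ^+ 2 / (16 * k2%:R * B).
have e10 : 0 < e1 by rewrite divr_gt0 ?exprn_gt0 // !mulr_gt0.
have [t1 t10 ht1] := dist0_ucont e10.
have [r1 r10 hr1] := sz_add hd t10.
have [k1 [r1' [r1'0 dens1]]] := return_density r10.
pose c1 := del ^+ 2 / (8 * k2%:R).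
have c10 : 0 < c1 by rewrite divr_gt0 ?exprn_gt0 // mulr_gt0.
exists B, (c1 / (k1.+1%:R * B)); split => //.
  by rewrite divr_gt0 // mulr_gt0.
move=> eta eta0; pose e3 := eta / (2 * B).
have e30 : 0 < e3 by rewrite divr_gt0 // mulr_gt0.
have [t3 t30 ht3] := dist0_ucont e30.
have [r3 r30 hr3] := sz_sub hd t30.
pose r := Num.min (Num.min r1 r1') (Num.min r2 r3).
have r0 : 0 < r by rewrite !lt_min r10 r1'0 r20 r30.
have [m [N [pi hpi]]] := almost_hom_ex r0.
have hr1e := almost_homS (_ : r <= r1) hpi; have {}hr1e := hr1e ltac:(by rewrite !ge_min lexx).
have hr1p := almost_homS (_ : r <= r1') hpi; have {}hr1p := hr1p ltac:(by rewrite !ge_min lexx orbT).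
have hr2e := almost_homS (_ : r <= r2) hpi; have {}hr2e := hr2e ltac:(by rewrite !ge_min lexx !orbT).
have hr3e := almost_homS (_ : r <= r3) hpi; have {}hr3e := hr3e ltac:(by rewrite !ge_min lexx !orbT).
pose A : finZmodType := {ffun 'I_m -> 'I_N.+1}.
pose psi : A -> A -> R[i] := @cyc_char R m N.
have hpsi xi : unit_char (psi xi) by exact: cyc_char_unit.
have orth n : \sum_xi psi xi n = if n == 0 then #|A|%:R else 0 by exact: cyc_char_orth.
have A0 : 0 < #|A|%:R :> R by rewrite ltr0n; apply/card_gt0P; exists 0.
pose D (n : A) := (DX (pi n))%:C%C.
have hDB n : normc (D n) <= B by rewrite normcR.
have [xi hxi] : exists xi, c1 / (k1.+1%:R * B) * #|A|%:R <= normc (fourier psi D xi).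
  have k10 : (0 < k1)%N.
    have := dens1 _ pi hr1p 0; case: (k1) => //.
    by rewrite mul0n leqn0 => /eqP/card0_eq/(_ 0).
  apply: (large_fourier hpsi orth c10 B0 k10 hDB (dens1 _ pi hr1p 0)) => n.
  rewrite unfold_in /= subr0 => hn.
  have -> : autocorr D n = (\sum_m DX (pi (m + n)) * DX (pi m))%:C%C.
    rewrite rmorph_sum; apply: eq_bigr => m' _.
    by rewrite /D conjc_real -rmorphM.
  rewrite normcR; apply: le_trans (ler_norm _).
  have h1 : \sum_m DX (pi m) ^+ 2 - 2 * e1 * B * #|A|%:R <= \sum_m DX (pi (m + n)) * DX (pi m).
    rewrite mulr_natr -sumr_const -sumrB; apply: ler_sum => m' _.
    have : `|DX (pi (m' + n)) - DX (pi m')| <= 2 * e1.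
      apply: (DXc _ _ ht1).
      have -> : pi (m' + n) - pi m' = (pi (m' + n) - (pi m' + pi n)) + pi n by zmod.
      by apply: hr1 => //; exact: hr1e.1.
    by have := DXB (pi m'); rewrite !ler_norml; nra.
  apply: le_trans h1.
  have h2 : (del / 2) ^+ 2 * (#|A|%:R / k2%:R) <= \sum_m DX (pi m) ^+ 2.
    have := dens2 _ pi hr2e 0; set S := [pred n | _] => hS.
    rewrite (bigID (mem S)) /= -[X in X <= _]addr0 lerD //; last first.
      by apply: sumr_ge0 => m' _; exact: sqr_ge0.
    apply: (@le_trans _ _ ((del / 2) ^+ 2 * #|S|%:R)).
      by rewrite ler_wpM2l ?sqr_ge0 // ler_pdivrMr // -natrM ler_nat mulnC.
    rewrite mulr_natr -sumr_const; apply: ler_sum => m'; rewrite unfold_in /= => hm.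
    have := DXc _ _ ht2 _ _ hm; have -> : DX 0 = del by rewrite /DX add0r distxx // subr0.
    rewrite ler_norml => /andP[h3 _]; nra.
  apply: le_trans (lerD h2 (lexx _)).
  rewrite le_eqVlt; apply/orP; left; apply/eqP; rewrite /c1 /e1.
  have k2n : k2%:R != 0 :> R by rewrite gt_eqF.
  have Bn : B != 0 by rewrite gt_eqF.
  move: (k2%:R : R) k2n => K Kn; move: (#|A|%:R : R) => a.
  by field; rewrite Kn Bn.
pose G y (n : A) := (d (pi n + y) 0)%:C%C.
pose L y := fourier psi (G y) xi / #|A|%:R.
have LB y : normc (L y) <= B.
  by apply: fourier_le => // n; rewrite normcR ger0_norm ?dist_ge0.
have Lc e t : (forall w w', sz (w - w') < t -> `|d w 0 - d w' 0| <= e) ->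
    forall y y', sz (y - y') < t -> normc (L y - L y') <= e.
  move=> h y y' hy; rewrite -mulrBl fourierB; apply: fourier_le => // n.
  rewrite -rmorphB normcR; apply: h.
  by have -> : pi n + y - (pi n + y') = y - y' by zmod.
exists L; split => //.
  move=> z y; have [a ha] := hpi.2 z.
  have key w : normc (L (z + w) - psi xi a * L w) <= e3.
    have -> : psi xi a * L w = fourier psi (fun n => G w (n + a)) xi / #|A|%:R.
      rewrite /L mulrA; congr (_ / _); rewrite /fourier mulr_sumr.
      rewrite (reindex_inj (addIr a)) /=; apply: eq_bigr => n _.
      rewrite opprD (hpsi xi).1 (unit_charN a) //.
      by have := unit_char_neq0 a (hpsi xi) => h; field.
    rewrite -mulrBl fourierB; apply: fourier_le => // n.
    rewrite -rmorphB normcR; apply: ht3.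
    have -> : pi n + (z + w) - (pi (n + a) + w) = (z - pi a) - (pi (n + a) - (pi n + pi a)).
      by zmod.
    apply: hr3; last exact: hr3e.1.
    by apply: lt_le_trans ha _; rewrite !ge_min lexx !orbT.
  have k0 := key 0; rewrite addr0 in k0.
  have -> : L (z + y) * L 0 - L z * L y =
    (L (z + y) - psi xi a * L y) * L 0 - (L z - psi xi a * L 0) * L y by ring.
  apply: le_trans (normcD _ _) _; rewrite normcNE [normc (_ * L 0)]normcM [normc (_ * L y)]normcM.
  have : e3 * B + e3 * B = eta by rewrite /e3; field; rewrite gt_eqF.
  have := key y; have := LB y; have := LB 0; have := normc_ge0 (L y); have := normc_ge0 (L 0).
  have := normc_ge0 (L (z + y) - psi xi a * L y); have := normc_ge0 (L z - psi xi a * L 0).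
  move=> p1 p2 p3 p4 p5 p6 p7 <-; apply: lerD; exact: ler_pM.
rewrite -mulrBl fourierB normcM normcV normc_nat ler_pdivlMr //.
apply: le_trans hxi _; rewrite le_eqVlt; apply/orP; left; apply/eqP; congr normc.
by apply: eq_bigr => n _; rewrite /G /D -rmorphB addr0.
Qed.

Definition small_char (chi : X -> R[i]) :=
  forall e, 0 < e -> exists2 r, 0 < r & forall x, sz x < r -> normc (chi x - 1) < e.

(** A modulus above 1 would grow without bound along the multiples of [x]; a modulus below 1 is
    excluded by looking at [- x]. *)
Lemma bounded_char_unit (chi : X -> R[i]) (B : R) : chi 0 = 1 ->
  (forall x y, chi (x + y) = chi x * chi y) -> (forall x, normc (chi x) <= B) ->
  unit_char chi.
Proof.
move=> chi0 chiD chiB; have chiX x n : chi (x *+ n) = chi x ^+ n.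
  by elim: n => [|n IH]; rewrite ?mulr0n // mulrS chiD IH exprS.
have le1 x : normc (chi x) <= 1.
  rewrite leNgt; apply/negP => h1; pose h := normc (chi x) - 1.
  have h0 : 0 < h by rewrite subr_gt0.
  have := bernoulli_ineq (Num.truncn (B / h)).+1 (ltW h0).
  have -> : 1 + h = normc (chi x) by rewrite /h addrC subrK.
  rewrite -normcX -chiX => h2; have := le_trans h2 (chiB _).
  have : B / h < (Num.truncn (B / h)).+1%:R by rewrite truncnS_gt.
  by rewrite ltr_pdivrMr // => h3; lra.
split => // x; apply/eqP; rewrite eq_le le1 /=.
have : normc (chi x) * normc (chi (- x)) = 1 by rewrite -normcM -chiD subrr chi0 normc1E.
have := le1 (- x); have := normc_ge0 (chi x); have := normc_ge0 (chi (- x)); nra.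
Qed.

(** In the ultralimit of approximate characters with errors [k.+1%:R^-1], the relation
    [l (z + y) * l 0 = l z * l y] is exact, and dividing by [l 0] gives a character. If [l 0] were
    0, so would be [l x0], against the lower bound [c]. *)
Theorem characters_separate x0 : x0 != 0 ->
  exists chi, [/\ unit_char chi, small_char chi & chi x0 != 1].
Proof.
move=> x00; have [B [c [B0 c0 hL]]] := approximate_character x00.
have [U [UF oU]] := ultra_nat.
have /choice[L hLk] k := hL k.+1%:R^-1 ltac:(by rewrite invr_gt0).
have /choice[l hl] y : exists l, ucvg U (fun k => L k y) l.
  by apply: (@ulim_complex _ _ UF _ B) => k; case: (hLk k).
have lM z y : l (z + y) * l 0 = l z * l y.
  apply/eqP; rewrite -subr_eq0 -normc_eq0 eq_le normc_ge0 andbT.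
  apply/ler_addgt0Pr => e e0; rewrite add0r.
  apply: (ucvg_normc_le UF (ucvgB UF (ucvgM UF (hl _) (hl _)) (ucvgM UF (hl _) (hl _)))).
  apply: ultraS (ultra_ge oU (Num.truncn e^-1)) => // k /= hk.
  case: (hLk k) => _ _ h _; apply: le_trans (h z y) _.
  rewrite invf_ple ?posrE //; apply/ltW/(lt_le_trans (truncnS_gt _)).
  by rewrite ler_nat ltnS.
have lc : c <= normc (l x0 - l 0).
  apply: (ucvg_normc_ge UF (ucvgB UF (hl _) (hl _))).
  by apply: ultraS (ultra_ge oU 0) => // k _; case: (hLk k).
have l0 : l 0 != 0.
  apply/eqP => l00; have := lM x0 x0; rewrite l00 mulr0 => /esym/eqP.
  rewrite mulf_eq0 orbb => /eqP lx0.
  by move: lc; rewrite lx0 l00 subrr normc0E leNgt c0.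
have ll0 : 0 < normc (l 0) by rewrite normc_gt0.
pose chi y := l y / l 0; exists chi; split.
- apply: (@bounded_char_unit _ (B / normc (l 0))).
  + by rewrite /chi divff.
  + move=> x y; rewrite /chi; apply: (mulIf l0); rewrite divfK //.
    by apply: (mulIf l0); rewrite lM; field.
  + move=> x; rewrite normcM normcV ler_wpM2r ?invr_ge0 ?normc_ge0 //.
    apply: (ucvg_normc_le UF (hl _)).
    by apply: ultraS (ultra_ge oU 0) => // k _ /=; case: (hLk k) => h _ _ _; exact: h.
- move=> e e0; have e2 : 0 < e * normc (l 0) / 2 by rewrite divr_gt0 // mulr_gt0.
  have [r r0 hr] := dist0_ucont e2; exists r => // x xr.
  have -> : chi x - 1 = (l x - l 0) / l 0 by rewrite mulrBl divff.
  rewrite normcM normcV ltr_pdivrMr //.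
  apply: (@le_lt_trans _ _ (e * normc (l 0) / 2)); last first.
    by rewrite ltr_pdivrMr // ltr_pMr ?mulr_gt0 // ltr1n.
  apply: (ucvg_normc_le UF (ucvgB UF (hl _) (hl _))).
  apply: ultraS (ultra_ge oU 0) => // k _; case: (hLk k) => _ h _ _.
  by apply: h hr _ _ _; rewrite subr0.
- apply/eqP => h; move: lc; have -> : l x0 = l 0 by rewrite -[RHS]mul1r -h divfK.
  by rewrite subrr normc0E leNgt c0.
Qed.

End Characters.

(** * Steering by integer polynomials *)

Section PolyAction.
Variables (A : comNzRingType) (V : zmodType) (sc : A -> V -> V) (T : V -> V).
Hypothesis scDl : forall a b v, sc (a + b) v = sc a v + sc b v.
Hypothesis scDr : forall a v w, sc a (v + w) = sc a v + sc a w.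
Hypothesis scA : forall a b v, sc a (sc b v) = sc (a * b) v.
Hypothesis TD : forall v w, T (v + w) = T v + T w.
Hypothesis Tsc : forall a v, T (sc a v) = sc a (T v).

(** The operator [p(T)], kept abstract because it is used twice: for integer polynomials in the
    automorphism of [X], and for polynomials in the shift of sequences. *)
Definition pact (p : {poly A}) v := \sum_(i < size p) sc p`_i (iter i T v).

Let sc0 v : sc 0 v = 0.
Proof. by apply: (addrI (sc 0 v)); rewrite -scDl !addr0. Qed.

Lemma pact_widen n (p : {poly A}) v : (size p <= n)%N -> pact p v = \sum_(i < n) sc p`_i (iter i T v).
Proof.
move=> pn; rewrite /pact (big_ord_widen n (fun i => sc p`_i (iter i T v)) pn) big_mkcond /=.
apply: eq_bigr => i _; case: ltnP => // h.
by rewrite nth_default.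
Qed.

Lemma pactD p q v : pact (p + q) v = pact p v + pact q v.
Proof.
pose n := maxn (size p) (size q).
rewrite !(@pact_widen n) ?leq_maxl ?leq_maxr ?size_polyD // -big_split.
by apply: eq_bigr => i _; rewrite coefD scDl.
Qed.

Lemma pactC c v : pact c%:P v = sc c v.
Proof. by rewrite (@pact_widen 1) ?size_polyC_leq1 // big_ord1 coefC. Qed.

Lemma iter_TD k v w : iter k T (v + w) = iter k T v + iter k T w.
Proof. by elim: k => //= k ->; rewrite TD. Qed.

Lemma pactDr p v w : pact p (v + w) = pact p v + pact p w.
Proof. by rewrite /pact -big_split; apply: eq_bigr => i _; rewrite iter_TD scDr. Qed.

Lemma pactMX p v : pact (p * 'X) v = pact p (T v).
Proof.
rewrite (@pact_widen (size p).+1) ?(leq_trans (size_polyMleq _ _)) ?size_polyX ?addn2 //.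
rewrite big_ord_recl coefMX eqxx sc0 add0r; apply: eq_bigr => i _.
by rewrite coefMX /= -iterS iterSr.
Qed.

Lemma pact_T p v : pact p (T v) = T (pact p v).
Proof.
rewrite /pact (big_morph T TD (_ : T 0 = 0)); last by apply: (addrI (T 0)); rewrite -TD !addr0.
by apply: eq_bigr => i _; rewrite Tsc -iterS iterSr.
Qed.

Lemma pactZ c p v : pact (c *: p) v = sc c (pact p v).
Proof.
have sc0r : sc c 0 = 0 by apply: (addrI (sc c 0)); rewrite -scDr !addr0.
rewrite (@pact_widen (size p)) ?size_scale_leq // /pact (big_morph _ (scDr c) sc0r).
by apply: eq_bigr => i _; rewrite coefZ scA.
Qed.

Lemma pactM p q v : pact (p * q) v = pact p (pact q v).
Proof.
elim/poly_ind: p v => [|p c IH] v.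
  by rewrite mul0r /pact size_poly0 !big_ord0.
rewrite mulrDl !pactD pactC mul_polyC pactZ mulrAC !pactMX IH.
by rewrite pact_T.
Qed.

Lemma pactXn n v : sc 1 v = v -> (forall w, sc 1 w = w) -> pact 'X^n v = iter n T v.
Proof.
move=> _ sc1; elim: n v => [|n IH] v; first by rewrite expr0 -[1]/(1%:P) pactC sc1.
by rewrite exprSr pactMX IH iterSr.
Qed.

End PolyAction.

Section CisNear.
Variable R : realType.

Lemma cis_near (e : R) : 0 < e -> exists2 r, 0 < r &
  forall s : R, normc (cis s - 1) < r -> exists m : int, `|s - m%:~R| < e.
Proof.
move=> e0; pose a := Num.min e 2^-1.
have a0 : 0 < a by rewrite lt_min e0 invr_gt0 ltr0n.
have a2 : a <= 2^-1 by rewrite ge_min lexx orbT.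
have ae : a <= e by rewrite ge_min lexx.
have pi0 := pi_gt0 R.
have c1 : cos (2 * pi * a) < 1.
  rewrite -[X in _ < X](@cos0 R) ltr_cos ?in_itv /= ?lexx ?pi_ge0 //.
    by rewrite !mulr_gt0.
  by apply/andP; split; nra.
exists (1 - cos (2 * pi * a)) => [|s]; first by rewrite subr_gt0.
move=> hs; pose m := Num.floor s; pose x := s - m%:~R.
have /andP[x0 x1] : 0 <= x < 1.
  by rewrite /x subr_ge0 ge_floor /= ltrBlDr -[1]/(1%:~R) addrC -intrD lt_succ_floor.
have cx : cos (2 * pi * a) < cos (2 * pi * x).
  have -> : cos (2 * pi * x) = complex.Re (cis s).
    by rewrite -[LHS]/(complex.Re (cis x)) /x cisB cis_int divr1.
  have := ler_Re_normc (cis s - 1); rewrite raddfB /= ler_norml => /andP[h _].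
  by have := hs; lra.
have [xa|ax] := ltP x a.
  by exists m; rewrite -/x ger0_norm //; lra.
have [xa|xa] := ltP (1 - a) x.
  exists (m + 1); rewrite intrD opprD addrA -/x ler0_norm; lra.
exfalso; have ai : 2 * pi * a \in `[0, pi] by rewrite in_itv /=; apply/andP; split; nra.
have [h|h] := leP x 2^-1.
  have xi : 2 * pi * x \in `[0, pi] by rewrite in_itv /=; apply/andP; split; nra.
  by move: cx; rewrite ltr_cos //; nra.
have xi : 2 * pi * (1 - x) \in `[0, pi] by rewrite in_itv /=; apply/andP; split; nra.
move: cx; have -> : cos (2 * pi * x) = cos (2 * pi * (1 - x)).
  by rewrite -[LHS]cosN -[LHS]cosD2pi; congr cos; rewrite -mulr_natl; ring.
by rewrite ltr_cos //; nra.
Qed.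

End CisNear.

Section Lagrange.
Variables (R : realType) (rs : seq R[i]).
Hypothesis rs_uniq : uniq rs.
Local Notation C := R[i].
Local Notation m := (size rs).

Definition lag (l : C) : {poly C} :=
  \prod_(x <- rs | x != l) ((l - x)^-1 *: ('X - x%:P)).

Lemma lagE l x : l \in rs -> x \in rs -> (lag l).[x] = (x == l)%:R.
Proof.
move=> hl hx; rewrite /lag horner_prod.
have [->|xl] := eqVneq x l.
  by rewrite big1 // => y yl; rewrite hornerZ hornerXsubC mulVf // subr_eq0 eq_sym.
rewrite big_mkcond (big_rem _ hx) /= xl hornerZ hornerXsubC subrr mulr0 mul0r //.
Qed.

Lemma lag_sum (F : C -> C) x : x \in rs -> (\sum_(l <- rs) F l *: lag l).[x] = F x.
Proof.
move=> hx; rewrite horner_sum (bigD1_seq x) //= hornerZ lagE // eqxx mulr1.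
rewrite big_seq_cond big1 ?addr0 // => y /andP[hy yx].
by rewrite hornerZ lagE // eq_sym (negbTE yx) mulr0.
Qed.

Lemma size_lag l : l \in rs -> (size (lag l) <= m)%N.
Proof.
move=> hl; rewrite /lag; have : (0 < m)%N by case: (rs) hl.
have -> : m = (\sum_(x <- rs | x != l) 1).+1.
  rewrite sum1_count -(count_predC (pred1 l)) addnC (count_uniq_mem _ rs_uniq) hl addn1 //.
move=> _; elim/big_rec2: _ => [|x n p _ h]; first by rewrite size_poly1.
apply: leq_trans (size_polyMleq _ _) _; rewrite add1n.
have h2 : (size ((l - x)^-1 *: ('X - x%:P)) <= 2)%N.
  by apply: leq_trans (size_scale_leq _ _) _; rewrite size_XsubC.
by have := leq_add h2 h; rewrite !addSn add0n; case: (_ + _)%N.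
Qed.

Lemma poly_eq_on (p q : {poly C}) : (size p <= m)%N -> (size q <= m)%N ->
  (forall x, x \in rs -> p.[x] = q.[x]) -> p = q.
Proof.
move=> sp sq h; apply/eqP; rewrite -subr_eq0; apply/eqP.
apply: (@roots_geq_poly_eq0 _ _ rs).
- by apply/allP => x hx; rewrite /root hornerD hornerN h ?subrr.
- by [].
- by rewrite (leq_trans (size_polyD _ _)) // size_polyN geq_max sp.
Qed.

Lemma interpolate (p : {poly C}) : (size p <= m)%N ->
  p = \sum_(l <- rs) p.[l] *: lag l.
Proof.
move=> sp; apply: poly_eq_on => //.
  rewrite big_seq; apply: (big_ind (fun q : {poly C} => (size q <= m)%N)).
  - by rewrite size_poly0.
  - by move=> p1 p2 h1 h2; rewrite (leq_trans (size_polyD _ _)) // geq_max h1.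
  - by move=> l hl; rewrite (leq_trans (size_scale_leq _ _)) // size_lag.
by move=> x hx; rewrite lag_sum.
Qed.

Lemma sum_lag : (0 < m)%N -> \sum_(l <- rs) lag l = 1.
Proof.
move=> m0; rewrite [RHS]interpolate ?size_poly1 //.
by apply: eq_bigr => l _; rewrite hornerC scale1r.
Qed.

(** The [i]-th coefficient of the polynomial interpolating [F] on [rs]. These are linear coordinates
    for functions on [rs], and they are real when [F] is conjugation-symmetric. *)
Definition lcoord (F : C -> C) i := \sum_(l <- rs) F l * (lag l)`_i.

Lemma lcoordK F x : x \in rs -> \sum_(i < m) lcoord F i * x ^+ i = F x.
Proof.
move=> hx; have -> : \sum_(i < m) lcoord F i * x ^+ i = (\sum_(l <- rs) F l *: lag l).[x].
  rewrite horner_sum; under eq_bigr do rewrite /lcoord mulr_suml.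
  rewrite exchange_big /= [LHS]big_seq [RHS]big_seq; apply: eq_bigr => l hl.
  rewrite hornerZ (horner_coef_wide _ (size_lag hl)) mulr_sumr.
  by apply: eq_bigr => i _; rewrite mulrA.
exact: lag_sum.
Qed.

Lemma lcoord_poly (p : {poly C}) i : (size p <= m)%N -> lcoord (fun l => p.[l]) i = p`_i.
Proof.
move=> sp; rewrite [in RHS](interpolate sp) coef_sum.
by apply: eq_bigr => l _; rewrite coefZ.
Qed.

Lemma lcoordB F H i : lcoord (fun l => F l - H l) i = lcoord F i - lcoord H i.
Proof. by rewrite /lcoord -sumrB; apply: eq_bigr => l _; rewrite mulrBl. Qed.

Lemma lcoordD F H i : lcoord (fun l => F l + H l) i = lcoord F i + lcoord H i.
Proof. by rewrite /lcoord -big_split; apply: eq_bigr => l _; rewrite mulrDl. Qed.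

Lemma eq_coord F H i : {in rs, F =1 H} -> lcoord F i = lcoord H i.
Proof. by move=> FH; rewrite /lcoord big_seq [RHS]big_seq; apply: eq_bigr => l /FH->. Qed.

(** Invertibility of the Vandermonde matrix: combining the relations with the coefficients of
    [lag x] isolates [F x]. *)
Lemma moments_eq0 (F : C -> C) : (forall i, (i < m)%N -> \sum_(l <- rs) F l * l ^+ i = 0) ->
  {in rs, forall l, F l = 0}.
Proof.
move=> h x hx.
have : \sum_(l <- rs) F l * (lag x).[l] = 0.
  under eq_bigr do rewrite (horner_coef_wide _ (size_lag hx)) mulr_sumr.
  rewrite exchange_big big1 //= => i _.
  under eq_bigr do rewrite mulrCA.
  by rewrite -mulr_sumr h // mulr0.
rewrite (bigD1_seq x) //= lagE // eqxx mulr1 big_seq_cond big1 ?addr0 // => y /andP[hy yx].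
by rewrite lagE // (negbTE yx) mulr0.
Qed.

Hypothesis conj_closed : forall l, l \in rs -> l^*%C \in rs.

Lemma lag_conj l : l \in rs -> lag l^*%C = map_poly conjc (lag l).
Proof.
move=> hl; apply: poly_eq_on; rewrite ?size_lag ?conj_closed ?size_map_poly ?size_lag //.
move=> x hx; rewrite -[in RHS](conjcK x) horner_map /= !lagE ?conj_closed //.
by rewrite rmorph_nat (can2_eq (@conjcK R) (@conjcK R)).
Qed.

Definition conj_sym (F : C -> C) := forall l, l \in rs -> F l^*%C = (F l)^*%C.

Lemma perm_conj : perm_eq [seq l^*%C | l <- rs] rs.
Proof.
have ui : uniq [seq l^*%C | l <- rs].
  by rewrite map_inj_uniq // => a b h; rewrite -[a]conjcK h conjcK.
apply: uniq_perm => // x; apply/mapP/idP => [[y yr ->]|xr]; first exact: conj_closed.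
by exists x^*%C; rewrite ?conj_closed // conjcK.
Qed.

Lemma lcoord_real F i : conj_sym F -> lcoord F i = (complex.Re (lcoord F i))%:C%C.
Proof.
move=> hF; suff h : (lcoord F i)^*%C = lcoord F i.
  by case: (lcoord F i) h => a b /= [h]; have -> : b = 0 by lra.
rewrite /lcoord -[in LHS](perm_big _ perm_conj) big_map rmorph_sum /= big_seq [RHS]big_seq.
apply: eq_bigr => l hl; rewrite rmorphM /= hF // conjcK; congr (_ * _).
by rewrite lag_conj // coef_map /= conjcK.
Qed.

End Lagrange.

Section Steering.
Variables (R : realType) (Lam : seq R[i]).
Hypotheses (Lam_uniq : uniq Lam) (Lam_conj : forall l, l \in Lam -> l^*%C \in Lam)
  (Lam_unit : forall l, l \in Lam -> normc l = 1)
  (Lam_aperiodic : forall l, l \in Lam -> forall n, l ^+ n.+1 != 1).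
Local Notation C := R[i].
Local Notation m := (size Lam).
Local Notation lcoord := (lcoord Lam).
Local Notation lag := (lag Lam).

Definition ev (P : {poly int}) (l : C) : C := (map_poly intr P).[l].

Lemma evD P Q l : ev (P + Q) l = ev P l + ev Q l.
Proof. by rewrite /ev rmorphD hornerD. Qed.

Lemma evB P Q l : ev (P - Q) l = ev P l - ev Q l.
Proof. by rewrite /ev rmorphB hornerD hornerN. Qed.

Lemma evXn n l : ev 'X^n l = l ^+ n.
Proof. by rewrite /ev map_polyXn hornerXn. Qed.

Lemma ev_conj P : conj_sym Lam (ev P).
Proof.
move=> l _; rewrite /ev -horner_map /= -map_poly_comp; congr horner.
by apply: eq_map_poly => z /=; rewrite rmorph_int.
Qed.

(* An integral relation would give a bounded integer sequence [\sum_l b l * l ^+ i]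
   obeying an invertible linear recurrence, hence periodic, although no [l] is a
   root of unity: this is Kronecker's argument. *)
Lemma integral_relation_trivial (a : 'I_m -> int) :
  (forall P, exists z : int, \sum_i (a i)%:~R * complex.Re (lcoord (ev P) i) = z%:~R) ->
  forall i, a i = 0.
Proof.
move=> ha; have /choice[z hz] n := ha 'X^n.
pose b l := \sum_(i < m) (a i)%:~R * (lag l)`_i.
have zE n : (z n)%:~R = \sum_(l <- Lam) b l * l ^+ n.
  have -> : (z n)%:~R = (((z n)%:~R : R)%:C%C) :> C by rewrite rmorph_int.
  rewrite -hz rmorph_sum /=.
  under [RHS]eq_bigr do rewrite mulr_suml.
  rewrite exchange_big /=; apply: eq_bigr => i _.
  rewrite rmorphM rmorph_int /= -(lcoord_real Lam_uniq Lam_conj i (ev_conj 'X^n)) mulr_sumr.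
  by apply: eq_bigr => l _; rewrite evXn; ring.
pose S := \sum_(l <- Lam) normc (b l).
have zS n : `|(z n)%:~R| <= S :> R.
  rewrite -normcR rmorph_int zE; apply: le_trans (normc_sum _ _ _) _.
  rewrite /S big_seq [X in _ <= X]big_seq; apply: ler_sum => l hl.
  by rewrite normcM normcX (Lam_unit hl) expr1n mulr1.
pose K := (Num.truncn S).+1.
have zK n : (`|z n| <= K)%N.
  rewrite -ltnS -(ltr_nat R) natr_absz intr_norm.
  apply: le_lt_trans (zS n) _; apply: lt_trans (truncnS_gt _) _.
  by rewrite ltr_nat.
clearbody K.
(* There are finitely many windows of [m] consecutive values, so two of them coincide; [m] equal
   values suffice for [moments_eq0] to give [b l * (l ^+ n2 - l ^+ n1) = 0]. *)
pose F (n : 'I_(#|{ffun 'I_m -> 'I_(K + K).+1}|.+1)) :=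
  [ffun j : 'I_m => inord (absz (z (n + j)%N + K%:Z)) : 'I_(K + K).+1].
have [|n1 [n2 [lt12 eF]]] := pigeonhole_lt F; first by rewrite ?card_ord.
have zz j : (j < m)%N -> z (n1 + j)%N = z (n2 + j)%N.
  move=> hj; have := congr1 (fun f : {ffun 'I_m -> 'I_(K + K).+1} => nat_of_ord (f (Ordinal hj))) eF.
  have := zK (n1 + j)%N; have := zK (n2 + j)%N.
  rewrite !ffunE /=; move: (z (n1 + j)%N) (z (n2 + j)%N) => x y hx hy.
  by rewrite !inordK; lia.
have b0 : {in Lam, forall l, b l = 0}.
  move=> l hl; have := @moments_eq0 _ Lam Lam_uniq (fun l => b l * (l ^+ n2 - l ^+ n1)).
  move=> /(_ _ l hl) H; have {H} : b l * (l ^+ n2 - l ^+ n1) = 0.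
    apply: H => j hj; have := zz j hj => /(congr1 (fun x : int => x%:~R : C)).
    rewrite !zE => /eqP; rewrite eq_sym -subr_eq0 -sumrB => /eqP e0; rewrite -[RHS]e0.
    by apply: eq_bigr => x _; rewrite !exprD; ring.
  have l0 : l != 0 by rewrite -normc_eq0 Lam_unit // oner_eq0.
  rewrite -(subnKC (ltnW lt12)) exprD -[X in _ - X]mulr1 -mulrBr => /eqP.
  rewrite !mulf_eq0 expf_eq0 (negbTE l0) andbF /= subr_eq0 => /orP[/eqP//|].
  have : (0 < n2 - n1)%N by rewrite subn_gt0.
  by case: (n2 - n1)%N => // k _; rewrite (negbTE (Lam_aperiodic hl k)).
(* For [i < m] the polynomial ['X^i] is its own interpolation, so that [z i] is [a i]. *)
move=> i; have zi : z i = 0.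
  apply/eqP; rewrite -(intr_eq0 C) zE big_seq big1 // => l hl.
  by rewrite b0 // mul0r.
have := hz i; rewrite zi (bigD1 i) //= big1 ?addr0 => [|j ji].
  rewrite (eq_coord (H := fun x => ('X^i).[x])); last by move=> x _; rewrite evXn hornerXn.
  rewrite lcoord_poly ?size_polyXn ?ltn_ord // coefXn eqxx mulr1 => /eqP.
  by rewrite eqr_int => /eqP.
rewrite (eq_coord (H := fun x => ('X^i).[x])); last by move=> x _; rewrite evXn hornerXn.
by rewrite lcoord_poly ?size_polyXn ?ltn_ord // coefXn val_eqE (negbTE ji) mulr0.
Qed.

Lemma lcoord_close F H (e : R) l : conj_sym Lam F -> conj_sym Lam H -> l \in Lam ->
  (forall i : 'I_m, `|complex.Re (lcoord F i) - complex.Re (lcoord H i)| <= e) ->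
  normc (F l - H l) <= m%:R * e.
Proof.
move=> hF hH hl h.
rewrite -(lcoordK Lam_uniq F hl) -(lcoordK Lam_uniq H hl) -sumrB.
apply: le_trans (normc_sum _ _ _) _.
rewrite mulr_natl -[m in X in _ <= X]card_ord -sumr_const; apply: ler_sum => i _.
rewrite -mulrBl normcM normcX (Lam_unit hl) expr1n mulr1 (lcoord_real Lam_uniq Lam_conj i hF).
by rewrite (lcoord_real Lam_uniq Lam_conj i hH) -rmorphB normcR.
Qed.

Lemma ev_sum (I : Type) (s : seq I) (P : I -> {poly int}) l :
  ev (\sum_(i <- s) P i) l = \sum_(i <- s) ev (P i) l.
Proof. by rewrite /ev rmorph_sum horner_sum. Qed.

(** Kronecker's theorem on the group of integer polynomials, for the characters that read one
    interpolation coordinate modulo 1; [integral_relation_trivial] removes every obstruction.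
    Approximation modulo 1 is enough, because subtracting an integer polynomial of size at most [m]
    moves the coordinates by arbitrary integers. *)
Lemma int_poly_dense (eps : R) t : 0 < eps -> conj_sym Lam t ->
  exists P, {in Lam, forall l, normc (ev P l - t l) < eps}.
Proof.
move=> eps0 ht; pose e1 := eps / m.+1%:R.
have e10 : 0 < e1 by rewrite divr_gt0.
have [r r0 hr] := cis_near e10.
pose g (i : 'I_m) (P : {poly int}) : C := cis (complex.Re (lcoord (ev P) i)).
have g_unit i : unit_char (g i).
  split => [P Q|P]; last exact: normc_cis.
  rewrite /g (eq_coord (H := fun l => ev P l + ev Q l)); last by move=> l _; rewrite evD.
  by rewrite lcoordD raddfD cisD.
have hrel (al be : 'I_m -> nat) :
    (forall P, setT P -> \prod_i g i P ^+ al i = \prod_i g i P ^+ be i) ->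
    \prod_(i < m) cis (complex.Re (lcoord t i)) ^+ al i =
      \prod_(i < m) cis (complex.Re (lcoord t i)) ^+ be i.
  move=> hab; suff ab i : al i = be i by apply: eq_bigr => i _; rewrite ab.
  suff : (al i : int) - (be i : int) = 0 by lia.
  move: i; apply: (integral_relation_trivial (a := fun i => (al i : int) - (be i : int))) => P.
  have /(_ I) := hab P; rewrite /g => h.
  have [z hz] : exists z : int, \sum_i (al i)%:R * complex.Re (lcoord (ev P) i)
      - \sum_i (be i)%:R * complex.Re (lcoord (ev P) i) = z%:~R.
    apply: cis_eq1; rewrite cisB.
    have e (c : 'I_m -> nat) : cis (\sum_(i < m) (c i)%:R * complex.Re (lcoord (ev P) i)) =
        \prod_(i < m) cis (complex.Re (lcoord (ev P) i)) ^+ c i.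
      rewrite (big_morph (@cis R) (@cisD R) (cis0 R)).
      by apply: eq_bigr => i _; rewrite cisM_nat.
    rewrite !e h divff //.
    by apply/prodf_neq0 => i _; rewrite expf_neq0 // cis_neq0.
  exists z; rewrite -hz -sumrB; apply: eq_bigr => i _.
  by rewrite intrB mulrBl -!pmulrn.
have sT : is_subgroup [set: {poly int}] by [].
have [P _ hP] := kronecker_approx sT g_unit (fun i => normc_cis _) hrel r0.
have /choice[k hk] (i : 'I_m) : exists k : int,
    `|complex.Re (lcoord (ev P) i) - complex.Re (lcoord t i) - k%:~R| < e1.
  apply: hr; have -> : cis (complex.Re (lcoord (ev P) i) - complex.Re (lcoord t i)) - 1 =
      (g i P - cis (complex.Re (lcoord t i))) / cis (complex.Re (lcoord t i)).
    by rewrite mulrBl divff ?cis_neq0 // cisB.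
  by rewrite normcM normcV normc_cis divr1; exact: hP.
exists (P - \sum_(i < m) (k i)%:P * 'X^i) => l hl.
apply: (@le_lt_trans _ _ (m%:R * e1)).
  apply: lcoord_close => // [|i]; first exact: ev_conj.
  pose q : {poly C} := \poly_(i < m) oapp (fun j => (k j)%:~R) 0 (insub i).
  rewrite (eq_coord (H := fun l => ev P l - q.[l])).
    rewrite lcoordB (@lcoord_poly _ _ Lam_uniq q) ?size_poly // coef_poly ltn_ord valK /= raddfB /=.
    have -> : complex.Re ((k i)%:~R : C) = (k i)%:~R by rewrite -(rmorph_int (real_complex R)).
    by rewrite addrAC ltW.
  move=> x _; rewrite evB; congr (_ - _); rewrite ev_sum /q poly_def horner_sum.
  apply: eq_bigr => j _; rewrite /ev rmorphM /= map_polyC map_polyXn valK /=.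
  by rewrite mul_polyC.
have : m.+1%:R * e1 = eps by rewrite /e1 mulrC divfK // pnatr_eq0.
by rewrite -natr1 mulrDl mul1r; lra.
Qed.

(** Makes the density uniform: bounded targets are rounded to a finite grid, and the bounds on size
    and coefficients are taken over the polynomials chosen for the grid points. *)
Lemma steering (W eps : R) : 0 < eps -> exists (G : nat) (V : R), forall t,
  conj_sym Lam t -> {in Lam, forall l, normc (t l) <= W} ->
  exists P : {poly int}, [/\ (size P <= G)%N, forall i, `|(P`_i)%:~R| <= V &
    {in Lam, forall l, normc (ev P l - t l) < eps}].
Proof.
move=> eps0; pose e1 := eps / (m.+1%:R * 2).
have e10 : 0 < e1 by rewrite divr_gt0 // mulr_gt0.
(* [D] bounds the coordinates of all targets, so multiples of [e1] with factors from [- Q] to [Q]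
   reach each of them up to [e1]; the factors are shifted by [Q] to be ordinals. *)
pose D := \sum_(l <- Lam) \sum_(i < m) `|W| * normc (lag l)`_i.
pose Q := (Num.truncn (D / e1)).+1.
pose grid (c : {ffun 'I_m -> 'I_(Q + Q).+1}) (l : C) : C :=
  \sum_(i < m) (((c i)%:R - Q%:R) * e1)%:C%C * l ^+ i.
have grid_sym c : conj_sym Lam (grid c).
  move=> l _; rewrite /grid rmorph_sum; apply: eq_bigr => i _ /=.
  rewrite [RHS](rmorphM (@conjc R)); congr (_ * _); first exact/esym/conjc_real.
  by rewrite [RHS](rmorphXn (@conjc R)).
have /choice[P hP] c : exists P, {in Lam, forall l, normc (ev P l - grid c l) < eps / 2}.
  by apply: int_poly_dense; rewrite ?divr_gt0.
exists (\max_c size (P c)), (\sum_c \sum_(i < size (P c)) `|((P c)`_i)%:~R|) => t ht tW.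
have tD i : `|complex.Re (lcoord t i)| <= D.
  have [im|mi] := ltnP i m; last first.
    rewrite /lcoord big_seq big1 => [|l hl]; last first.
      by rewrite (nth_default _ (leq_trans (size_lag Lam_uniq hl) mi)) mulr0.
    rewrite normr0 /D; apply: sumr_ge0 => l _; apply: sumr_ge0 => j _.
    by rewrite mulr_ge0 ?normc_ge0.
  apply: le_trans (ler_Re_normc _) _; apply: le_trans (normc_sum _ _ _) _.
  rewrite /D big_seq [X in _ <= X]big_seq; apply: ler_sum => l hl.
  rewrite (bigD1 (Ordinal im)) //= -[X in X <= _]addr0 lerD //.
    by rewrite normcM ler_wpM2r ?normc_ge0 // (le_trans (tW l hl)) // ler_norm.
  by apply: sumr_ge0 => j _; rewrite mulr_ge0 ?normc_ge0.
have Dq : D < Q%:R * e1 by rewrite -ltr_pdivrMr // truncnS_gt.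
pose k i := Num.floor (complex.Re (lcoord t i) / e1).
have hk i : 0 <= complex.Re (lcoord t i) - (k i)%:~R * e1 < e1.
  have h1 : (k i)%:~R <= complex.Re (lcoord t i) / e1 by rewrite ge_floor.
  have h2 : complex.Re (lcoord t i) / e1 < (k i)%:~R + 1.
    by rewrite -[1]/(1%:~R) -intrD lt_succ_floor.
  by move: h1 h2; rewrite ler_pdivlMr // ltr_pdivrMr // => h1 h2; nra.
have kQ i : - (Q%:Z) <= k i <= Q%:Z.
  have := hk i; have := tD i; rewrite ler_norml => /andP[h1 h2] /andP[h3 h4].
  apply/andP; split.
    have : (- Q%:Z - 1)%:~R * e1 < (k i)%:~R * e1 :> R.
      by rewrite intrB intrN -pmulrn; lra.
    by rewrite ltr_pM2r // ltr_int; lia.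
  have : (k i)%:~R * e1 < (Q%:Z)%:~R * e1 :> R by rewrite -pmulrn; lra.
  by rewrite ltr_pM2r // ltr_int => /ltW.
pose c : {ffun 'I_m -> 'I_(Q + Q).+1} := [ffun i : 'I_m => inord (absz (k i + Q%:Z))].
have cE i : (c i)%:R - Q%:R = (k i)%:~R :> R.
  have := kQ i; rewrite ffunE inordK; last by have := kQ i; lia.
  move=> h; have -> : k i = (absz (k i + Q%:Z))%:Z - Q%:Z by lia.
  by rewrite intrB -!pmulrn; congr (_%:R - _); lia.
exists (P c); split.
- exact: leq_bigmax.
- move=> i; rewrite (bigD1 c) //= -[X in X <= _]addr0 lerD //; last first.
    by apply: sumr_ge0 => c' _; apply: sumr_ge0.
  have [ip|pi] := ltnP i (size (P c)); last first.
    by rewrite nth_default // normr0 sumr_ge0.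
  rewrite (bigD1 (Ordinal ip)) //= -[X in X <= _]addr0 lerD // sumr_ge0 //.
- move=> l hl.
  have -> : ev (P c) l - t l = (ev (P c) l - grid c l) + (grid c l - t l) by ring.
  apply: le_lt_trans (normcD _ _) _.
  have h1 := hP c l hl.
  have h2 : normc (grid c l - t l) <= m%:R * e1.
    apply: lcoord_close => // i.
    pose q : {poly C} := \poly_(i < m) ((k i)%:~R * e1)%:C%C.
    rewrite (eq_coord (H := fun l => q.[l])).
      rewrite (@lcoord_poly _ _ Lam_uniq q) ?size_poly // coef_poly ltn_ord /=.
      by have := hk i; rewrite distrC ler_norml; lra.
    move=> x _; rewrite /q poly_def horner_sum; apply: eq_bigr => j _.
    by rewrite cE hornerZ hornerXn.
  have h3 : m%:R * e1 < eps / 2.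
    have M0 : m.+1%:R != 0 :> R by rewrite pnatr_eq0.
    have : m.+1%:R * e1 = eps / 2.
      by rewrite /e1; move: (m.+1%:R : R) M0 => M M0; field.
    by rewrite -natr1 mulrDl mul1r; lra.
  by lra.
Qed.

End Steering.

(** * Partial specification of factors *)

Section IntervalCounts.
Implicit Types (p q : pred nat) (a b c : nat).

Definition cnt p a b := count p (index_iota a b).

Lemma cntD p a b c : (a <= b <= c)%N -> cnt p a c = (cnt p a b + cnt p b c)%N.
Proof.
move=> /andP[ab bc]; rewrite /cnt /index_iota -count_cat.
by rewrite -[in iota b _](subnKC ab) -iotaD; congr (count p (iota a _)); lia.
Qed.

Lemma cnt_le p a b : (cnt p a b <= b - a)%N.
Proof. by rewrite /cnt (leq_trans (count_size _ _)) // size_iota. Qed.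

Lemma sub_cnt p q a b : (forall k, (a <= k < b)%N -> p k -> q k) -> (cnt p a b <= cnt q a b)%N.
Proof.
move=> h; rewrite /cnt -[X in (X <= _)%N](_ : count (fun k => p k && q k) (index_iota a b) = _).
  by apply: sub_count => k /andP[].
by apply: eq_in_count => k; rewrite mem_index_iota => /h; case: (p k) => // ->.
Qed.

Lemma cnt_predC p a b : (cnt p a b + cnt (predC p) a b = b - a)%N.
Proof. by rewrite /cnt count_predC size_iota. Qed.

Lemma cnt_chunks p a b Q K : (a <= b)%N -> (b <= a + K * Q)%N ->
  cnt p a b = (\sum_(q < K) cnt p (minn (a + q * Q) b) (minn (a + q.+1 * Q) b))%N.
Proof.
move=> ab bK.
suff h : forall K, cnt p a (minn (a + K * Q) b) =
    (\sum_(q < K) cnt p (minn (a + q * Q) b) (minn (a + q.+1 * Q) b))%N.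
  by rewrite -h; congr cnt; apply/esym/minn_idPr.
elim=> [|k IH]; first by rewrite big_ord0 mul0n addn0 (minn_idPl ab) /cnt /index_iota subnn.
rewrite big_ord_recr /= -IH; apply: cntD.
by rewrite leq_min leq_addr ab /= leq_min geq_minr andbT geq_min mulSn addnCA leq_addl.
Qed.

(** A chunk consists of a traced core from [k0] to [k1] and a gap from [k1] to [k2]. The last clause
    says that a nonempty gap is preceded by a full core, so even a truncated chunk can pay for its
    gap. *)
Lemma chunk_arith k0 b L M Q k1 k2 : Q = (L + M)%N -> (k0 < b)%N -> (0 < L)%N ->
  k1 = minn (k0 + L) b -> k2 = minn (k0 + Q) b ->
  [/\ (k0 < k1 <= k2)%N, (k2 - k1 <= M)%N, (k1 - k0 <= L)%N, (k1 <= k0 + Q)%N &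
    ((L <= k2 - k0) || (k2 - k1 == 0))%N].
Proof. by move=> -> h L0 -> ->; split; lia. Qed.

End IntervalCounts.

Section Tracing.
Variables (R : realType) (X : topologicalZmodType) (d : X -> X -> R) (T : X -> X).
Hypotheses (hd : compatible_metric d) (cX : compact [set: X]).
Hypotheses (TD : forall x y, T (x + y) = T x + T y) (Tbij : bijective T) (Tc : continuous T).
Local Notation sz := (sz d).
Local Notation block := (X * nat * nat)%type.
Implicit Types (e : R) (x y z w : X) (A B C : set X) (P : set nat) (t : block) (s : seq block).

Definition stable A := is_subgroup A /\ T @` A = A.

(* a block [(x, a, b)] prescribes the orbit of [x] over the times [a <= k < b] *)
Definition spaced M s :=
  all (fun t => t.1.2 < t.2)%N s && pairwise (fun t t' => t.2 + M <= t'.1.2)%N s.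

Definition close_mod e B z := exists2 b, B b & sz (z - b) < e.

Definition off e B x y : pred nat := fun k => ~~ `[< close_mod e B (iter k T x - iter k T y) >].

Definition traces e B y t :=
  (cnt (off e B t.1.1 y) t.1.2 t.2)%:R < e * (t.2 - t.1.2)%:R.

(* partial specification of the factor [A / B], lifted to [A] *)
Definition pspec P A B := forall e, 0 < e -> exists M : nat, forall s n,
  spaced M s -> (forall t, t \in s -> A t.1.1) -> P n -> (0 < n)%N -> (M <= n)%N ->
  (forall t, t \in s -> (1 + e) * (t.2)%:R <= n%:R) ->
  exists y, [/\ A y, B (iter n T y - y) & forall t, t \in s -> traces e B y t].

Definition separated J (F : set nat) :=
  forall n n', F n -> F n' -> (n < n')%N -> (n + J <= n')%N.

Definition cosparse q J P := exists F : 'I_q -> set nat,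
  (forall i, separated J (F i)) /\ (forall n, P n \/ exists i, F i n).

(** The order of quantifiers matters: [q] is fixed first, so that [J] can be taken larger than
    [c * q.+1] at the end. In extensions the numbers [q] just add up. *)
Definition spec A B := exists q, forall J, exists2 P, cosparse q J P & pspec P A B.

Lemma iterTD k x y : iter k T (x + y) = iter k T x + iter k T y.
Proof. by elim: k => //= k ->; rewrite TD. Qed.

Lemma iterTN k x : iter k T (- x) = - iter k T x.
Proof. by elim: k => //= k ->; apply: (addrI (T (iter k T x))); rewrite -TD !subrr (auto0 TD). Qed.

Lemma iterTB k x y : iter k T (x - y) = iter k T x - iter k T y.
Proof. by rewrite iterTD iterTN. Qed.

Lemma stable_iter A k x : stable A -> A x -> A (iter k T x).
Proof.
move=> [_ TA] Ax; elim: k => //= k IH.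
by rewrite -TA; exists (iter k T x).
Qed.

Lemma stable_preiter A k x : stable A -> A x -> exists2 y, A y & iter k T y = x.
Proof.
move=> [_ TA]; elim: k x => [|k IH] x Ax; first by exists x.
have [y Ay <-] := IH x Ax; move: (Ay); rewrite -[X in X y]TA => -[z Az <-].
by exists z => //; rewrite -iterSr.
Qed.

Lemma cosparseI q1 q2 J P1 P2 : cosparse q1 J P1 -> cosparse q2 J P2 ->
  cosparse (q1 + q2) J (P1 `&` P2).
Proof.
move=> [F1 [s1 h1]] [F2 [s2 h2]].
exists (fun i => match fintype.split i with inl i => F1 i | inr i => F2 i end); split.
  by move=> i; case: (fintype.split i).
move=> n; case: (h1 n) => [p1|[i hi]].
  case: (h2 n) => [p2|[i hi]]; first by left.
  by right; exists (unsplit (inr i)); rewrite unsplitK.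
by right; exists (unsplit (inl i)); rewrite unsplitK.
Qed.

Lemma pspecS P P' A B : P' `<=` P -> pspec P A B -> pspec P' A B.
Proof.
move=> PP h e e0; have [M hM] := h e e0; exists M => s n h1 h2 /PP.
exact: hM.
Qed.

Lemma spec_trivial A : stable A -> spec A A.
Proof.
move=> hA; exists 0%N => J; exists setT.
  by exists (fun=> setT); split => [[]//|n]; left.
move=> e e0; exists 0%N => s n /andP[/allP hs _] sA _ n0 _ _; exists 0.
have i0 k : iter k T 0 = 0 by elim: k => //= k ->; rewrite auto0.
split; [exact: hA.1.1|by rewrite i0 subr0; exact: hA.1.1|move=> t ts; rewrite /traces].
have -> : cnt (off e A t.1.1 0) t.1.2 t.2 = 0%N.
  apply/eqP; rewrite -leqn0 -[X in (_ <= X)%N](_ : cnt pred0 t.1.2 t.2 = 0%N); last by rewrite /cnt count_pred0.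
  apply: sub_cnt => k _; rewrite /off => /negP []; apply/asboolP.
  exists (iter k T t.1.1); first by apply: stable_iter => //; exact: sA.
  by rewrite i0 subr0 subrr (sz0 hd).
by rewrite mulr_gt0 // ltr0n subn_gt0 hs.
Qed.

(** Block points are replaced by chosen preimages under [phi], and the tracing point is pushed
    forward. It will be applied to polynomials in [T]. *)
Lemma pspec_factor (phi : X -> X) P A B :
  (forall x y, phi (x + y) = phi x + phi y) ->
  (forall e, 0 < e -> exists2 r, 0 < r & forall x, sz x < r -> sz (phi x) < e) ->
  (forall x, phi (T x) = T (phi x)) ->
  pspec P A B -> pspec P (phi @` A) (phi @` B).
Proof.
move=> phiD phis phiT h e e0; have [r r0 hr] := phis e e0.
have phi0 : phi 0 = 0 by apply: (addrI (phi 0)); rewrite -phiD !addr0.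
have phiN x : phi (- x) = - phi x by apply: (addrI (phi x)); rewrite -phiD !subrr.
have phi_iter k x : phi (iter k T x) = iter k T (phi x) by elim: k => //= k <-.
pose e1 := Num.min e r; have e10 : 0 < e1 by rewrite lt_min e0 r0.
have e1e : e1 <= e by rewrite ge_min lexx.
have e1r : e1 <= r by rewrite ge_min lexx orbT.
have [M hM] := h e1 e10; exists M => s n hs sA Pn n0 Mn tn.
have /choice[g hg] x : exists y, (phi @` A) x -> A y /\ phi y = x.
  have [[y Ay yx]|h'] := pselect ((phi @` A) x); first by exists y.
  by exists x.
pose f t : block := (g t.1.1, t.1.2, t.2).
have [|u /mapP[t ts ->]|//|//|//|u /mapP[t ts ->]|y [Ay By ht]] := hM (map f s) n.
- by case/andP: hs => h1 h2; rewrite /spaced all_map pairwise_map; apply/andP.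
- by have [] := hg _ (sA _ ts).
- by apply: le_trans (tn _ ts); rewrite ler_wpM2r // lerD2l.
exists (phi y); split; first by exists y.
  by exists (iter n T y - y); rewrite // phiD phiN phi_iter.
move=> t ts; have := ht (f t) (map_f f ts); rewrite /traces /= => h1.
apply: (@lt_le_trans _ _ (e1 * (t.2 - t.1.2)%:R)); last by rewrite ler_wpM2r.
apply: le_lt_trans h1; rewrite ler_nat; apply: sub_cnt => k _.
apply: contra => /asboolP [b Bb hb]; apply/asboolP; exists (phi b); first by exists b.
have [_ <-] := hg _ (sA _ ts).
rewrite -!phi_iter -!phiN -!phiD; apply: hr.
by apply: lt_le_trans e1r.
Qed.

Lemma close_modD e B z b : is_subgroup B -> B b -> close_mod e B z -> close_mod e B (z + b).
Proof.
move=> hB Bb [c Bc hc]; exists (c + b); first exact: subgroupD.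
by have -> : z + b - (c + b) = z - c by zmod.
Qed.

(** Cores of length [L] separated by gaps [M], the last core being truncated at the end of the
    block; [zf] supplies a new point for each starting time. The [- 1] makes the last core start
    strictly before [t.2]. *)
Definition chop (zf : X -> nat -> X) L M t : seq block :=
  [seq (zf t.1.1 (t.1.2 + q * (L + M))%N, (t.1.2 + q * (L + M))%N,
        minn (t.1.2 + q * (L + M) + L) t.2) | q <- iota 0 ((t.2 - t.1.2 - 1) %/ (L + M)).+1].

Arguments chop : simpl never.

Lemma chop_bounds zf L M t u : (0 < L)%N -> (t.1.2 < t.2)%N -> u \in chop zf L M t ->
  [/\ (t.1.2 <= u.1.2)%N, (u.1.2 < u.2)%N & (u.2 <= t.2)%N].
Proof.
move=> L0 ht /mapP[q]; rewrite mem_iota add0n ltnS => /andP[_ hq] -> /=.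
have h : (q * (L + M) <= t.2 - t.1.2 - 1)%N.
  by rewrite (leq_trans _ (leq_trunc_div _ (L + M))) // leq_mul2r hq orbT.
by rewrite leq_addr geq_minr leq_min; split=> //; apply/andP; split; lia.
Qed.

Lemma pairwise_chop zf L M t : pairwise (fun u v => u.2 + M <= v.1.2)%N (chop zf L M t).
Proof.
rewrite /chop pairwise_map; set K := _.+1; move: (0%N) => j.
elim: K j => //= K IHK j; rewrite IHK andbT.
apply/allP => q; rewrite mem_iota => /andP[jq _] /=.
have : (j.+1 * (L + M) <= q * (L + M))%N by rewrite leq_mul2r jq orbT.
by rewrite mulSn; lia.
Qed.

Lemma chop_chunks zf L M t : (0 < L)%N -> (t.1.2 < t.2)%N -> exists K, [/\
  chop zf L M t = [seq (zf t.1.1 (t.1.2 + q * (L + M))%N, (t.1.2 + q * (L + M))%N,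
        minn (t.1.2 + q * (L + M) + L) t.2) | q <- iota 0 K],
  (t.2 <= t.1.2 + K * (L + M))%N & forall q, (q < K)%N -> (t.1.2 + q * (L + M) < t.2)%N].
Proof.
move=> L0 ht; exists ((t.2 - t.1.2 - 1) %/ (L + M)).+1; split => //.
  have Q0 : (0 < L + M)%N by rewrite addn_gt0 L0.
  by have := ltn_ceil (t.2 - t.1.2 - 1) Q0; set k := (_ * _)%N; lia.
move=> q; rewrite ltnS => hq.
have h : (q * (L + M) <= t.2 - t.1.2 - 1)%N.
  by rewrite (leq_trans _ (leq_trunc_div _ (L + M))) // leq_mul2r hq orbT.
by move: h; set k := (_ * _)%N; lia.
Qed.

Lemma spaced_chop zf L M M' s : (0 < L)%N -> (M <= M')%N -> spaced M' s ->
  spaced M (flatten [seq chop zf L M t | t <- s]).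
Proof.
move=> L0 MM; elim: s => [//|t s IH] hs0.
have /andP[/andP[ht hs] /andP[hts hp]] := hs0.
have /andP[h1 h2] : spaced M (flatten [seq chop zf L M t | t <- s]).
  by apply: IH; apply/andP.
rewrite /spaced -[flatten _]/(chop zf L M t ++ flatten [seq chop zf L M t | t <- s]).
rewrite all_cat h1 andbT pairwise_cat h2 pairwise_chop !andbT.
apply/andP; split; first by apply/allP => u /(chop_bounds L0 ht)[].
apply/allrelP => u v hu /flattenP[_ /mapP[t' ts' ->] hv].
have [_ _ u2] := chop_bounds L0 ht hu.
have [v1 _ _] := chop_bounds L0 (allP hs _ ts') hv.
apply: leq_trans v1; apply: leq_trans (allP hts _ ts'); exact: leq_add.
Qed.

(** A point tracing modulo [B] is corrected inside [B] to a periodic point [y1]. Where a chunk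
    starts well, the discrepancy to [y1] is close to the orbit of some point of [B], and stays so
    for [Q] steps. A periodic point modulo [C] of [B] tracing all these orbits is added to [y1]. *)
Lemma pspec_extension P A B C : stable A -> stable B -> B `<=` A ->
  is_subgroup C ->
  (forall n, (0 < n)%N -> forall b, B b -> exists2 v, B v & iter n T v - v = b) ->
  pspec P A B -> pspec P B C -> pspec P A C.
Proof.
move=> hA hB BA hC surj hAB hBC e e0.
have [r r0 hr] := sz_add hd e0.
pose e2 := Num.min (e / 4) r; have e20 : 0 < e2 by rewrite lt_min r0 divr_gt0.
have e2r : e2 <= r by rewrite ge_min lexx orbT.
have e24 : e2 <= e / 4 by rewrite ge_min lexx.
have [M2 hM2] := hBC e2 e20.
(* A gap of length [M2] is at most the proportion [e / 4] of a chunk with a full core of length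
   [L]. *)
pose L := (Num.truncn (M2%:R * 4 / e)).+1.
have L0 : (0 < L)%N by [].
have LR0 : 0 < L%:R :> R by rewrite ltr0n.
have M2L : M2%:R <= e / 4 * L%:R.
  have : M2%:R * 4 / e < L%:R by rewrite truncnS_gt.
  by rewrite ltr_pdivrMr //; lra.
clearbody L.
pose Q := (L + M2)%N; have QE : Q = (L + M2)%N by []; clearbody Q.
have [del del0 hdel] := sz_iter hd TD Tc Q r0.
(* One bad time modulo [B] may spoil a whole core of [L] times, which explains the third bound;
   [del] keeps a discrepancy small during the [Q] iterates of a chunk. *)
pose e1 := Num.min del (Num.min e (e / (4 * L%:R))).
have e10 : 0 < e1 by rewrite !lt_min del0 e0 /= divr_gt0 // mulr_gt0.
have e1e : e1 <= e by rewrite !ge_min lexx !orbT.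
have e1d : e1 <= del by rewrite ge_min lexx.
have e1L : L%:R * e1 <= e / 4.
  have : e1 <= e / (4 * L%:R) by rewrite !ge_min lexx !orbT.
  by rewrite ler_pdivlMr ?mulr_gt0 //; lra.
have [M1 hM1] := hAB e1 e10.
exists (maxn M1 M2) => s n hs sA Pn n0 Mn tn.
have spS M M' : (M <= M')%N -> spaced M' s -> spaced M s.
  move=> MM /andP[h1 h2]; rewrite /spaced h1; apply: sub_pairwise h2 => t t' h.
  exact: leq_trans (leq_add (leqnn _) MM) h.
have [|//|//|//||t ts|y0 [Ay0 By0 tr0]] := hM1 s n.
- exact: spS (leq_maxl _ _) hs.
- exact: leq_trans (leq_maxl _ _) Mn.
- by apply: le_trans (tn _ ts); rewrite ler_wpM2r // lerD2l.
have [v Bv hv] := surj n n0 _ By0.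
pose y1 := y0 - v; have y1E : y1 = y0 - v by []; clearbody y1.
have y1n : iter n T y1 = y1.
  rewrite y1E iterTB; apply/eqP; rewrite -subr_eq0; apply/eqP.
  have -> : iter n T y0 - iter n T v - (y0 - v) = (iter n T y0 - y0) - (iter n T v - v) by zmod.
  by rewrite hv subrr.
(* An element of [B] near the discrepancy at time [p.2], pulled back to time 0; at bad times the
   default is 0. *)
have /choice[zf0 hz0] (p : X * nat) : exists z, B z /\
    (close_mod e1 B (iter p.2 T p.1 - iter p.2 T y1) ->
     sz (iter p.2 T p.1 - iter p.2 T y1 - iter p.2 T z) < e1).
  have [[b Bb hb]|h] := pselect (close_mod e1 B (iter p.2 T p.1 - iter p.2 T y1)).
    by have [z Bz zb] := stable_preiter p.2 hB Bb; exists z; rewrite zb.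
  by exists 0; split => //; exact: hB.1.1.
pose zf x k := zf0 (x, k).
pose s2 := flatten [seq chop zf L M2 t | t <- s].
have /andP[/allP hs_all _] := hs.
have [|u|//|//||u|w [Bw Cw tr2]] := hM2 s2 n.
- exact: spaced_chop L0 (leq_maxr _ _) hs.
- move=> /flattenP[_ /mapP[t ts ->] /mapP[q _ ->]] /=.
  by have [] := hz0 (t.1.1, (t.1.2 + q * (L + M2))%N).
- exact: leq_trans (leq_maxr _ _) Mn.
- move=> /flattenP[_ /mapP[t ts ->] hu].
  have [_ _ u2] := chop_bounds L0 (hs_all _ ts) hu.
  apply: le_trans (tn _ ts); apply: ler_pM; rewrite ?addr_ge0 ?(ltW e20) ?ler_nat //.
  by rewrite lerD2l; lra.
exists (y1 + w); split.
- by apply: subgroupD; [exact: hA.1| |exact: BA]; rewrite y1E; apply: hA.1.2 => //; exact: BA.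
- rewrite iterTD y1n; have -> : y1 + iter n T w - (y1 + w) = iter n T w - w by zmod.
  exact: Cw.
case=> [[x a] b] ts; rewrite /traces /=.
have ab : (a < b)%N by exact: (hs_all _ ts).
have := tr0 _ ts; rewrite /traces /= => tr.
have [K [chopE bK qK]] := @chop_chunks zf L M2 (x, a, b) L0 ab.
rewrite /= -QE in chopE bK qK.
have chunk (q : 'I_K) :
    (cnt (off e C x (y1 + w)) (minn (a + q * Q) b) (minn (a + q.+1 * Q) b))%:R <=
    e / 2 * (cnt predT (minn (a + q * Q) b) (minn (a + q.+1 * Q) b))%:R +
    L%:R * (cnt (off e1 B x y0) (minn (a + q * Q) b) (minn (a + q.+1 * Q) b))%:R :> R.
  have qb := qK q (ltn_ord q).
  rewrite (minn_idPl (ltnW qb)); set k0 := (a + q * Q)%N in qb *.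
  pose k1 := minn (k0 + L) b; pose k2 := minn (a + q.+1 * Q) b.
  have k2E : k2 = minn (k0 + Q) b by rewrite /k2 mulSn /k0 addnCA addnC.
  have k1E : k1 = minn (k0 + L) b by [].
  have u_in : (zf x k0, k0, k1) \in s2.
    apply/flattenP; exists (chop zf L M2 (x, a, b)); first exact: map_f.
    by rewrite chopE; apply/mapP; exists (q : nat) => //; rewrite mem_iota add0n ltn_ord.
  rewrite -/k2; clearbody k0 k1 k2.
  have [/andP[k01 k12] k2M k1L k1Q kL] := chunk_arith QE qb L0 k1E k2E.
  rewrite (@cntD _ k0 k1 k2) ?(ltnW k01) ?k12 // natrD.
  have -> : cnt predT k0 k2 = (k2 - k0)%N by rewrite /cnt count_predT size_iota.
  have gap : (cnt (off e C x (y1 + w)) k1 k2)%:R <= e / 4 * (k2 - k0)%:R :> R.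
    have h1 := cnt_le (off e C x (y1 + w)) k1 k2.
    have h2 : 0 <= e / 4 * (k2 - k0)%:R by rewrite mulr_ge0 // divr_ge0 // ltW.
    case/orP: kL => [kL|/eqP kE]; last by move: h1; rewrite kE leqn0 => /eqP->.
    apply: (@le_trans _ _ M2%:R); first by rewrite ler_nat (leq_trans h1).
    by apply: le_trans M2L _; rewrite ler_wpM2l ?divr_ge0 ?(ltW e0) // ler_nat.
  have kk : (k1 - k0)%:R <= (k2 - k0)%:R :> R by rewrite ler_nat leq_sub2r.
  have [good|bad] := pselect (close_mod e1 B (iter k0 T x - iter k0 T y1)).
    have h3 : (cnt (off e C x (y1 + w)) k0 k1)%:R <= e / 4 * (k2 - k0)%:R :> R.
      apply: le_trans (_ : (cnt (off e2 C (zf x k0) w) k0 k1)%:R <= _); last first.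
        have := tr2 _ u_in; rewrite /traces /= => h.
        by apply: le_trans (ltW h) _; apply: ler_pM => //; exact: ltW.
      rewrite ler_nat; apply: sub_cnt => k /andP[k0k kk1].
      apply: contra => /asboolP[c Cc hc]; apply/asboolP; exists c => //.
      have [_ /(_ good)] := hz0 (x, k0); rewrite /= -/(zf x k0) => sm.
      have kk0 : (k - k0 <= Q)%N by rewrite leq_subLR (leq_trans (ltnW kk1)).
      have := hdel _ (lt_le_trans sm e1d) _ kk0.
      rewrite !iterTB -!iterD subnK // => sm2.
      have -> : iter k T x - iter k T (y1 + w) - c =
        (iter k T x - iter k T y1 - iter k T (zf x k0)) +
        (iter k T (zf x k0) - iter k T w - c) by rewrite iterTD; zmod.
      by apply: hr => //; exact: lt_le_trans e2r.
    have h4 : 0 <= L%:R * (cnt (off e1 B x y0) k0 k2)%:R :> R by rewrite mulr_ge0.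
    by move: gap h3 h4; set G := (_ - _)%:R; lra.
  (* [y0] and [y1] differ by an element of [B], so a bad start [k0] is itself one of the bad times
     of [y0] and pays for the core. *)
  have h5 : (1 <= cnt (off e1 B x y0) k0 k2)%N.
    rewrite (@cntD _ k0 k0.+1 k2) ?leqnSn ?(leq_trans k01) //.
    rewrite /cnt /index_iota subSnn /= /off; case: asboolP => // h; case: bad.
    have -> : iter k0 T x - iter k0 T y1 = iter k0 T x - iter k0 T y0 + iter k0 T v.
      by rewrite y1E iterTB; zmod.
    by apply: close_modD => //; [exact: hB.1|exact: stable_iter].
  have h6 : (cnt (off e C x (y1 + w)) k0 k1)%:R <= L%:R :> R.
    by rewrite ler_nat (leq_trans (cnt_le _ _ _)).
  have h7 : L%:R <= L%:R * (cnt (off e1 B x y0) k0 k2)%:R :> R.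
    by rewrite ler_peMr ?ler1n // ltW.
  have h8 : 0 <= e / 4 * (k2 - k0)%:R by rewrite mulr_ge0 // divr_ge0 // ltW.
  by move: gap h6 h7 h8; set G := (_ - _)%:R; lra.
have total : (cnt (off e C x (y1 + w)) a b)%:R <=
    e / 2 * (b - a)%:R + L%:R * (cnt (off e1 B x y0) a b)%:R :> R.
  rewrite (cnt_chunks _ (ltnW ab) bK) natr_sum (cnt_chunks _ (ltnW ab) bK) natr_sum.
  have -> : (b - a)%N = cnt predT a b by rewrite /cnt count_predT size_iota.
  rewrite (cnt_chunks predT (ltnW ab) bK) natr_sum !mulr_sumr -big_split /=.
  by apply: ler_sum => q _; exact: chunk.
apply: le_lt_trans total _.
have ba0 : 0 < (b - a)%:R :> R by rewrite ltr0n subn_gt0.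
have h9 : L%:R * (cnt (off e1 B x y0) a b)%:R < L%:R * (e1 * (b - a)%:R) by rewrite ltr_pM2l.
have h10 : L%:R * (e1 * (b - a)%:R) <= e / 4 * (b - a)%:R by rewrite mulrA ler_pM2r.
have h11 : 0 < e * (b - a)%:R by rewrite mulr_gt0.
by move: h9 h10 h11; set G := (b - a)%:R; lra.
Qed.

Lemma spec_extension A B C : stable A -> stable B -> B `<=` A -> is_subgroup C ->
  (forall n, (0 < n)%N -> forall b, B b -> exists2 v, B v & iter n T v - v = b) ->
  spec A B -> spec B C -> spec A C.
Proof.
move=> hA hB BA hC surj [q1 h1] [q2 h2]; exists (q1 + q2)%N => J.
have [P1 c1 p1] := h1 J; have [P2 c2 p2] := h2 J.
exists (P1 `&` P2); first exact: cosparseI.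
apply: (pspec_extension hA hB) => //; first exact: pspecS p1.
exact: pspecS p2.
Qed.

(** If [q.+1] consecutive multiples of [c] all missed [P], two of them would lie in the same
    exceptional set, at distance at most [c * q]. *)
Lemma cosparse_multiples q J P c : (0 < c)%N -> (c * q.+1 < J)%N -> cosparse q J P ->
  bounded_gaps (P `&` [set n | (c %| n)%N]).
Proof.
move=> c0 cJ [F [sF hF]]; exists (c * q.+2)%N => m.
apply: contrapT => hno.
pose m0 := (m %/ c).+1.
have hm (j : 'I_q.+1) : exists i, F i (c * (m0 + j))%N.
  case: (hF (c * (m0 + j))%N) => // p; exfalso; apply: hno; exists (c * (m0 + j))%N.
  split; first by split => //=; rewrite dvdn_mulr.
  have := ltn_ceil m c0; have := leq_trunc_div m c; have := ltn_ord j.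
  rewrite /m0 => h1 h2 h3; apply/andP; split.
    by rewrite mulnDr; move: h3; rewrite mulnC; lia.
  have : (c * (m %/ c).+1 <= m + c)%N by rewrite mulnS mulnC addnC leq_add2r.
  have : (c * j <= c * q)%N by rewrite leq_mul2l -ltnS h1 orbT.
  by rewrite mulnDr !mulnS; lia.
have /choice[f hf] := hm.
have [|j1 [j2 [lt12 ef]]] := pigeonhole_lt f; first by rewrite ?card_ord.
have h1 := hf j1; have h2 := hf j2; rewrite -ef in h2.
have := sF _ _ _ h1 h2; rewrite ltn_pmul2l // ltn_add2l => /(_ lt12).
have : (c * j2 <= c * q)%N by rewrite leq_mul2l -ltnS ltn_ord orbT.
by move: cJ; rewrite !mulnDr mulnS; lia.
Qed.

Lemma spec_partial_spec : spec [set: X] [set 0] -> partial_spec d T.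
Proof.
move=> [q hq] c c0; have [P cP pP] := hq (c * q.+1).+1.
exists (P `&` [set n | (c %| n)%N]); split; first by move=> n [].
split; first exact: cosparse_multiples cP.
move=> e e0; have [r r0 hr] := sz_dist hd cX e0.
pose e1 := Num.min e r; have e10 : 0 < e1 by rewrite lt_min e0 r0.
have e1e : e1 <= e by rewrite ge_min lexx.
have e1r : e1 <= r by rewrite ge_min lexx orbT.
have [M hM] := pP e1 e10; exists M.+1, M.+1; split => //; split => //.
move=> p x a b n [p0 [ab sp]] [Pn _] Mn bn.
have le_b i j : (i <= j < p)%N -> (b i <= b j)%N.
  elim: j => [|j IH]; first by rewrite leqn0 => /andP[/eqP->].
  move=> /andP[]; rewrite leq_eqVlt => /orP[/eqP->//|]; rewrite ltnS => ij jp.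
  have := IH; rewrite ij (ltnW jp) => /(_ isT) h.
  by have := sp _ jp; have := ab _ jp; lia.
have sp' i j : (i < j < p)%N -> (b i + M <= a j)%N.
  case: j => // j /andP[]; rewrite ltnS => ij jp.
  by have := le_b i j; rewrite ij (ltnW jp) => /(_ isT); have := sp _ jp; lia.
pose s := mkseq (fun i => (x i, a i, b i)) p.
have [||//|||t ts|y [_ yn tr]] := hM s n.
- apply/andP; split.
    rewrite /s /mkseq all_map; apply/allP => i; rewrite mem_iota add0n => /andP[_ ip].
    exact: ab.
  apply/(pairwiseP (x 0%N, a 0%N, b 0%N)) => i j; rewrite !inE size_mkseq => ip jp ij.
  by rewrite !nth_mkseq //=; apply: sp'; rewrite ij.
- by [].
- exact: leq_ltn_trans Mn.
- exact: ltnW.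
- move: t ts; apply/allP; rewrite /s /mkseq all_map; apply/allP => i.
  rewrite mem_iota add0n => /andP[_ ip] /=; apply: le_trans bn.
  apply: ler_pM; rewrite ?addr_ge0 ?(ltW e10) ?lerD2l ?ler_nat //.
  by apply: le_b; rewrite -ltnS prednK // ip leqnn.
exists y; split; first by apply/eqP; rewrite -subr_eq0; apply/eqP.
move=> i ip; have := tr (x i, a i, b i) (map_f _ _); rewrite mem_iota add0n => /(_ ip).
rewrite /traces /= => h.
have ba0 : 0 < (b i - a i)%:R :> R by rewrite ltr0n subn_gt0 ab.
rewrite ltr_pdivlMr //; set good := fun n => _.
have h1 : (cnt (predC good) (a i) (b i) <= cnt (off e1 [set (0%R : X)] (x i) y) (a i) (b i))%N.
  apply: sub_cnt => k _; apply: contra => /= /asboolP[z -> ]; rewrite subr0 => hz.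
  by apply: hr; exact: lt_le_trans e1r.
have := cnt_predC good (a i) (b i).
rewrite -/(cnt good (a i) (b i)) => /(congr1 (fun k => k%:R : R)); rewrite natrD => h2.
have h3 : (cnt (predC good) (a i) (b i))%:R <= (cnt (off e1 [set 0] (x i) y) (a i) (b i))%:R :> R.
  by rewrite ler_nat.
have h4 : e1 * (b i - a i)%:R <= e * (b i - a i)%:R by rewrite ler_pM2r.
by rewrite mulrBl mul1r; lra.
Qed.

End Tracing.

(** * The factor defined by one character *)

Lemma ultra_inv_lt (R : realType) (U : set_system nat) (e : R) :
  \oo `<=` U -> UltraFilter U -> 0 < e -> U [set k | k.+1%:R^-1 < e].
Proof.
move=> oU UF e0; have := ultra_ge oU (Num.truncn e^-1); apply: (ultraS UF) => k /= hk.
rewrite -[e]invrK ltf_pV2 ?posrE ?invr_gt0 //.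
by apply: lt_le_trans (truncnS_gt _) _; rewrite ler_nat.
Qed.

Lemma unit_div_dist (R : realType) (u v : R[i]) : normc v = 1 -> normc (u / v - 1) = normc (u - v).
Proof.
move=> v1; have v0 : v != 0 by rewrite -normc_eq0 v1 oner_eq0.
by rewrite -[RHS]divr1 -v1 -normcV -normcM mulrBl divff.
Qed.

Lemma prod_exprzB1 (F : fieldType) n (u : 'I_n -> F) (al be : 'I_n -> nat) :
  (forall i, u i != 0) ->
  (\prod_i u i ^ ((al i)%:Z - (be i)%:Z) = 1 <-> \prod_i u i ^+ al i = \prod_i u i ^+ be i).
Proof.
move=> u0; have nz (c : 'I_n -> nat) : \prod_i u i ^+ c i != 0.
  by apply/prodf_neq0 => i _; rewrite expf_neq0.
under eq_bigr do rewrite expfzDr // -invr_expz.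
rewrite big_split prodfV /=; under eq_bigr do rewrite -exprnP.
under [in X in _ / X]eq_bigr do rewrite -exprnP.
split=> [h|->]; last by rewrite divff.
by apply: (mulIf (x := (\prod_i u i ^+ be i)^-1)); rewrite ?invr_eq0 ?divff.
Qed.

Section CharacterFactor.
Variables (R : realType) (X : topologicalZmodType) (d : X -> X -> R) (T S : X -> X).
Hypotheses (hd : compatible_metric d) (cX : compact [set: X]).
Hypotheses (TD : forall x y, T (x + y) = T x + T y) (Tc : continuous T).
Hypotheses (TK : cancel T S) (SK : cancel S T).
Local Notation sz := (sz d).
Local Notation block := (X * nat * nat)%type.
Implicit Types (x y z : X) (a : {poly int}).

(** Continuity of the inverse of a continuous bijection, by compactness. *)
Lemma sz_inv (e : R) : 0 < e -> exists2 r, 0 < r & forall x, sz x < r -> sz (S x) < e.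
Proof.
move=> e0; apply: contrapT => hno.
have /choice[u hu] : forall k : nat, exists x, sz x < k.+1%:R^-1 /\ e <= sz (S x).
  move=> k; apply: contrapT => hk; apply: hno; exists k.+1%:R^-1 => // x hx.
  by rewrite ltNge; apply/negP => hx2; apply: hk; exists x.
have [U [UF oU]] := ultra_nat.
have [l [hl _]] := compact_ulim hd cX (fun k => S (u k)) UF.
have l0 : l = 0.
  apply: (can_inj TK); rewrite (auto0 TD); apply: (sz_eq0 hd) => t t0.
  have [r r0 hr] := sz_sub hd t0; have [r' r'0 hr'] := sz_auto hd TD Tc r0.
  have [k [/= h1 h2]] := ultra_ex UF (ultraI UF (hl _ r'0) (ultra_inv_lt oU UF r0)).
  have -> : T l = u k - T (S (u k) - l) by rewrite TD -[T (- l)]/(iter 1 T (- l)) (iterTN TD) SK /=; zmod.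
  apply: hr; last exact: hr'.
  by have [h3 _] := hu k; exact: lt_trans h2.
have [k /=] := ultra_ex UF (hl e e0).
by rewrite l0 subr0 ltNge; have [_ ->] := hu k.
Qed.

Lemma sz_iter_inv m (e : R) : 0 < e -> exists2 r, 0 < r & forall x, sz x < r -> sz (iter m S x) < e.
Proof.
elim: m e => [|m IH] e e0; first by exists e.
have [r r0 hr] := sz_inv e0; have [t t0 ht] := IH _ r0.
by exists t => // x /ht/hr.
Qed.

Lemma iter_cancel k x : iter k T (iter k S x) = x.
Proof. by elim: k x => // k IH x; rewrite iterSr iterS SK IH. Qed.

(** The point at the integer time [k - m] is encoded as [iter k T (iter m S x)]; this passes to a
    larger common backward shift. *)
Lemma iter_inv_widen k m K x : (m <= K)%N ->
  iter k T (iter m S x) = iter (k + (K - m)) T (iter K S x).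
Proof.
by move=> mK; rewrite -{2}(subnK mK) [iter (K - m + m) S x]iterD [RHS]iterD iter_cancel.
Qed.

Lemma iter_inv_comm k m x : iter m S (iter k T x) = iter k T (iter m S x).
Proof.
have ST y : S (T y) = T (S y) by rewrite TK SK.
elim: k => //= k <-; elim: m (iter k T x) => //= m IH y.
by rewrite IH ST.
Qed.

Lemma iter_invK m : cancel (iter m T) (iter m S).
Proof. by move=> z; rewrite iter_inv_comm iter_cancel. Qed.

Lemma iter_invD m x y : iter m S (x + y) = iter m S x + iter m S y.
Proof. by apply: (can_inj (@iter_invK m)); rewrite (iterTD TD) !iter_cancel. Qed.

Lemma iter_invB m x y : iter m S (x - y) = iter m S x - iter m S y.
Proof. by apply: (can_inj (@iter_invK m)); rewrite (iterTB TD) !iter_cancel. Qed.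

Lemma nbhs_szP x (A : set X) :
  nbhs x A <-> exists2 e : R, 0 < e & forall y, sz (x - y) < e -> A y.
Proof.
split=> [/(nbhs_dist hd)[e e0 h]|[e e0 h]].
  by have [r r0 hr] := sz_dist hd cX e0; exists r => // y /hr/h.
have := @sub_continuous X (x, x) [set y | sz y < e].
rewrite /= subrr => /(_ (sz_nbhs0 hd e0)) [[A' B'] /= [nA nB] hAB].
by apply: filterS nB => y By; apply: h; apply: (hAB (x, y)); split => //; exact: nbhs_singleton.
Qed.

Lemma closure_sz (A : set X) x (e : R) : closure A x -> 0 < e -> exists y, A y /\ sz (x - y) < e.
Proof.
move=> hx e0; have [y [Ay hy]] := hx _ ((nbhs_szP _ _).2 (ex_intro2 _ _ e e0 (fun y hy => hy))).
by exists y.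
Qed.

Lemma closed_image (phi : X -> X) (A : set X) : closed A ->
  (forall x y, phi (x + y) = phi x + phi y) ->
  (forall e : R, 0 < e -> exists2 r, 0 < r & forall x, sz x < r -> sz (phi x) < e) ->
  closed (phi @` A).
Proof.
move=> cA phiD phi_small y hy; have [U [UF oU]] := ultra_nat.
have /choice[u hu] k : exists x, A x /\ sz (y - phi x) < k.+1%:R^-1.
  have [|_ [[x Ax <-] hx]] := @closure_sz _ y k.+1%:R^-1 hy; first by rewrite invr_gt0.
  by exists x.
have [l [hl [_ hc]]] := compact_ulim hd cX u UF.
exists l; first by apply: hc cA _; apply: (ultraS UF) (ultra_ge oU 0) => k _; case: (hu k).
apply/eqP; rewrite -subr_eq0; apply/eqP/(sz_eq0 hd) => e e0.
have [r r0 hr] := sz_add hd e0; have [t t0 ht] := phi_small r r0.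
have [k [/= h1 h2]] := ultra_ex UF (ultraI UF (hl _ t0) (ultra_inv_lt oU UF r0)).
have phi0 : phi 0 = 0 by apply: (addrI (phi 0)); rewrite -phiD !addr0.
have phiN z : phi (- z) = - phi z by apply: (addrI (phi z)); rewrite -phiD !subrr.
have -> : phi l - y = phi (l - u k) + (phi (u k) - y) by rewrite phiD phiN addrA subrK.
apply: hr; first by apply: ht; rewrite -szN opprB.
by rewrite -szN opprB; have [_ h] := hu k; exact: lt_trans h2.
Qed.

Definition pev a y := pact (fun (c : int) (v : X) => v *~ c) T a y.

Lemma autoMz x (c : int) : T (x *~ c) = T x *~ c.
Proof.
have TN y : T (- y) = - T y by apply: (iterTN TD 1).
have TMn n : T (x *+ n) = T x *+ n by elim: n => [|n IH]; rewrite ?mulr0n ?(auto0 TD) // !mulrS TD IH.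
by case: c => n; rewrite -?pmulrn // NegzE !mulrNz TN -!pmulrn TMn.
Qed.

Lemma pevM a b y : pev (a * b) y = pev a (pev b y).
Proof.
apply: pactM => // *; [exact: mulrzDr | exact: mulrzDl | | exact: autoMz].
by rewrite -mulrzA mulrC.
Qed.

Lemma pevD a b y : pev (a + b) y = pev a y + pev b y.
Proof. by apply: pactD => // *; exact: mulrzDr. Qed.

Lemma pevDr a y z : pev a (y + z) = pev a y + pev a z.
Proof. by apply: pactDr => // *; [exact: mulrzDl]. Qed.

Lemma pevC (c : int) y : pev c%:P y = y *~ c.
Proof. by apply: pactC => // *; exact: mulrzDr. Qed.

Lemma pev_T a y : pev a (T y) = T (pev a y).
Proof. by apply: pact_T => // *; [exact: autoMz]. Qed.

Lemma pevXn n y : pev 'X^n y = iter n T y.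
Proof.
apply: pactXn => // *; rewrite ?mulrzDr ?mulrzDl ?autoMz -?mulrzA 1?mulrC //.
Qed.

Lemma pev_widen n a y : (size a <= n)%N -> pev a y = \sum_(i < n) iter i T y *~ a`_i.
Proof. by move=> h; apply: pact_widen => // *; exact: mulrzDr. Qed.

Lemma stable_pev Y a y : stable T Y -> Y y -> Y (pev a y).
Proof.
move=> hY Yy; have [sY _] := hY; rewrite /pev /pact.
apply: (big_ind Y) => [|u v|i _]; [by case: sY | exact: subgroupD |].
have Yi := stable_iter i hY Yy.
by case: (a`_i) => n; rewrite ?NegzE ?mulrNz -pmulrn; [|apply: subgroupN => //]; apply: subgroupMn.
Qed.

Lemma char_pev (gam : X -> R[i]) n a y : unit_char gam -> (size a <= n)%N ->
  gam (pev a y) = \prod_(i < n) gam (iter i T y) ^ a`_i.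
Proof.
move=> gU h; rewrite (pev_widen _ h) unit_char_sum //.
by apply: eq_bigr => i _; rewrite unit_charMz.
Qed.

Lemma unit_char_pev (gam : X -> R[i]) a : unit_char gam -> unit_char (gam \o pev a).
Proof. by move=> [gD gN]; split=> [x y|x] /=; rewrite ?pevDr ?gD ?gN. Qed.

Lemma sz_pev a (e : R) : 0 < e -> exists2 r, 0 < r & forall x, sz x < r -> sz (pev a x) < e.
Proof.
elim/poly_ind: a e => [|a c IH] e e0.
  by exists 1 => // x _; rewrite /pev /pact size_poly0 big_ord0 (sz0 hd).
have [r r0 hr] := sz_add hd e0; have [t t0 ht] := IH _ r0; have [t' t'0 ht'] := sz_auto hd TD Tc t0.
have [u u0 hu] : exists2 u, 0 < u & forall x, sz x < u -> sz (x *~ c) < r.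
  have [u u0 hu] := sz_sum hd `|c|%N r0; exists u => // x hx.
  have E : sz (x *+ `|c|%N) < r.
    by rewrite -[`|c|%N]card_ord -sumr_const; apply: hu.
  by case: c E {hu} => n; rewrite ?NegzE ?mulrNz -pmulrn ?szN.
exists (Num.min t' u) => [|x]; first by rewrite lt_min t'0.
rewrite lt_min => /andP[h1 h2]; rewrite pevD pevC -[X in _ * X]expr1 pevM pevXn.
by apply: hr; [apply/ht/ht' | exact: hu].
Qed.

Lemma small_char_pev (gam : X -> R[i]) a : small_char d gam -> small_char d (gam \o pev a).
Proof.
move=> gS e /gS[r r0 hr]; have [t t0 ht] := sz_pev a r0.
by exists t => // x /ht/hr.
Qed.

Section Kernel.
Variables (Y : set X) (gam : X -> R[i]).
Hypotheses (hY : stable T Y) (cY : closed Y) (gU : unit_char gam) (gS : small_char d gam).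

(* the largest [T]-invariant subgroup of [Y] in the kernel of [gam] *)
Definition inv_ker := [set y | Y y /\ forall k m, gam (iter k T (iter m S y)) = 1].

Lemma inv_ker_sub : inv_ker `<=` Y.
Proof. by move=> y []. Qed.

Lemma inv_ker_stable : stable T inv_ker.
Proof.
have [[Y0 YB] TY] := hY; split; first split.
- split=> // k m; have -> : iter m S 0 = 0 by elim: m => //= m ->; rewrite -[X in S X](auto0 TD) TK.
  by rewrite -(subrr (0 : X)) (iterTB TD) subrr unit_char0.
- move=> x y [Yx hx] [Yy hy]; split; first exact: YB.
  by move=> k m; rewrite iter_invB (iterTB TD) unit_charB // hx hy divr1.
- rewrite predeqE => y; split=> [[x [Yx hx] <-]|[Yy hy]].
    split; first by rewrite -TY; exists x.
    by move=> k m; rewrite -[T x]/(iter 1 T x) iter_inv_comm -iterD.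
  exists (S y); last exact: SK.
  split; first by move: (Yy); rewrite -[X in X y]TY => -[z Yz <-]; rewrite TK.
  by move=> k m; rewrite -iterSr.
Qed.

Lemma char_iter_small k m (e : R) : 0 < e -> exists2 r, 0 < r &
  forall x y, sz (x - y) < r -> normc (gam (iter k T (iter m S x)) - gam (iter k T (iter m S y))) < e.
Proof.
move=> /gS[r r0 hr]; have [t t0 ht] := sz_iter hd TD Tc k r0; have [u u0 hu] := sz_iter_inv m t0.
exists u => // x y /hu/ht/(_ k (leqnn k))/hr.
by have [_ gN] := gU; rewrite iter_invB (iterTB TD) unit_charB // unit_div_dist.
Qed.

Lemma char_ulim (U : set_system nat) (u : nat -> X) l k m (c : R[i]) : UltraFilter U ->
  (forall e, 0 < e -> U [set j | sz (u j - l) < e]) ->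
  (forall e, 0 < e -> U [set j | normc (gam (iter k T (iter m S (u j))) - c) < e]) ->
  gam (iter k T (iter m S l)) = c.
Proof.
move=> UF hl hc; apply/eqP; rewrite -subr_eq0 -normc_eq0 eq_le normc_ge0 andbT leNgt.
apply/negP => h0; have h02 : 0 < normc (gam (iter k T (iter m S l)) - c) / 2 by lra.
have [r r0 hr] := char_iter_small k m h02.
have [j [/= h1 h2]] := ultra_ex UF (ultraI UF (hl _ r0) (hc _ h02)).
have := normc_distD (gam (iter k T (iter m S (u j)))) (gam (iter k T (iter m S l))) c.
by have := hr _ _ h1; rewrite normcB; lra.
Qed.

Lemma inv_ker_closed : closed inv_ker.
Proof.
have [U [UF oU]] := ultra_nat.
move=> x hx.
have /choice[u hu] k : exists y, inv_ker y /\ sz (x - y) < k.+1%:R^-1.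
  by apply: (closure_sz hx); rewrite invr_gt0.
have hl e : 0 < e -> U [set j | sz (u j - x) < e].
  move=> e0; apply: (ultraS UF) (ultra_inv_lt oU UF e0) => j /= hj.
  by rewrite -szN opprB; have [_ h] := hu j; exact: lt_trans hj.
split.
  apply: cY; move=> B nB; have [y [[Yy _] By]] := hx B nB.
  by exists y.
move=> k m; apply: (char_ulim UF hl) => e e0.
apply: (ultraS UF) (ultra_ge oU 0) => j _ /=.
by have [[_ ->] _] := hu j; rewrite subrr normc0E.
Qed.

(** By compactness, nearly trivial phases at the times from [- K] to [K] force closeness to the
    kernel: a limit of counterexamples with growing windows would lie in [inv_ker]. Phases thus
    serve as coordinates modulo the kernel. *)
Lemma close_inv_ker (e : R) : 0 < e -> exists K, exists2 r : R, 0 < r & forall z, Y z ->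
  (forall i, (i <= 2 * K)%N -> normc (gam (iter i T (iter K S z)) - 1) < r) -> close_mod d e inv_ker z.
Proof.
move=> e0; apply: contrapT => hno.
have /choice[u hu] K : exists z, [/\ Y z,
    forall i, (i <= 2 * K)%N -> normc (gam (iter i T (iter K S z)) - 1) < K.+1%:R^-1
    & ~ close_mod d e inv_ker z].
  apply: contrapT => hK; apply: hno; exists K; exists K.+1%:R^-1; first by rewrite invr_gt0.
  by move=> z Yz hz; apply: contrapT => nz; apply: hK; exists z.
have [U [UF oU]] := ultra_nat.
have [l [hl [_ hc]]] := compact_ulim hd cX u UF.
have Kl : inv_ker l.
  split; first by apply: hc cY _; apply: (ultraS UF) (ultra_ge oU 0) => j _; case: (hu j).
  move=> k m; apply: (char_ulim UF hl) => t t0.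
  apply: (ultraS UF) (ultraI UF (ultra_ge oU (k + m)%N) (ultra_inv_lt oU UF t0)) => j [/= h1 h2].
  have [_ h _] := hu j; rewrite (@iter_inv_widen k m j); last lia.
  by apply: lt_trans h2; apply: h; lia.
have [j /= hj] := ultra_ex UF (hl e e0).
by have [_ _ []] := hu j; exists l.
Qed.

Definition annihilates a := forall y, Y y -> gam (pev a y) = 1.

(* the phases [theta] allowed by the relations among the characters [gam \o iter k T] *)
Definition admissible (theta : nat -> R) := forall a, annihilates a ->
  forall j, exists z : int, \sum_(k < size a) (a`_k)%:~R * theta (j + k)%N = z%:~R.

Lemma cis_sum (n : nat) (c : 'I_n -> int) (t : 'I_n -> R) :
  cis (\sum_i (c i)%:~R * t i) = \prod_i cis (t i) ^ c i.
Proof.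
rewrite (big_morph (@cis R) (@cisD R) (cis0 R)).
by apply: eq_bigr => i _; rewrite cisM_int.
Qed.

(** Kronecker's theorem realizes the phases approximately at the times from [- mm] to [mm], and
    compactness yields an exact solution. The time [k - m] appears as [k + n.-1 * m], which is
    congruent to it modulo the period and never negative. *)
Lemma admissible_realized theta n : (0 < n)%N -> (forall k, theta (k + n)%N = theta k) ->
  admissible theta -> exists2 y, Y y & forall k m,
    gam (iter k T (iter m S y)) = cis (theta (k + n.-1 * m)%N).
Proof.
move=> n0 thn ath.
have thnM k q : theta (k + n * q)%N = theta k.
  by elim: q => [|q IH]; rewrite ?muln0 ?addn0 // mulnSr addnA thn.
have approx mm (e : R) : 0 < e -> exists2 y, Y y & forall j : 'I_(2 * mm).+1,
    normc (gam (iter j T (iter mm S y)) - cis (theta (j + n.-1 * mm)%N)) < e.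
  have sY : is_subgroup Y by case: hY.
  apply: (kronecker_approx (g := fun (j : 'I_(2 * mm).+1) y => gam (iter j T (iter mm S y)))
    (z := fun j : 'I_(2 * mm).+1 => cis (theta (j + n.-1 * mm)%N)) sY).
  - have [gD gN] := gU; move=> j; split=> [x y|x]; last exact: gN.
    by rewrite iter_invD (iterTD TD) gD.
  - by move=> j; exact: normc_cis.
  move=> al be hab.
  (* A relation among the characters of the window, read at [iter mm T y], is an annihilating
     polynomial, to which the admissibility of [theta] applies. *)
  pose c (j : 'I_(2 * mm).+1) : int := (al j)%:Z - (be j)%:Z.
  pose a : {poly int} := \poly_(k < (2 * mm).+1) oapp c 0 (insub k).
  have sa : (size a <= (2 * mm).+1)%N by exact: size_poly.
  have aE (k : 'I_(2 * mm).+1) : a`_k = c k by rewrite coef_poly ltn_ord valK.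
  have ann_a : annihilates a.
    move=> y Yy; rewrite (char_pev _ gU sa).
    have := hab (iter mm T y) (stable_iter mm hY Yy).
    rewrite iter_inv_comm iter_cancel => h.
    by under eq_bigr do rewrite aE; apply/prod_exprzB1 => // k; exact: unit_char_neq0 gU.
  have [z hz] := ath a ann_a (n.-1 * mm)%N.
  have : cis (\sum_(j < (2 * mm).+1) (c j)%:~R * theta (j + n.-1 * mm)%N) = 1.
    rewrite -(cis_int R z) -hz; congr cis; rewrite [RHS](big_ord_widen _ (fun k => (a`_k)%:~R * theta (n.-1 * mm + k)%N) sa).
    rewrite [RHS]big_mkcond; apply: eq_bigr => k _; rewrite aE addnC; case: ifP => // /negbT; rewrite -leqNgt => h.
    by rewrite -aE nth_default // mul0r.
  by rewrite cis_sum => /(prod_exprzB1 _ _ (fun k => cis_neq0 _)).1.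
have /choice[u hu] mm : exists y, Y y /\ forall j : 'I_(2 * mm).+1,
    normc (gam (iter j T (iter mm S y)) - cis (theta (j + n.-1 * mm)%N)) < mm.+1%:R^-1.
  have [|y Yy hy] := approx mm mm.+1%:R^-1; first by rewrite invr_gt0.
  by exists y.
have [U [UF oU]] := ultra_nat.
have [l [hl [_ hc]]] := compact_ulim hd cX u UF.
exists l; first by apply: hc cY _; apply: (ultraS UF) (ultra_ge oU 0) => j _; case: (hu j).
move=> k m; apply: (char_ulim UF hl) => t t0.
apply: (ultraS UF) (ultraI UF (ultra_ge oU (k + m)%N) (ultra_inv_lt oU UF t0)) => j [/= h1 h2].
have [_ h] := hu j; rewrite (@iter_inv_widen k m j); last lia.
have hj : (k + (j - m) < (2 * j).+1)%N by lia.
apply: lt_trans h2; have := h (Ordinal hj); rewrite /=.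
have -> // : theta (k + (j - m) + n.-1 * j)%N = theta (k + n.-1 * m)%N.
rewrite -(thnM (k + n.-1 * m)%N (j - m)%N); congr theta.
rewrite -{2}(subnK (_ : m <= j)%N); last lia.
by rewrite -[in RHS](prednK n0) /= mulnDr mulSn; lia.
Qed.

Definition shadowable (P : set nat) := forall e : R, 0 < e -> exists M : nat, forall s n,
  spaced M s -> P n -> (0 < n)%N ->
  (forall t : block, t \in s -> [/\ Y t.1.1, (M <= t.1.2)%N & (t.2 + M <= n)%N]) ->
  exists theta, [/\ forall k, theta (k + n)%N = theta k, admissible theta &
    forall t, t \in s -> forall k, (t.1.2 <= k < t.2)%N ->
      normc (cis (theta k) - gam (iter k T t.1.1)) < e].

(** Closeness modulo the kernel at one time involves the phases at distance up to [K], so blocks are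
    widened by [K] on both sides, after a delay by [m] that makes room at the beginning. No time of
    a block is lost. *)
Lemma shadowable_pspec P : shadowable P -> pspec d T P Y inv_ker.
Proof.
move=> hP e e0; have [K [r r0 hr]] := close_inv_ker e0.
have [M' hM'] := hP r r0.
pose m := (K + M')%N.
(* From [(1 + e) * t.2 <= n], a time of at least [e / (1 + e) * n] is left after the last block; for
   [n >= M] it contains the delay, the widening and the margin [M']. The term [M' + 2 * K] keeps
   widened blocks [M'] apart. *)
pose M := ((Num.truncn ((1 + e) / e * (m + K + M')%:R)).+1 + M' + 2 * K)%N.
have hM : (1 + e) * (m + K + M')%:R <= e * M%:R.
  have h : (1 + e) / e * (m + K + M')%:R <= M%:R.
    apply: ltW; apply: lt_le_trans (truncnS_gt _) _; by rewrite ler_nat /M -[leqRHS]addnA leq_addr.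
  have : e * ((1 + e) / e * (m + K + M')%:R) <= e * M%:R by rewrite ler_pM2l.
  by have -> : e * ((1 + e) / e * (m + K + M')%:R) = (1 + e) * (m + K + M')%:R by field; lra.
exists M => s n sM sY Pn n0 Mn bn.
pose sh (t : block) : block := (iter m S t.1.1, t.1.2 + m - K, t.2 + m + K)%N.
have YS x : Y x -> Y (iter m S x).
  move=> /(stable_preiter m hY)[y Yy <-].
  by rewrite iter_inv_comm iter_cancel.
suff [theta [thn ath hth]] : exists theta, [/\ forall k, theta (k + n)%N = theta k, admissible theta &
    forall t, t \in map sh s -> forall k, (t.1.2 <= k < t.2)%N ->
      normc (cis (theta k) - gam (iter k T t.1.1)) < r].
  have [y Yy hy] := admissible_realized n0 thn ath.
  exists (iter m T y); split.
  - exact: stable_iter.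
  - have -> : iter n T (iter m T y) - iter m T y = iter m T (iter n T y - y).
      by rewrite (iterTB TD) -!iterD addnC.
    apply: (stable_iter m inv_ker_stable); split.
      by have [[_ YB] _] := hY; apply: YB => //; exact: stable_iter.
    move=> k i; have -> : iter k T (iter i S (iter n T y - y)) =
        iter (k + n) T (iter i S y) - iter k T (iter i S y).
      by rewrite iterD -(iterTB TD) iter_invB iter_inv_comm.
    rewrite unit_charB // !hy addnAC thn divff ?cis_neq0 //.
  - move=> t ts; rewrite /traces.
    have -> : cnt (off d T e inv_ker t.1.1 (iter m T y)) t.1.2 t.2 = 0%N.
      apply/eqP; rewrite -leqn0; apply: leq_trans (sub_cnt (q := pred0) _) _; last first.
        by rewrite /cnt count_pred0.
      move=> k /andP[k1 k2] /negP[]; apply/asboolP; apply: hr.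
        have [[_ YB] _] := hY; apply: YB; first exact/(stable_iter _ hY)/sY.
        exact/(stable_iter _ hY)/(stable_iter _ hY).
      move=> i iK.
      have kK (x : X) : iter i T (iter K S (iter k T (iter m T x))) = iter (i + k + m - K) T x.
        have -> : iter K S (iter k T (iter m T x)) = iter (k + m - K) T x.
          rewrite -iterD -{1}(subnKC (_ : K <= k + m)%N); last by rewrite /m; lia.
          by rewrite iterD iter_inv_comm iter_cancel.
        by rewrite -iterD; congr (iter _ T x); rewrite /m; lia.
      rewrite iter_invB (iterTB TD) unit_charB // kK.
      have -> : t.1.1 = iter m T (iter m S t.1.1) by rewrite iter_cancel.
      rewrite kK.
      have kk : ((sh t).1.2 <= i + k + m - K < (sh t).2)%N by rewrite /sh /m /=; lia.
      have := hth _ (map_f sh ts) _ kk; have := hy (i + k + m - K)%N 0; rewrite /= muln0 addn0 => <-.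
      by have [_ gN] := gU; rewrite normcB unit_div_dist.
    rewrite mulr_gt0 //; have /andP[/allP/(_ t ts) /=] := sM.
    by rewrite ltr0n subn_gt0.
apply: hM' => // [|t].
- move: sM => /andP[h1 h2]; apply/andP; split.
    rewrite all_map; apply: sub_all h1 => t /=; rewrite /m; lia.
  rewrite pairwise_map; apply: sub_pairwise h2 => t t' /=; rewrite /m /M; lia.
- move=> /mapP[t' ts ->] /=; split; [exact/YS/sY | by rewrite /m; lia |].
  have := bn t' ts; rewrite -(ler_nat R) => h.
  have Mn' : M%:R <= n%:R :> R by rewrite ler_nat.
  have : (1 + e) * (t'.2 + m + K + M')%:R <= (1 + e) * n%:R.
    have -> : (t'.2 + m + K + M' = t'.2 + (m + K + M'))%N by lia.
    rewrite natrD mulrDr [X in _ <= X]mulrDl mul1r lerD //.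
    by apply: le_trans hM _; rewrite ler_pM2l.
  by rewrite ler_pM2l //; lra.
Qed.

Lemma cis_char (theta : nat -> R) x a j : (forall k, cis (theta k) = gam (iter k T x)) ->
  cis (\sum_(k < size a) (a`_k)%:~R * theta (j + k)%N) = gam (pev a (iter j T x)).
Proof.
move=> h; rewrite cis_sum (char_pev _ gU (leqnn _)); apply: eq_bigr => k _.
by rewrite h -iterD addnC.
Qed.

Lemma spaced_unique M (s : seq block) (t t' : block) k : spaced M s -> t \in s -> t' \in s ->
  (t.1.2 <= k < t.2)%N -> (t'.1.2 <= k < t'.2)%N -> t = t'.
Proof.
move=> /andP[_ h] ts ts' kt kt'; elim: s h ts ts' => [|u s IH] //= /andP[/allP h /IH{}IH].
rewrite !inE => /orP[/eqP tu|ts] /orP[/eqP tu'|ts']; rewrite ?tu ?tu' //; last exact: IH.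
- by have := h _ ts'; rewrite -tu; lia.
- by have := h _ ts; rewrite -tu'; lia.
Qed.

(* [p = 0] is the case without any relation *)
Lemma shadowable_free (p : nat) : (forall y, Y y -> gam y ^+ p = 1) ->
  (forall a, annihilates a -> forall i, exists b, a`_i = b * p%:Z) -> shadowable setT.
Proof.
move=> gp ha e e0; exists 0%N => s n sM _ n0 hs.
(* The phase is copied from the block containing [k] and is 0 outside blocks. No compatibility is
   required: all relations are divisible by [p], and [p%:R * w k] is an integer. *)
pose w k : R := oapp (fun t : block => arg (gam (iter k T t.1.1))) 0
  (ohead [seq t <- s | (t.1.2 <= k < t.2)%N]).
have wE t k : t \in s -> (t.1.2 <= k < t.2)%N -> w k = arg (gam (iter k T t.1.1)).
  move=> ts kt; have : t \in [seq t <- s | (t.1.2 <= k < t.2)%N] by rewrite mem_filter kt.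
  rewrite /w; case E : [seq t <- s | (t.1.2 <= k < t.2)%N] => [|t' s'] // _ /=.
  have : t' \in [seq t <- s | (t.1.2 <= k < t.2)%N] by rewrite E mem_head.
  by rewrite mem_filter => /andP[kt' ts']; rewrite (spaced_unique sM ts ts' kt kt').
have wp k : exists z : int, p%:R * w k = z%:~R.
  rewrite /w; case E : [seq t <- s | (t.1.2 <= k < t.2)%N] => [|t s'] /=; first by exists 0; rewrite mulr0.
  have : t \in [seq t <- s | (t.1.2 <= k < t.2)%N] by rewrite E mem_head.
  rewrite mem_filter => /andP[_ ts]; have [Yt _ _] := hs t ts; have [_ gN] := gU.
  by apply: cis_eq1; rewrite cisM_nat cis_arg // gp //; exact: stable_iter.
exists (fun k => w (k %% n)%N); split=> [k|a an j|t ts k kt].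
- by rewrite modnDr.
- have /choice[b hb] := ha a an; have /choice[z hz] := wp.
  exists (\sum_(k < size a) b k * z ((j + k) %% n)%N); rewrite rmorph_sum.
  by apply: eq_bigr => k _; rewrite hb /= rmorphM [in RHS]rmorphM /= -hz mulrA.
- have [Yt _ tn] := hs t ts; have [_ gN] := gU.
  have kn : (k < n)%N by case/andP: kt => _ k2; move: tn; rewrite addn0; exact: leq_trans.
  by rewrite modn_small // (wE t) // cis_arg ?subrr ?normc0E.
Qed.

End Kernel.

End CharacterFactor.

(** * Shadowing a linear recurrence *)

Section Sequences.
Variable K : comNzRingType.
Implicit Types (p q : {poly K}) (w : nat -> K).

Definition sact p w j := \sum_(i < size p) p`_i * w (j + i)%N.

Let shift w : nat -> K := fun j => w j.+1.
Let scl (a : K) w : nat -> K := fun j => a * w j.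

Lemma sact_pact p w j : sact p w j = pact scl shift p w j.
Proof.
have it i (v : nat -> K) k : iter i shift v k = v (k + i)%N.
  by elim: i k => [|i IH] k; rewrite ?addn0 //= /shift IH addSnnS.
by rewrite /sact /pact fct_sumE; apply: eq_bigr => i _; rewrite /scl it.
Qed.

Lemma sact_widen n p w j : (size p <= n)%N -> sact p w j = \sum_(i < n) p`_i * w (j + i)%N.
Proof.
move=> pn; rewrite /sact (big_ord_widen n (fun i => p`_i * w (j + i)%N) pn) big_mkcond.
by apply: eq_bigr => i _; case: ltnP => // h; rewrite nth_default // mul0r.
Qed.

Lemma eq_sact p w w' j : (forall k, w k = w' k) -> sact p w j = sact p w' j.
Proof. by move=> h; apply: eq_bigr => i _; rewrite h. Qed.

Lemma sactM p q w j : sact (p * q) w j = sact p (sact q w) j.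
Proof.
have -> : sact q w = pact scl shift q w by apply/funext => k; exact: sact_pact.
rewrite !sact_pact pactM //.
- by move=> a b v; apply/funext => k; rewrite /scl !fctE mulrDl.
- by move=> a v v'; apply/funext => k; rewrite /scl !fctE mulrDr.
- by move=> a b v; apply/funext => k; rewrite /scl mulrA.
Qed.

Lemma sactZ c p w j : sact (c *: p) w j = c * sact p w j.
Proof.
rewrite (@sact_widen (size p)) ?size_scale_leq // mulr_sumr.
by apply: eq_bigr => i _; rewrite coefZ mulrA.
Qed.

Lemma sactZr c p w j : sact p (fun k => c * w k) j = c * sact p w j.
Proof. by rewrite mulr_sumr; apply: eq_bigr => i _; rewrite mulrCA. Qed.

Lemma sact_sum (I : Type) (r : seq I) (P : pred I) (F : I -> {poly K}) w j :
  sact (\sum_(i <- r | P i) F i) w j = \sum_(i <- r | P i) sact (F i) w j.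
Proof.
apply: (big_morph (fun p => sact p w j)) => [p q|]; last by rewrite /sact size_poly0 big_ord0.
rewrite !(@sact_widen (maxn (size p) (size q))) ?leq_maxl ?leq_maxr ?size_polyD // -big_split.
by apply: eq_bigr => i _; rewrite coefD mulrDl.
Qed.

Lemma sact_sumr (I : Type) (r : seq I) p (w : I -> nat -> K) j :
  sact p (fun k => \sum_(i <- r) w i k) j = \sum_(i <- r) sact p (w i) j.
Proof.
by rewrite exchange_big; apply: eq_bigr => i _; rewrite mulr_sumr.
Qed.

Lemma sact_XsubC l w j : sact ('X - l%:P) w j = w j.+1 - l * w j.
Proof.
rewrite /sact size_XsubC big_ord_recl big_ord1 !coefB !coefX !coefC /= addn0 addn1.
by rewrite sub0r subr0 mul1r mulNr addrC.
Qed.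

Lemma sact1 w j : sact 1 w j = w j.
Proof. by rewrite /sact size_poly1 big_ord1 coef1 mul1r addn0. Qed.

End Sequences.

Section Dynamics.
Variables (R : realType).
Local Notation C := R[i].
Variables (l c : C).
Implicit Types (v : nat -> C) (w : nat -> C).

(* response of the mode [l] to the input [v], starting at rest *)
Fixpoint resp v k : C := if k is k'.+1 then l * resp v k' + c * v k' else 0.

Lemma respE v k : resp v k = c * \sum_(i < k) l ^+ (k - i.+1) * v i.
Proof.
elim: k => [|k IH]; first by rewrite big_ord0 mulr0.
rewrite /= IH big_ord_recr /= subnn expr0 mul1r mulrDr; congr (_ + _).
rewrite mulrCA mulr_sumr; congr (_ * _); apply: eq_bigr => i _.
by rewrite subSn ?ltn_ord // exprS mulrA.
Qed.

Lemma eq_resp v v' k : (forall i, (i < k)%N -> v i = v' i) -> resp v k = resp v' k.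
Proof.
by elim: k => //= k IH h; rewrite IH ?h // => i ik; apply: h; exact: ltnW.
Qed.

Lemma orbit_diff v w k n (y : nat -> C) :
  (forall i, (k <= i < k + n)%N -> y i.+1 = l * y i + c * v i) ->
  (forall i, (k <= i < k + n)%N -> w i.+1 = l * w i + c * v i) ->
  y (k + n)%N - w (k + n)%N = l ^+ n * (y k - w k).
Proof.
elim: n => [|n IH] h1 h2; first by rewrite addn0 expr0 mul1r.
rewrite addnS h1 ?h2; try lia.
rewrite opprD addrACA subrr addr0 -mulrBr IH ?exprS ?mulrA // => i ik; [apply: h1|apply: h2]; lia.
Qed.

(** Variation of constants. *)
Lemma orbit_drift v k n (y : nat -> C) :
  (forall i, (k <= i < k + n)%N -> y i.+1 = l * y i + c * v i) ->
  y (k + n)%N = l ^+ n * y k + c * \sum_(i < n) l ^+ (n - i.+1) * v (k + i)%N.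
Proof.
elim: n => [|n IH] h; first by rewrite addn0 expr0 mul1r big_ord0 mulr0 addr0.
rewrite addnS h; last lia.
rewrite IH; last by move=> i ik; apply: h; lia.
rewrite big_ord_recr /= subnn expr0 mul1r !mulrDr -addrA exprS mulrA; congr (_ + (_ + _)).
rewrite mulrCA mulr_sumr; congr (_ * _); apply: eq_bigr => i _.
by rewrite subSn ?ltn_ord // exprS mulrA.
Qed.

Hypothesis l_aperiodic : forall n, l ^+ n.+1 != 1.

(** The initial state [resp v n / (1 - l ^+ n)] is the fixed point of the return map sending [s] to
    [l ^+ n * s + resp v n]. *)
Definition presp n v k := resp v k + l ^+ k * resp v n / (1 - l ^+ n).

Lemma presp_rec n v k : presp n v k.+1 = l * presp n v k + c * v k.
Proof. by rewrite /presp /= exprS; ring. Qed.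

Lemma presp_periodic n v : (0 < n)%N -> (forall k, v (k + n)%N = v k) ->
  forall k, presp n v (k + n)%N = presp n v k.
Proof.
move=> n0 vn; elim=> [|k IH]; last by rewrite addSn !presp_rec IH vn.
have d : 1 - l ^+ n != 0 by rewrite subr_eq0 eq_sym -(prednK n0).
by rewrite /presp add0n /=; field.
Qed.

(** Look at a time [j] where the modulus is maximal over a period: the recurrence is used for the
    step into [j] if [|l| < 1], and for the step out of [j] if [|l| > 1]. *)
Lemma periodic_bound n v w (V : R) : (0 < n)%N -> normc l != 1 ->
  (forall k, w (k + n)%N = w k) -> (forall k, w k.+1 = l * w k + c * v k) ->
  (forall k, normc (v k) <= V) -> forall k, normc (w k) <= normc c * V / `|1 - normc l|.
Proof.
move=> n0 l1 wn wrec vV.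
have wnM k q : w (k + n * q)%N = w k.
  by elim: q => [|q IH]; rewrite ?muln0 ?addn0 // mulnSr addnA wn.
have [j jmax] : exists j, forall k, normc (w k) <= normc (w j).
  have := @arg_maxP _ R 'I_n (Ordinal n0) xpredT (fun i => normc (w i)) isT.
  case=> j _ hj; exists j => k; rewrite {1}(divn_eq k n) addnC mulnC wnM.
  exact: (hj (Ordinal (ltn_pmod k n0))).
move=> k; apply: le_trans (jmax k) _.
have [l0 c0] := (normc_ge0 l, normc_ge0 c).
have d0 : 0 < `|1 - normc l| by rewrite normr_gt0 subr_eq0 eq_sym.
rewrite ler_pdivlMr //.
have V0 := le_trans (normc_ge0 _) (vV 0%N).
have rec i : normc l * normc (w i) <= normc (w j) + normc c * V /\
    normc (w i.+1) <= normc l * normc (w i) + normc c * V.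
  have cv : normc (c * v i) <= normc c * V by rewrite normcM ler_wpM2l.
  split; last by rewrite wrec; apply: le_trans (normcD _ _) _; rewrite normcM; lra.
  rewrite -normcM; have -> : l * w i = w i.+1 - c * v i by rewrite wrec addrK.
  by apply: le_trans (normcD _ _) _; rewrite normcNE lerD.
have [jn|jn] := ltP (normc l) 1.
  rewrite ger0_norm; last by rewrite subr_ge0 ltW.
  have [_ h] := rec (j + n).-1; rewrite prednK ?wn in h; last by rewrite ltn_addl.
  have hm : normc l * normc (w (j + n).-1) <= normc l * normc (w j) by exact: ler_wpM2l.
  by rewrite mulrBr mulr1 [normc (w j) * _]mulrC; lra.
rewrite ler0_norm ?subr_le0 //; have [h _] := rec j; lra.
Qed.

End Dynamics.

Section Shadowing.
Variables (R : realType) (rs : seq R[i]) (c : R[i] -> R[i]).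
Local Notation C := R[i].
Hypotheses (rs_uniq : uniq rs) (rs_conj : forall l, l \in rs -> l^*%C \in rs)
  (rs_aperiodic : forall l, l \in rs -> forall n, l ^+ n.+1 != 1)
  (c_neq0 : forall l, l \in rs -> c l != 0) (c_conj : conj_sym rs c).
Implicit Types v : nat -> int.

Definition neutral := [seq l <- rs | normc l == 1].

Lemma neutral_sub l : l \in neutral -> l \in rs.
Proof. by rewrite mem_filter => /andP[]. Qed.

Lemma neutral_unit l : l \in neutral -> normc l = 1.
Proof. by rewrite mem_filter => /andP[/eqP]. Qed.

Lemma neutral_conj l : l \in neutral -> l^*%C \in neutral.
Proof. by rewrite !mem_filter normcJE => /andP[-> /rs_conj]. Qed.

Lemma neutral_uniq : uniq neutral. Proof. exact: filter_uniq. Qed.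

Definition cast v : nat -> C := fun k => (v k)%:~R.

Local Notation state v k l := (resp l (c l) (cast v) k).

Lemma state_conj v k : conj_sym rs (fun l => state v k l).
Proof.
move=> l hl; elim: k => [|k IH] /=; first exact/esym/(rmorph0 (@conjc R)).
by rewrite IH c_conj // rmorphD !(rmorphM (@conjc R)) /= /cast rmorph_int.
Qed.

Lemma neutral_shift_norm v k n l : l \in neutral -> (forall i, (k <= i < k + n)%N -> v i = 0) ->
  normc (state v (k + n) l) = normc (state v k l).
Proof.
move=> hl h; rewrite (@orbit_drift _ l (c l) (cast v)) // [X in c l * X]big1 ?mulr0 ?addr0 => [|i _].
  by rewrite normcM normcX (neutral_unit hl) expr1n mul1r.
by rewrite /cast h ?mulr0 //; have := ltn_ord i; lia.
Qed.

(** One integer input of length [G] steers all neutral modes at once: its effect on the mode [l] is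
    [c l * ev P l], so [P] must approximate the target minus the drifted state, divided by [c l].
    [G] and [V] depend only on the bound [W] and the precision [eta]. *)
Lemma steer_step (W eta : R) : 0 < eta -> exists (G : nat) (V : R), forall v k0 t,
  conj_sym neutral t -> {in neutral, forall l, normc (t l) <= W} ->
  {in neutral, forall l, normc (state v k0 l) <= W + 1} ->
  exists v', [/\ forall k, (k < k0)%N -> v' k = v k,
    forall k, (k0 + G <= k)%N -> v' k = 0, forall k, (k0 <= k)%N -> `|(v' k)%:~R| <= V &
    {in neutral, forall l, normc (state v' (k0 + G) l - t l) < eta}].
Proof.
move=> eta0; pose D := \sum_(l <- neutral) (normc (c l))^-1.
pose E := 1 + \sum_(l <- neutral) normc (c l).
have E0 : 0 < E by rewrite /E ltr_wpDr // sumr_ge0 // => l _; exact: normc_ge0.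
have e0 : 0 < eta / E by rewrite divr_gt0.
have [G [V hGV]] := steering neutral_uniq neutral_conj neutral_unit
  (fun l hl => rs_aperiodic (neutral_sub hl)) ((2 * W + 1) * D) e0.
exists G, V => v k0 t tc tW sW.
have le1 l (F : C -> R) : l \in neutral -> (forall l, 0 <= F l) -> F l <= \sum_(l <- neutral) F l.
  by move=> hl F0; rewrite (big_rem _ hl) /= lerDl sumr_ge0.
have [||P [sP PV hP]] := hGV (fun l => (t l - l ^+ G * state v k0 l) / c l).
- move=> l hl; have hr := neutral_sub hl.
  rewrite /= tc // (state_conj v k0 hr) c_conj // rmorphM fmorphV rmorphB; congr ((_ - _) / _).
  by rewrite (rmorphM (@conjc R)) (rmorphXn (@conjc R)).
- move=> l hl /=; rewrite normcM normcV ler_pM ?normc_ge0 ?invr_ge0 ?normc_ge0 //; last first.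
    by apply: (le1 l (fun l => (normc (c l))^-1) hl) => x; rewrite invr_ge0 normc_ge0.
  apply: le_trans (normcD _ _) _; rewrite normcNE normcM normcX (neutral_unit hl) expr1n mul1r.
  by have := tW l hl; have := sW l hl; lra.
(* The coefficients are fed in reverse order, since the input at time [k0 + i] is multiplied by
   [l ^+ (G - i.+1)] before time [k0 + G]. *)
pose v' k := if (k < k0)%N then v k else if (k < k0 + G)%N then P`_(G - (k - k0).+1) else 0.
exists v'; split.
- by move=> k h; rewrite /v' h.
- by move=> k h; rewrite /v' !ltnNge (leq_trans (leq_addr _ _) h) h.
- move=> k h; rewrite /v' ltnNge h /=; case: ifP => _ //.
  by apply: le_trans (PV 0%N); rewrite normr0.
- move=> l hl; have hr := neutral_sub hl.
  have := hP l hl; set q := _ / c l => hq.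
  have -> : state v' (k0 + G) l - t l = c l * (ev P l - q).
    rewrite (@orbit_drift _ l (c l) (cast v') k0 G) // (@eq_resp _ l (c l) (cast v') (cast v)); last first.
      by move=> i ik; rewrite /cast /v' ik.
    rewrite /q mulrBr [c l * (_ / _)]mulrCA divff ?c_neq0 // mulr1.
    have -> : ev P l = \sum_(i < G) l ^+ (G - i.+1) * cast v' (k0 + i).
      rewrite /ev (@horner_coef_wide _ G); last by rewrite (leq_trans (size_poly _ _)).
      rewrite (reindex_inj rev_ord_inj) /=; apply: eq_bigr => i _.
      rewrite coef_map /= mulrC; congr (_ * _); rewrite /cast /v'.
      by rewrite ltnNge leq_addr /= ltn_add2l ltn_ord addKn.
    by ring.
  rewrite normcM; apply: (@le_lt_trans _ _ (E * normc (ev P l - q))).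
    rewrite ler_wpM2r ?normc_ge0 // /E (le_trans (le1 l (fun l => normc (c l)) hl _)) ?lerDr //.
    by move=> x; exact: normc_ge0.
  by rewrite mulrC -ltr_pdivlMr.
Qed.

Definition trajectory (V W : R) v (w : C -> nat -> C) :=
  [/\ forall k, `|(v k)%:~R| <= V,
     forall l k, l \in rs -> normc (w l k) <= W,
     forall l k, l \in rs -> w l k.+1 = l * w l k + c l * cast v k &
     forall k, conj_sym rs (fun l => w l k)].

(** Before each block the neutral modes are steered to its initial state; in the block its input is
    copied, so the error keeps its modulus because [|l| = 1]; after it the input is 0. The state is
    therefore bounded by [W + 1] again when the next steering begins, and one [G] serves for all
    blocks. *)
Lemma steer_chain (V W eta : R) : 0 < eta <= 1 -> 0 <= W -> exists (G : nat) (V' : R),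
  forall (B : eqType) (va : B -> nat -> int) (wa : B -> C -> nat -> C) (a b : B -> nat) (s : seq B) e,
  (forall t, t \in s -> (a t <= b t)%N) ->
  pairwise (fun t t' => b t + G <= a t')%N s ->
  (forall t, t \in s -> (G <= a t)%N /\ (b t <= e)%N) ->
  (forall t, t \in s -> trajectory V W (va t) (wa t)) ->
  exists v, [/\ forall k, `|(v k)%:~R| <= V', forall k, (e <= k)%N -> v k = 0,
    forall t, t \in s -> forall k, (a t <= k < b t)%N -> v k = va t k,
    forall t, t \in s -> {in neutral, forall l, normc (state v (a t) l - wa t l (a t)) < eta} &
    {in neutral, forall l k, (e <= k)%N -> normc (state v k l) <= W + 1}].
Proof.
move=> /andP[eta0 eta1] W0; have [G [V1 hG]] := steer_step W eta0.
exists G, (Num.max 0 (Num.max V V1)) => B va wa a b; elim/last_ind => [|s t IH] e ab sp ge ok.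
  exists (fun=> 0); split=> // [k|l hl k _]; first by rewrite normr0 le_max lexx.
  rewrite respE big1 ?mulr0 ?normc0E ?addr_ge0 // => i _.
  by rewrite /cast mulr0.
have ts : t \in rcons s t by rewrite mem_rcons mem_head.
have sub u : u \in s -> u \in rcons s t by rewrite mem_rcons inE orbC => ->.
move: sp; rewrite pairwise_rcons => /andP[/allP st sp].
have [Gt bte] := ge t ts; have [tV tW trec tconj] := ok t ts; have abt := ab t ts.
have [|||v [vV v0 vs vc vn]] := IH (a t - G)%N _ sp.
- by move=> u /sub; exact: ab.
- move=> u us; have [h _] := ge u (sub u us); split=> //.
  by have := st u us; rewrite /= leq_subRL // addnC.
- by move=> u /sub; exact: ok.
have [|||v' [p1 p2 p3 p4]] := hG v (a t - G)%N (fun l => wa t l (a t)).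
- by move=> l /neutral_sub; exact: tconj.
- by move=> l /neutral_sub; exact: tW.
- by move=> l hl; apply: vn.
rewrite subnK // in p2 p4.
pose v2 k := if (k < a t)%N then v' k else if (k < b t)%N then va t k else 0.
have v2E k : (k < a t - G)%N -> v2 k = v k.
  by move=> h; rewrite /v2 (leq_trans h) ?leq_subr // p1.
have sE k l : (k <= a t - G)%N -> state v2 k l = state v k l.
  by move=> h; apply: eq_resp => i ik; rewrite /cast v2E //; exact: leq_trans h.
have s2E l : state v2 (a t) l = state v' (a t) l.
  by apply: eq_resp => i ik; rewrite /cast /v2 ik.
have hb u : u \in s -> (b u <= a t - G)%N.
  by move=> us; have := st u us; rewrite /= leq_subRL // addnC.
exists v2; split.
- move=> k; rewrite /v2; case: ifP => h1.
    have [h|h] := ltnP k (a t - G); first by rewrite p1.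
    by rewrite !le_max p3 ?orbT.
  by case: ifP => _; rewrite ?normr0 !le_max ?lexx // tV orbT.
- by move=> k ek; rewrite /v2 !ltnNge (leq_trans (leq_trans abt bte) ek) (leq_trans bte ek).
- move=> u; rewrite mem_rcons inE => /orP[/eqP->|us] k /andP[k1 k2].
    by rewrite /v2 ltnNge k1 /= k2.
  by rewrite v2E ?(vs u) ?k1 //; exact: leq_trans (hb u us).
- move=> u; rewrite mem_rcons inE => /orP[/eqP->|us] l hl; first by rewrite s2E; exact: p4.
  by rewrite sE ?vc //; apply: leq_trans (hb u us); exact/ab/sub.
- move=> l hl k ek.
  have E1 : state v2 (b t) l - wa t l (b t) = l ^+ (b t - a t) * (state v2 (a t) l - wa t l (a t)).
    rewrite -{1 2}(subnKC abt); apply: (orbit_diff (c := c l) (v := cast (va t))) => i ik.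
      rewrite /=; congr (_ + _ * _); rewrite /cast /v2; have [i1 i2] := andP ik.
      by rewrite ltnNge i1 /=; move: i2; rewrite subnKC // => ->.
    by apply: trec; exact: neutral_sub.
  have E2 : normc (state v2 (b t) l - wa t l (b t)) < eta.
    by rewrite E1 normcM normcX (neutral_unit hl) expr1n mul1r s2E; exact: p4.
  have -> : normc (state v2 k l) = normc (state v2 (b t) l).
    rewrite -{1}(subnKC (leq_trans bte ek)); apply: neutral_shift_norm => // i /andP[i1 _].
    by rewrite /v2 !ltnNge i1 (leq_trans abt i1).
  have -> : state v2 (b t) l = (state v2 (b t) l - wa t l (b t)) + wa t l (b t) by rewrite subrK.
  apply: le_trans (normcD _ _) _; have := tW l (b t) (neutral_sub hl); lra.
Qed.

Lemma window_arith (a b k n G m H : nat) : (G + 2 * m + H <= a)%N -> (a <= k)%N -> (k < b)%N ->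
  (b + (G + 2 * m + H) <= n)%N ->
  [/\ forall i, (a - m <= i < b + m)%N -> (i < n)%N /\ (i < n - H)%N,
      (a - m <= k)%N /\ (a - m + (k - (a - m)) <= b + m)%N, (a - m <= n)%N /\ (k <= b + m)%N,
      (m <= k - (a - m))%N /\ (m <= b + m - k)%N & forall i, (i < a - m)%N -> (i < n - H)%N].
Proof.
move=> h1 h2 h3 h4; split; first (by move=> i /andP[i1 i2]; split; lia);
  last (by move=> i; lia); by split; lia.
Qed.

Lemma geometric_small (q D eta : R) : 0 <= q < 1 -> 0 < eta ->
  exists m, forall k, (m <= k)%N -> q ^+ k * D < eta.
Proof.
move=> /andP[q0 q1] eta0; pose D1 := Num.max D 1.
have D0 : 0 < D1 by rewrite lt_max ltr01 orbT.
have : (GRing.exp q : nat -> R) @ \oo --> (0 : R) by apply: cvg_expr; rewrite ger0_norm.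
move=> /cvgrPdist_lt/(_ (eta / D1) (divr_gt0 eta0 D0)) [m _ hm]; exists m => k mk.
have := hm k mk; rewrite /= sub0r normrN ger0_norm ?exprn_ge0 // ltr_pdivlMr // => h.
by apply: le_lt_trans h; rewrite ler_wpM2l ?exprn_ge0 // le_max lexx.
Qed.

(** The input of [steer_chain] is completed by a steering at the end of the period and repeated.
    Neutral modes are handled by steering; the others are attracted to the trajectory of the block
    from one of its ends. *)
Lemma periodic_shadow (V W eta kap : R) : 0 < eta -> 0 < kap -> 0 <= V -> 0 <= W ->
  exists M : nat,
  forall (B : eqType) (va : B -> nat -> int) (wa : B -> C -> nat -> C) (a b : B -> nat) (s : seq B) n, (0 < n)%N ->
  (forall l, l \in neutral -> kap <= normc (l ^+ n - 1)) ->
  (forall t, t \in s -> (a t < b t)%N) ->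
  pairwise (fun t t' => b t + M <= a t')%N s ->
  (forall t, t \in s -> (M <= a t)%N /\ (b t + M <= n)%N) ->
  (forall t, t \in s -> trajectory V W (va t) (wa t)) ->
  exists v w, [/\ forall k, v (k + n)%N = v k, forall l k, l \in rs -> w l (k + n)%N = w l k,
    forall l k, l \in rs -> w l k.+1 = l * w l k + c l * cast v k &
    forall t, t \in s -> forall l k, l \in rs -> (a t <= k < b t)%N -> normc (w l k - wa t l k) < eta].
Proof.
(* A neutral mode suffers the error [eta1] from steering into the block and [eta1 / kap] from
   closing up the period; their sum must be at most [eta]. *)
move=> eta0 kap0 V0 W0; pose eta1 := Num.min 1 (eta * kap / (kap + 1)).
have kap10 : 0 < kap + 1 by rewrite addr_gt0.
have eta10 : 0 < eta1 by rewrite lt_min ltr01 divr_gt0 // mulr_gt0.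
have eta1E : eta1 + eta1 / kap <= eta.
  have h : eta1 <= eta * kap / (kap + 1) by rewrite ge_min lexx orbT.
  rewrite ler_pdivlMr // in h.
  have -> : eta1 + eta1 / kap = eta1 * (kap + 1) / kap by field; rewrite gt_eqF.
  by rewrite ler_pdivrMr.
have [|G1 [V1 hG1]] := steer_chain V (eta := eta1) _ W0; first by rewrite eta10 ge_min lexx.
have [G2 [V2 hG2]] := steer_step W eta10.
(* The rate at which a mode with [|l| <> 1] forgets, forwards or backwards; [D l] bounds its
   distance to the trajectory of the block. *)
pose q (l : C) := if normc l < 1 then normc l else (normc l)^-1.
pose D l := normc (c l) * Num.max V1 V2 / `|1 - normc l| + W.
have /choice[m hm] l : exists m, l \in rs -> normc l != 1 -> forall k, (m <= k)%N -> q l ^+ k * D l < eta.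
  have [l1|l1] := eqVneq (normc l) 1; first by exists 0%N.
  have [|m hm] := @geometric_small (q l) (D l) eta _ eta0; last by exists m.
  rewrite /q; case: ltP => h; first by rewrite normc_ge0.
  by rewrite invr_ge0 normc_ge0 invf_lt1 ?lt_neqAle ?(eq_sym 1) ?l1 // -lt_neqAle (lt_le_trans _ h).
pose m0 := \max_(l <- rs) m l.
have m0P l : l \in rs -> (m l <= m0)%N by move=> hl; exact: leq_bigmax_seq.
clearbody m0; exists (G1 + 2 * m0 + G2)%N => B va wa a b s n n0 nP ab sp ge ok.
(* Blocks are enlarged by [m0] on both sides: over that time the modes with [|l| <> 1] already
   receive the right input and come within [eta]. *)
have [|||v [vV v0 vs vc vn]] := hG1 B va wa (fun t => a t - m0)%N (fun t => b t + m0)%N s (n - G2)%N _ _ _ ok.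
- by move=> t /ab; clear; lia.
- by apply: sub_pairwise sp => t t' /=; clear; lia.
- by move=> t /ge; clear; lia.
have G2n : s != [::] -> (G2 <= n)%N.
  by case: (s) ge => // t s' ge _; have := ge t (mem_head _ _); clear; lia.
have [s0|s0] := eqVneq s [::].
  exists (fun=> 0), (fun _ _ => 0); split=> // [l k _|t]; last by rewrite s0.
  by rewrite /cast !mulr0 addr0.
(* The last [G2] inputs bring the neutral modes back near 0, so the periodic solution is close to
   the one that starts at rest. *)
have [|||v' [p1 _ p3 p4]] := hG2 v (n - G2)%N (fun=> 0).
- by move=> l _; rewrite rmorph0.
- by move=> l _; rewrite normc0E.
- by move=> l hl; apply: vn.
rewrite subnK ?G2n // in p4.
pose v2 k := v' (k %% n)%N.
have v2n k : v2 (k + n)%N = v2 k by rewrite /v2 modnDr.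
have v2V k : normc (cast v2 k) <= Num.max V1 V2.
  have -> : normc (cast v2 k) = `|(v2 k)%:~R| by rewrite -normcR rmorph_int.
  rewrite /v2 le_max; have [h|h] := ltnP (k %% n)%N (n - G2); last by rewrite p3 ?orbT.
  by rewrite p1 // vV.
have sE k l : (k <= n)%N -> state v2 k l = state v' k l.
  by move=> kn; apply: eq_resp => i ik; rewrite /cast /v2 modn_small // (leq_trans ik).
pose w l k := presp l (c l) n (cast v2) k.
have wn l k : l \in rs -> w l (k + n)%N = w l k.
  by move=> hl; apply: presp_periodic => // [|i]; [exact: rs_aperiodic|rewrite /cast v2n].
have wrec l k : l \in rs -> w l k.+1 = l * w l k + c l * cast v2 k.
  by move=> hl; rewrite /w presp_rec.
exists v2, w; split=> // t ts l k hl /andP[k1 k2].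
have [tV tW trec _] := ok t ts; have [ge1 ge2] := ge t ts.
have [F1 [F2 F3] [F4 F5] [F6 F7] F8] := window_arith ge1 k1 k2 ge2.
have v2E i : (a t - m0 <= i < b t + m0)%N -> cast v2 i = cast (va t) i.
  move=> h; have [h1 h2] := F1 i h; rewrite /cast /v2 modn_small //.
  by rewrite p1 ?(vs t).
have dE i j : (a t - m0 <= i)%N -> (i + j <= b t + m0)%N ->
    w l (i + j)%N - wa t l (i + j)%N = l ^+ j * (w l i - wa t l i).
  move=> h1 h2; apply: (orbit_diff (c := c l) (v := cast (va t))) => x hx; last exact: trec.
  by rewrite wrec // v2E //; case/andP: hx => x1 x2; rewrite (leq_trans h1 x1) (leq_trans x2 h2).
have [lc|lc] := eqVneq (normc l) 1.
  have hc : l \in neutral by rewrite mem_filter lc eqxx.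
  rewrite -(subnKC F2) dE //.
  rewrite normcM normcX lc expr1n mul1r; apply: lt_le_trans eta1E.
  rewrite /w /presp sE // (@eq_resp _ l (c l) (cast v') (cast v)); last first.
    by move=> i /F8 ik; rewrite /cast p1.
  rewrite addrAC; apply: le_lt_trans (normcD _ _) _; apply: ltr_leD; first exact: vc.
  rewrite sE // !normcM normcX lc expr1n mul1r normcV.
  have := p4 l hc; rewrite subr0 => h; have hk := nP l hc.
  apply: ler_pM; rewrite ?invr_ge0 ?normc_ge0 //; first exact: ltW.
  by rewrite normcB lef_pV2 // posrE (lt_le_trans kap0).
have wB i : normc (w l i - wa t l i) <= D l.
  apply: le_trans (normcD _ _) _; rewrite normcNE lerD ?tW //.
  by apply: (@periodic_bound _ l (c l) n (cast v2)) => // j; [exact: wn | exact: wrec].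
have d0 := normc_ge0 (w l k - wa t l k).
have hq j : (m0 <= j)%N -> q l ^+ j * D l < eta.
  by move=> h; apply: hm => //; exact: leq_trans (m0P l hl) h.
have [l1|l1] := ltP (normc l) 1.
  have := hq (k - (a t - m0))%N F6; rewrite /q l1; apply: le_lt_trans.
  by rewrite -{1 2}(subnKC F2) dE // normcM normcX ler_wpM2l ?exprn_ge0 ?normc_ge0.
have := hq (b t + m0 - k)%N F7; rewrite /q (ltNge (normc l)) l1; apply: le_lt_trans.
have lp : 0 < normc l by rewrite (lt_le_trans _ l1).
have := dE k (b t + m0 - k)%N; rewrite subnKC // => /(_ F2 (leqnn _)) e; have := wB (b t + m0)%N.
by rewrite e normcM normcX exprVn -ler_pdivlMl ?exprn_gt0.
Qed.

End Shadowing.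

(** * Characters with a relation of minimal degree *)

Section Relation.
Variables (R : realType) (X : topologicalZmodType) (d : X -> X -> R) (T S : X -> X).
Hypotheses (hd : compatible_metric d) (cX : compact [set: X]).
Hypotheses (TD : forall x y, T (x + y) = T x + T y) (Tc : continuous T).
Hypotheses (TK : cancel T S) (SK : cancel S T).
Variables (Y : set X) (gam : X -> R[i]).
Hypotheses (hY : stable T Y) (cY : closed Y) (gU : unit_char gam) (gS : small_char d gam).
Hypothesis EY : forall n, (0 < n)%N -> forall b, Y b -> exists2 v, Y v & iter n T v - v = b.
Local Notation C := R[i].
Local Notation pev := (pev T).
Local Notation castC := (@cast R).
Local Notation block := (X * nat * nat)%type.
Implicit Types (a b g h u : {poly int}).

Definition nontrivial (chi : X -> C) := exists2 y, Y y & chi y != 1.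

Variable f : {poly int}.
Hypotheses (f_size : (1 < size f)%N) (f_ann : annihilates T Y gam f) (g_nontriv : nontrivial gam).
Hypothesis f_min : forall chi u, unit_char chi -> small_char d chi -> nontrivial chi ->
  u != 0 -> annihilates T Y chi u -> (size f <= size u)%N.
Local Notation ann := (annihilates T Y gam).

Let f0 : f != 0. Proof. by rewrite -size_poly_gt0 (ltn_trans _ f_size). Qed.

Lemma ann_mulr a b : ann b -> ann (a * b).
Proof. by move=> hb y Yy; rewrite mulrC pevM // hb //; exact: stable_pev. Qed.

Lemma annB a b : ann a -> ann b -> ann (a - b).
Proof.
move=> ha hb y Yy; have [gD _] := gU.
rewrite pevD gD ha // mul1r -mulN1r; apply: ann_mulr => //.
Qed.

(** Otherwise [gam \o pev g] would be a nontrivial character with the relation [h], which is smaller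
    than [f]. *)
Lemma ann_factor g h : ann (g * h) -> h != 0 -> (size h < size f)%N -> ann g.
Proof.
move=> gh h0 hf; apply: contrapT => ng; have : (size f <= size h)%N; last by rewrite leqNgt hf.
apply: (@f_min (gam \o pev g)) => //; first exact: unit_char_pev.
- exact: small_char_pev.
- apply: contrapT => hno; apply: ng => y Yy; apply/eqP/negPn/negP => hy.
  by apply: hno; exists y.
- by move=> y Yy /=; rewrite -pevM // gh.
Qed.

Lemma ann_scale (c : int) a : c != 0 -> ann (c *: a) -> ann a.
Proof.
move=> c0 h; apply: (@ann_factor a c%:P); rewrite ?polyC_eq0 //.
  by rewrite mulrC mul_polyC.
by rewrite size_polyC c0.
Qed.

Lemma ann_size a : a != 0 -> ann a -> (size f <= size a)%N.
Proof. exact: f_min. Qed.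

Lemma ann_divisor g : Pdiv.Field.dvdp g f -> (1 < size g)%N -> ann g.
Proof.
move=> /Pdiv.Idomain.dvdpP[[c h] /= c0 E] g1.
have gh0 : h * g != 0 by rewrite -E scale_poly_eq0 negb_or c0.
have h0 : h != 0 by apply: contraNneq gh0 => ->; rewrite mul0r.
have g0 : g != 0 by apply: contraNneq gh0 => ->; rewrite mulr0.
apply: (@ann_factor g h) => //; first by rewrite mulrC -E -mul_polyC; exact: ann_mulr.
have := congr1 (fun p : {poly int} => size p) E; rewrite size_scale // size_mul // => ->.
have lt x y : (0 < x)%N -> (1 < y)%N -> (x < (x + y).-1)%N by lia.
by apply: lt; rewrite // size_poly_gt0.
Qed.

Lemma ann_dvdp a : ann a -> Pdiv.Field.dvdp f a.
Proof.
move=> ha; rewrite /dvdp; apply/eqP; apply: contrapT => /eqP r0.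
have := ltn_modp a f; rewrite f0; apply/negP; rewrite -leqNgt; apply: ann_size r0 _.
have -> : Pdiv.Field.modp a f = lead_coef f ^+ scalp a f *: a - Pdiv.Field.divp a f * f.
  by rewrite Pdiv.Idomain.divp_eq addrAC subrr add0r.
by apply: annB; [rewrite -mul_polyC|]; exact: ann_mulr.
Qed.

(** A constant gcd is impossible, since a Bezout identity evaluated at [l] would make a nonzero
    integer vanish. So the gcd is a nonconstant divisor of [f], hence a relation, and [u] is a
    multiple of it up to a constant. *)
Lemma ann_common_root u (l : C) : ev f l = 0 -> ev u l = 0 -> ann u.
Proof.
move=> fl ul; pose g := gcdp f u.
have [g1|g1] := boolP (size g == 1%N).
  exfalso; have [[u1 u2] /= /eqpP[[c1 c2] /= /andP[c10 c20] E]] := Pdiv.Idomain.Bezoutp f u.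
  have [c c0 gc] : exists2 c, c != 0 & g = c%:P by apply/size_poly1P.
  have := congr1 (fun p : {poly int} => ev p l) E; rewrite -/g gc -!mul_polyC.
  rewrite /ev !rmorphM !rmorphD !rmorphM /= !map_polyC /= !hornerE -/(ev f l) -/(ev u l) fl ul.
  rewrite !mulr0 addr0 mulr0 => /esym/eqP; rewrite mulf_eq0 !intr_eq0.
  by rewrite (negbTE c20) (negbTE c0).
have g2 : (1 < size g)%N.
  have : g != 0 by rewrite gcdp_eq0 negb_and f0.
  by move: g1; rewrite -size_poly_gt0; lia.
have hg : ann g by apply: ann_divisor g2; exact: dvdp_gcdl.
have /Pdiv.Idomain.dvdpP[[c h] /= c0 E] : Pdiv.Field.dvdp g u by exact: dvdp_gcdr.
by apply: (@ann_scale c) => //; rewrite E; exact: ann_mulr.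
Qed.

(** Otherwise ['X^(n.+1) - 1] would be a relation of [gam], but it maps [Y] onto itself. *)
Lemma root_aperiodic (l : C) : ev f l = 0 -> forall n, l ^+ n.+1 != 1.
Proof.
move=> fl n; apply/eqP => ln; have [y Yy /eqP] := g_nontriv; apply.
have hX : ann ('X^(n.+1) - 1).
  by apply: (@ann_common_root _ l) => //; rewrite evB evXn ln /ev rmorph1 hornerC subrr.
have [z Yz <-] := EY (ltn0Sn n) Yy.
have := hX z Yz; rewrite pevD pevXn // -[1]/(1%:P) -polyCN pevC //.
Qed.

Lemma root_simple (l : C) : ev f l = 0 -> ev f^`() l != 0.
Proof.
move=> fl; apply/eqP => fl'.
have sf : (size f^`() < size f)%N by apply: lt_size_deriv.
have fa : ann f^`() by exact: ann_common_root fl'.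
have f'0 : f^`() != 0.
  apply/eqP => /(congr1 (fun p : {poly int} => p`_(size f).-2)); rewrite coef0 coef_deriv.
  have -> : (size f).-2.+1 = (size f).-1 by move: f_size; lia.
  move/eqP; rewrite mulrn_eq0 -/(lead_coef f) lead_coef_eq0 (negbTE f0) orbF.
  by move: f_size; lia.
by have := ann_size f'0 fa; rewrite leqNgt sf.
Qed.

Let F := zprimitive f.
Let FC : {poly C} := map_poly intr F.

Lemma prim_scale : exists2 c : int, c != 0 & f = c *: F.
Proof. by exists (zcontents f); [rewrite zcontents_eq0 | exact: zpolyEprim]. Qed.

Lemma ann_prim : ann F.
Proof. by have [c c0 E] := prim_scale; apply: (@ann_scale c) => //; rewrite -E. Qed.

(** Gauss's lemma: the primitive part divides with an integral quotient, so the single relation [F]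
    accounts for all of them. *)
Lemma ann_primP a : ann a -> exists r, a = r * F.
Proof. by move=> /ann_dvdp/dvdpP_int[r ->]; exists r; rewrite mulrC. Qed.

Lemma FC0 : FC != 0.
Proof.
have [c c0 E] := prim_scale; rewrite map_poly_eq0_id0.
  by apply: contraNneq f0 => F0; rewrite E F0 scaler0.
by rewrite intr_eq0 lead_coef_eq0; apply: contraNneq f0 => F0; rewrite E F0 scaler0.
Qed.

Lemma ev_prim l : FC.[l] = 0 -> ev f l = 0.
Proof.
have [c c0 E] := prim_scale; move=> h; rewrite E /ev -mul_polyC rmorphM hornerM /=.
by rewrite -/FC h mulr0.
Qed.

Lemma prim_roots : exists rs : seq C, [/\ uniq rs, (0 < size rs)%N,
  FC = lead_coef FC *: \prod_(z <- rs) ('X - z%:P) & forall l, l \in rs -> ev f l = 0].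
Proof.
have [rs E] := closed_field_poly_normal FC.
have L0 : lead_coef FC != 0 by rewrite lead_coef_eq0 FC0.
have hr l : l \in rs -> ev f l = 0.
  move=> hl; apply: ev_prim; rewrite E hornerZ.
  by move: hl; rewrite -root_prod_XsubC => /eqP ->; rewrite mulr0.
exists rs; split=> //.
  rewrite -separable_prod_XsubC; rewrite unlock; apply: Pdiv.ClosedField.root_coprimep => l hl.
  have := root_simple (hr l _); rewrite -root_prod_XsubC => /(_ hl).
  apply: contraNneq => dl; have [c c0 Ef] := prim_scale.
  rewrite /ev -deriv_map Ef -mul_polyC rmorphM /= map_polyC -/FC mul_polyC derivZ E derivZ.
  by rewrite !hornerZ dl !mulr0.
case: rs E {hr} => // E; have := f_size; have [c c0 Ef] := prim_scale.
have -> : size f = size F by rewrite Ef size_scale.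
have -> : size F = size FC.
  apply/esym/size_map_poly_id0; rewrite intr_eq0 lead_coef_eq0.
  by apply: contraNneq f0 => F0; rewrite Ef F0 scaler0.
by rewrite E big_nil alg_polyC size_polyC; case: (_ == _).
Qed.

Section Modes.
Variable rs : seq C.
Hypotheses (rs_uniq : uniq rs) (rs_size : (0 < size rs)%N)
  (FCE : FC = lead_coef FC *: \prod_(z <- rs) ('X - z%:P)) (rs_root : forall l, l \in rs -> ev f l = 0).
Local Notation lag := (lag rs).

Lemma mem_rs l : (l \in rs) = root FC l.
Proof.
by rewrite -root_prod_XsubC [in RHS]FCE rootZ // lead_coef_eq0 FC0.
Qed.

Lemma rs_conj l : l \in rs -> l^*%C \in rs.
Proof.
rewrite !mem_rs !rootE -/(ev F l) -/(ev F l^*%C) => /eqP h.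
by rewrite (ev_conj F (mem_head l [::])) h rmorph0.
Qed.

(** The residue of [1 / FC] at the simple root [l]: by partial fractions, the modes driven with
    these gains add up to a solution of the recurrence [FC] with the given input. *)
Definition mode_gain (l : C) := (lead_coef FC)^-1 * \prod_(x <- rs | x != l) (l - x)^-1.

Lemma mode_gain_neq0 l : l \in rs -> mode_gain l != 0.
Proof.
move=> hl; rewrite mulf_neq0 ?invr_eq0 ?lead_coef_eq0 ?FC0 //.
by rewrite prodf_seq_neq0; apply/allP => x _; apply/implyP => xl; rewrite invr_eq0 subr_eq0 eq_sym.
Qed.

Lemma lag_XsubC l : l \in rs -> lag l * ('X - l%:P) = mode_gain l *: FC.
Proof.
move=> hl; rewrite /lag scaler_prod -scalerAl [in RHS]FCE scalerA mulrAC mulVf ?lead_coef_eq0 ?FC0 // mul1r.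
by rewrite (bigD1_seq l) //= mulrC.
Qed.

Lemma mode_gain_conj : conj_sym rs mode_gain.
Proof.
move=> l hl; have h := lag_XsubC (rs_conj hl).
have := congr1 (map_poly (@conjc R)) (lag_XsubC hl).
rewrite rmorphM /= -(lag_conj rs_uniq rs_conj hl) map_polyXsubC h map_polyZ.
have -> : map_poly conjc FC = FC.
  rewrite /FC -map_poly_comp; apply: eq_map_poly => z /=; exact: rmorph_int.
by move=> /eqP; rewrite -subr_eq0 -scalerBl scale_poly_eq0 (negbTE FC0) orbF subr_eq0 => /eqP.
Qed.

Lemma sact_modes (v : nat -> C) (w : C -> nat -> C) j :
  (forall l k, l \in rs -> w l k.+1 = l * w l k + mode_gain l * v k) ->
  sact FC (fun k => \sum_(l <- rs) w l k) j = v j.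
Proof.
move=> h; rewrite sact_sumr -[RHS](sact1 v) -(sum_lag rs_uniq rs_size) sact_sum big_seq [RHS]big_seq.
apply: eq_bigr => l hl; apply: (mulfI (mode_gain_neq0 hl)).
rewrite -sactZ -lag_XsubC // sactM -sactZr; apply: eq_sact => k.
by rewrite sact_XsubC h // addrAC subrr add0r.
Qed.

(** Phases are lifted to real numbers between 0 and 1. The relation [F] turns them into an integer
    input, and [lag l], as a polynomial in the shift, projects them onto the mode [l]; the bounds do
    not depend on [x]. *)
Lemma block_trajectory : exists V W : R, [/\ 0 <= V, 0 <= W & forall x, Y x -> exists v w,
  trajectory rs mode_gain V W v w /\ forall k, cis (complex.Re (\sum_(l <- rs) w l k)) = gam (iter k T x)].
Proof.
exists (\sum_(i < size F) `|(F`_i)%:~R|), (\sum_(l <- rs) \sum_(i < size rs) normc (lag l)`_i); split.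
- exact: sumr_ge0.
- by apply: sumr_ge0 => l _; apply: sumr_ge0 => i _; exact: normc_ge0.
move=> x Yx; pose th k := arg (gam (iter k T x)); have [_ gN] := gU.
have thE k : cis (th k) = gam (iter k T x) by rewrite cis_arg.
have th1 k : `|th k| <= 1 by have /andP[h1 h2] := arg01 (gam (iter k T x)); rewrite ger0_norm.
have /choice[v hv] k : exists z : int, \sum_(i < size F) (F`_i)%:~R * th (k + i)%N = z%:~R.
  by apply: cis_eq1; rewrite (cis_char gU (T := T) (x := x)) // ann_prim //; exact: stable_iter.
pose thC k : C := (th k)%:C%C.
have vE k : sact FC thC k = castC v k.
  have -> : castC v k = ((v k)%:~R : R)%:C%C by rewrite rmorph_int.
  rewrite -hv rmorph_sum (@sact_widen _ (size F)) ?size_poly //; apply: eq_bigr => i _.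
  by rewrite coef_map rmorphM rmorph_int.
exists v, (fun l k => sact (lag l) thC k); split; first split.
- move=> k; rewrite -hv; apply: le_trans (ler_norm_sum _ _ _) _; apply: ler_sum => i _.
  by rewrite normrM ler_piMr.
- move=> l k hl; rewrite (@sact_widen _ (size rs)) ?size_lag //; apply: le_trans (normc_sum _ _ _) _.
  rewrite (big_rem _ hl) /= -[X in X <= _]addr0 lerD //; last first.
    by apply: sumr_ge0 => l' _; apply: sumr_ge0 => i _; exact: normc_ge0.
  by apply: ler_sum => i _; rewrite normcM normcR ler_piMr ?normc_ge0.
- move=> l k hl; rewrite -vE -(sactZ (mode_gain l)) -lag_XsubC // [lag l * _]mulrC sactM sact_XsubC.
  by rewrite addrCA subrr addr0.
- move=> k l hl; rewrite !(@sact_widen _ (size rs)) ?size_lag ?rs_conj // rmorph_sum; apply: eq_bigr => i _.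
  rewrite (lag_conj rs_uniq rs_conj hl) coef_map [RHS](rmorphM (@conjc R)); congr (_ * _).
  exact/esym/conjc_real.
- by move=> k; rewrite -thE -sact_sum (sum_lag rs_uniq rs_size) sact1.
Qed.

(** Every relation is [r * F]; [F] applied to the output returns the integer input, and [r] combines
    it integrally. Real parts may be taken because the coefficients are real. *)
Lemma modes_admissible v (w : C -> nat -> C) :
  (forall l k, l \in rs -> w l k.+1 = l * w l k + mode_gain l * castC v k) ->
  admissible T Y gam (fun k => complex.Re (\sum_(l <- rs) w l k)).
Proof.
move=> hw a /ann_primP[r ->] j; pose z k := \sum_(l <- rs) w l k.
exists (\sum_(i < size r) r`_i * v (j + i)%N).
have E : sact (map_poly intr (r * F)) z j = (\sum_(i < size r) r`_i * v (j + i)%N)%:~R.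
  rewrite rmorphM sactM rmorph_sum (@sact_widen _ (size r)) ?size_poly //; apply: eq_bigr => i _.
  by rewrite coef_map (sact_modes (v := castC v)) //= intrM.
have := congr1 (@complex.Re R) E.
have -> : ((\sum_(i < size r) r`_i * v (j + i)%N)%:~R : C) =
    ((\sum_(i < size r) r`_i * v (j + i)%N)%:~R : R)%:C%C by rewrite rmorph_int.
move=> /= <-; rewrite (@sact_widen _ (size (r * F))) ?size_poly // raddf_sum; apply: eq_bigr => i _.
rewrite coef_map /=; have -> : (((r * F)`_i)%:~R : C) = (((r * F)`_i)%:~R : R)%:C%C by rewrite rmorph_int.
by rewrite -/(z (j + i)%N); case: (z _) => x y /=; rewrite mul0r subr0.
Qed.

Lemma positive_lower_bound (I : eqType) (s : seq I) (G : I -> R) :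
  (forall i, i \in s -> 0 < G i) -> exists2 e : R, 0 < e & forall i, i \in s -> e <= G i.
Proof.
elim: s => [|i s IH] h; first by exists 1.
have [|e e0 he] := IH; first by move=> j js; apply: h; rewrite inE js orbT.
exists (Num.min e (G i)) => [|j]; first by rewrite lt_min e0 h ?mem_head.
rewrite inE => /orP[/eqP->|js]; first by rewrite ge_min lexx orbT.
by rewrite ge_min he.
Qed.

(** There is one exceptional set for each neutral root [l], formed by the [n] with
    [normc (l ^+ n - 1) < kap]. Since [kap] is half of a lower bound for [normc (l ^+ j - 1)] over
    [1 <= j <= J], two elements closer than [J] are impossible. *)
Lemma shadowable_modes : exists q, forall J, exists2 P, cosparse q J P & shadowable T Y gam P.
Proof.
have lunit l : l \in neutral rs -> normc l = 1 by exact: neutral_unit.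
have [V [W [V0 W0 traj]]] := block_trajectory.
exists (size (neutral rs)) => J.
have [kap2 kap20 hkap] : exists2 e : R, 0 < e & forall p, p \in allpairs pair (neutral rs) (iota 0 J) ->
    e <= normc (p.1 ^+ p.2.+1 - 1).
  apply: positive_lower_bound => p /allpairsP[[l j] /= [hl _ ->]] /=.
  rewrite normc_gt0 subr_eq0; apply: root_aperiodic; exact/rs_root/neutral_sub.
pose kap := kap2 / 2; have kap0 : 0 < kap by rewrite divr_gt0.
exists [set n | forall l, l \in neutral rs -> kap <= normc (l ^+ n - 1)].
  exists (fun i => [set n | normc ((tnth (in_tuple (neutral rs)) i) ^+ n - 1) < kap]); split.
    move=> i n n' /= hn hn' lt; rewrite leqNgt; apply/negP => h.
    set l := tnth _ _ in hn hn'; have hl : l \in neutral rs by exact: mem_tnth.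
    have := hkap (l, (n' - n).-1); rewrite /= prednK ?subn_gt0 //.
    have -> : (l, (n' - n).-1) \in allpairs pair (neutral rs) (iota 0 J).
      by rewrite allpairs_f // mem_iota /=; move: h lt; clear; lia.
    move=> /(_ isT); apply/negP; rewrite -ltNge.
    have -> : normc (l ^+ (n' - n) - 1) = normc (l ^+ n' - l ^+ n).
      rewrite -{2}(subnK (ltnW lt)) exprD -[X in _ = normc (_ - X)]mul1r -mulrBl normcM normcX.
      by rewrite (lunit l hl) expr1n mulr1.
    have := normc_distD 1 (l ^+ n') (l ^+ n); rewrite [normc (1 - _)]normcB /kap in hn hn' *; lra.
  move=> n; have [h|h] := pselect (exists i : 'I_(size (neutral rs)),
    normc ((tnth (in_tuple (neutral rs)) i) ^+ n - 1) < kap); [by right|left].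
  move=> l hl; rewrite leNgt; apply/negP => hlt; apply: h.
  by have /tnthP[i li] : l \in in_tuple (neutral rs) by []; exists i; rewrite -li.
move=> e e0; have [r r0 hr] := cis_ucont e0.
have m0 : 0 < (size rs)%:R :> R by rewrite ltr0n.
have eta0 : 0 < r / (size rs)%:R by rewrite divr_gt0.
have [M hM] := periodic_shadow rs_uniq rs_conj (fun l hl => root_aperiodic (rs_root hl))
  mode_gain_neq0 mode_gain_conj eta0 kap0 V0 W0.
exists M => s n /andP[sab sp] nP n0 hs.
have /choice[vw hvw] (t : block) : exists vw : (nat -> int) * (C -> nat -> C), Y t.1.1 ->
    trajectory rs mode_gain V W vw.1 vw.2 /\
    forall k, cis (complex.Re (\sum_(l <- rs) vw.2 l k)) = gam (iter k T t.1.1).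
  have [/traj[v [w h]]|h] := pselect (Y t.1.1); first by exists (v, w).
  by exists ((fun=> 0), (fun _ _ => 0)) => /h.
have [|//|t /hs[] //|t /hs[Yt _ _]|v [w [vn wn wrec hw]]] := hM _ (fun t => (vw t).1) (fun t => (vw t).2)
  (fun t : block => t.1.2) (fun t : block => t.2) s n n0 nP.
- by move=> t ts; exact: (allP sab).
- by have [] := hvw t Yt.
exists (fun k => complex.Re (\sum_(l <- rs) w l k)); split.
- by move=> k; congr complex.Re; rewrite big_seq [RHS]big_seq; apply: eq_bigr => l hl; exact: wn.
- exact: modes_admissible wrec.
- move=> t ts k kt; have [Yt _ _] := hs t ts; have [_ <-] := hvw t Yt.
  apply: hr; rewrite -raddfB; apply: le_lt_trans (ler_Re_normc _) _.
  rewrite -sumrB; apply: le_lt_trans (normc_sum _ _ _) _.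
  have -> : r = \sum_(l <- rs) r / (size rs)%:R.
    by rewrite big_const_seq count_predT iter_addr_0 -[LHS](divfK (lt0r_neq0 m0)) mulr_natr.
  rewrite big_seq [X in _ < X]big_seq; apply: ltr_sum => [|l hl]; last exact: hw.
  by case: (rs) rs_size => // l rs' _; rewrite /= mem_head.
Qed.

End Modes.

Lemma shadowable_relation : exists q, forall J, exists2 P, cosparse q J P & shadowable T Y gam P.
Proof. by have [rs [h1 h2 h3 h4]] := prim_roots; exact: (shadowable_modes h1 h2 h3 h4). Qed.

End Relation.

(** * Descent *)

Section Descent.
Variables (R : realType) (X : topologicalZmodType) (d : X -> X -> R) (T S : X -> X).
Hypotheses (hd : compatible_metric d) (cX : compact [set: X]).
Hypotheses (TD : forall x y, T (x + y) = T x + T y) (Tc : continuous T).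
Hypotheses (TK : cancel T S) (SK : cancel S T).
Local Notation C := R[i].
Local Notation pev := (pev T).
Implicit Types (Y : set X) (chi : X -> C).

Definition surj_coboundary Y :=
  forall n, (0 < n)%N -> forall b, Y b -> exists2 v, Y v & iter n T v - v = b.

Section Torsion.
Variables (Y : set X) (p : nat).
Hypotheses (hY : stable T Y) (EY : surj_coboundary Y) (p_gt0 : (0 < p)%N).
Hypothesis p_min : forall chi q, unit_char chi -> small_char d chi -> nontrivial Y chi -> (0 < q)%N ->
  (forall y, Y y -> chi y ^+ q = 1) -> (p <= q)%N.
Variable gam : X -> C.
Hypotheses (gU : unit_char gam) (gS : small_char d gam) (g_nontriv : nontrivial Y gam).
Hypothesis g_torsion : forall y, Y y -> gam y ^+ p = 1.
Local Notation ann := (annihilates T Y gam).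

Lemma ann_multiple (a : {poly int}) : (forall i, (p %| a`_i)%Z) -> ann a.
Proof.
move=> ha y Yy; rewrite (char_pev _ _ gU (leqnn _)) big1 // => i _.
have /dvdzP[b ->] := ha i; rewrite mulrC -exprz_exp -exprnP g_torsion ?exp1rz //.
exact: stable_iter.
Qed.

(** If [p = r * q] properly, either the character [q * gam] is nontrivial and killed by [r], or
    [gam] is killed by [q]; both contradict minimality. *)
Lemma torsion_prime : prime p.
Proof.
have [y Yy /eqP hy] := g_nontriv; rewrite -[prime p]negbK; apply/negP => /primePn[p1|[q /andP[q1 qp] /dvdnP[r pr]]].
  have p1' : p = 1%N by move: p1 p_gt0; lia.
  by apply: hy; rewrite -[LHS]expr1 -p1' g_torsion.
have r0 : (0 < r)%N by move: p_gt0; rewrite pr muln_gt0 => /andP[].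
have kill : ~ nontrivial Y (gam \o pev (q%:Z)%:P).
  move=> nt; have : (p <= r)%N.
    apply: (@p_min (gam \o pev (q%:Z)%:P)) => //; [exact: unit_char_pev | exact: small_char_pev |].
    move=> z Yz /=; rewrite pevC // unit_charMz // -exprnP -exprM mulnC -pr g_torsion //.
  by rewrite pr -[X in (_ <= X)%N]muln1 leq_pmul2l // leqNgt q1.
have : (p <= q)%N; last by rewrite leqNgt qp.
apply: (@p_min gam) => //; first exact: ltnW.
move=> z Yz; apply: contrapT => hz; apply: kill; exists z => //=; apply/eqP.
by rewrite pevC // unit_charMz // -exprnP.
Qed.

(** The remainders of the powers ['X^n] by [b] take finitely many values modulo [p], so some
    ['X^n2 - 'X^n1] would be a relation, although it maps [Y] onto itself. *)
Lemma no_monic_relation (b : {poly int}) : b \is monic -> ~ ann b.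
Proof.
move=> bm hb; pose r n := Pdiv.CommonRing.rmodp ('X^n : {poly int}) b.
have hr n : ann ('X^n - r n).
  rewrite [X in X - _](Pdiv.RingMonic.rdivp_eq bm) -/(r n) addrK.
  exact: ann_mulr.
have sr n : (size (r n) < size b)%N by apply: Pdiv.Ring.ltn_rmodpN0; exact: monic_neq0.
have [q pq] : exists q, p = q.+1 by exists p.-1; rewrite prednK.
pose D := size b; have p0 : (p%:Z : int) != 0 by rewrite pq.
pose G (n : 'I_(#|{ffun 'I_D -> 'I_q.+1}|.+1)) :=
  [ffun i : 'I_D => inord (absz ((r n)`_i %% p%:Z)%Z) : 'I_q.+1].
have [|n1 [n2 [lt12 eG]]] := pigeonhole_lt G; first by rewrite ?card_ord.
have lt_abs (x : int) : (absz (x %% p%:Z)%Z < q.+1)%N.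
  by have := modz_ge0 x p0; have := @ltz_pmod x p%:Z; rewrite pq => /(_ isT); lia.
have rr : ann (r n2 - r n1).
  apply: ann_multiple => i; rewrite coefB.
  have [iD|Di] := ltnP i D; last first.
    by rewrite !nth_default ?subrr ?dvdz0 // ltnW // (leq_trans (sr _)).
  rewrite -eqz_mod_dvd; apply/eqP.
  have := congr1 (fun F : {ffun 'I_D -> 'I_q.+1} => nat_of_ord (F (Ordinal iD))) eG.
  rewrite !ffunE /= !inordK ?lt_abs // => e.
  have := modz_ge0 (r n1)`_i p0; have := modz_ge0 (r n2)`_i p0; move: e; clear; lia.
have hX : ann ('X^n2 - 'X^n1).
  have -> : 'X^n2 - 'X^n1 = ('X^n2 - r n2) - ('X^n1 - r n1) + (r n2 - r n1) :> {poly int} by ring.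
  rewrite -[X in _ + X]opprK; apply: annB => //; first exact: annB.
  by rewrite -mulN1r; exact: ann_mulr.
have [y Yy /eqP] := g_nontriv; apply.
have [z Yz <-] := stable_preiter n1 hY Yy; have n210 : (0 < n2 - n1)%N by rewrite subn_gt0.
have [v Yv <-] := EY n210 Yz.
have := hX v Yv; rewrite pevD // -[- 'X^n1]mulN1r pevM // -[-1]/(-(1%:P)) -polyCN pevC // !pevXn //.
by rewrite (iterTB TD) -iterD subnKC // ltnW.
Qed.

(** A leading coefficient divisible by [p] is removed; any other could be turned into 1 by a Bezout
    identity with [p], giving a monic relation. *)
Lemma torsion_coef (a : {poly int}) : ann a -> forall i, (p %| a`_i)%Z.
Proof.
move: {2}(size a) (leqnn (size a)) => n; elim: n a => [|n IH] a.
  by rewrite leqn0 size_poly_eq0 => /eqP-> _ i; rewrite coef0 dvdz0.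
move=> sa ha; have [sn|sn] := leqP (size a) n; first exact: IH.
have an : size a = n.+1 by apply/eqP; rewrite eqn_leq sa sn.
have [pl|pl] := boolP (p %| a`_n)%Z.
  pose t : {poly int} := (a`_n)%:P * 'X^n.
  have tE i : t`_i = if i == n then a`_n else 0 by rewrite coefCM coefXn; case: eqP => _; rewrite ?mulr1 ?mulr0.
  have ht : ann t by apply: ann_multiple => i; rewrite tE; case: ifP => _ //; rewrite dvdz0.
  have st : (size (a - t)%R <= n)%N.
    apply/leq_sizeP => j nj; rewrite coefB tE; have [->|jn] := eqVneq j n; first by rewrite subrr.
    by rewrite subr0 nth_default // an ltn_neqAle eq_sym jn.
  move=> i; rewrite -(subrK t a) coefD rpredD //; first exact/IH/annB.
  by rewrite tE; case: ifP => _ //; rewrite dvdz0.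
exfalso; have [u [v uv]] := Bezoutz a`_n p%:Z.
have g1 : gcdz a`_n p%:Z = 1.
  by congr Posz; apply/eqP; rewrite -/(coprime _ _) coprime_sym prime_coprime ?torsion_prime.
rewrite g1 in uv.
apply: (@no_monic_relation (u%:P * a + (v * p%:Z)%:P * 'X^n)).
  have E i : (u%:P * a + (v * p%:Z)%:P * 'X^n)`_i = u * a`_i + (v * p%:Z) * (i == n)%:R.
    by rewrite coefD !coefCM coefXn.
  have sz : size (u%:P * a + (v * p%:Z)%:P * 'X^n) = n.+1.
    apply/eqP; rewrite eqn_leq; apply/andP; split.
      apply/leq_sizeP => j nj; rewrite E nth_default ?an // mulr0 add0r.
      by rewrite gtn_eqF ?mulr0.
    rewrite ltnNge; apply/negP => /leq_sizeP/(_ n (leqnn n)); rewrite E eqxx mulr1 uv => /eqP.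
    by rewrite oner_eq0.
  by rewrite monicE /lead_coef sz /= E eqxx mulr1 uv.
rewrite -[X in _ + X]opprK; apply: annB => //; first exact: ann_mulr.
rewrite -mulN1r; apply: ann_mulr => //; apply: ann_multiple => i.
by rewrite coefCM dvdz_mulr // dvdz_mull.
Qed.

End Torsion.

(** Either no character has a relation, and [chi0] is free with [p = 0]; or a relation of least size
    is not constant; or it is constant, and a torsion character of least order is taken. *)
Lemma good_character Y chi0 : stable T Y -> surj_coboundary Y ->
  unit_char chi0 -> small_char d chi0 -> nontrivial Y chi0 ->
  exists gam, [/\ unit_char gam, small_char d gam, nontrivial Y gam &
    exists q, forall J, exists2 P, cosparse q J P & shadowable T Y gam P].
Proof.
move=> hY EY u0 s0 nt0.
pose rel (s : nat) := exists chi u, [/\ unit_char chi, small_char d chi, nontrivial Y chi, u != 0 &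
  annihilates T Y chi u /\ size u = s].
have free (gam : X -> C) (p : nat) : unit_char gam -> (forall y, Y y -> gam y ^+ p = 1) ->
    (forall a, annihilates T Y gam a -> forall i, (p %| a`_i)%Z) ->
    exists q, forall J, exists2 P, cosparse q J P & shadowable T Y gam P.
  move=> gU gp ha; exists 0%N => J; exists setT; first by exists (fun=> set0); split=> [[]//|n]; left.
  by apply: (shadowable_free hY gU gp) => a /ha h i; have /dvdzP[b ->] := h i; exists b.
have [[s1 hs1]|hno] := pselect (exists s, `[< rel s >]); last first.
  exists chi0; split=> //; apply: (free _ 0%N) => // a ha i; rewrite dvd0z.
  apply/negPn/negP => ai; apply: hno; exists (size a); apply/asboolP; exists chi0, a; split=> //.
  by apply: contraNneq ai => ->; rewrite coef0.
have [s /asboolP[gam [f [gU gS nt f0 [fa fs]]]] smin] := ex_minnP (ex_intro (fun s => `[< rel s >]) s1 hs1).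
have f_min chi u : unit_char chi -> small_char d chi -> nontrivial Y chi -> u != 0 ->
    annihilates T Y chi u -> (size f <= size u)%N.
  by move=> *; rewrite fs; apply: smin; apply/asboolP; exists chi, u.
have [f1|f1] := ltnP 1 (size f).
  exists gam; split=> //; exact: (shadowable_relation hd TD Tc hY gU gS EY f1 fa nt f_min).
have [c c0 fc] : exists2 c, c != 0 & f = c%:P.
  by apply/size_poly1P; rewrite eqn_leq f1 size_poly_gt0.
pose tor (p : nat) := (0 < p)%N /\ exists chi, [/\ unit_char chi, small_char d chi, nontrivial Y chi &
  forall y, Y y -> chi y ^+ p = 1].
have ex_tor : exists p, `[< tor p >].
  exists `|c|%N; apply/asboolP; split; first by rewrite absz_gt0.
  exists gam; split=> // y Yy; have := fa y Yy; rewrite fc pevC // unit_charMz //.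
  case: (c) => m; first by rewrite -exprnP.
  by rewrite NegzE -invr_expz -exprnP => /eqP; rewrite invr_eq1 => /eqP; rewrite abszN.
have [p /asboolP[p0 [g [gU' gS' nt' gp]]] pmin] := ex_minnP ex_tor.
have p_min chi q : unit_char chi -> small_char d chi -> nontrivial Y chi -> (0 < q)%N ->
    (forall y, Y y -> chi y ^+ q = 1) -> (p <= q)%N.
  by move=> *; apply: pmin; apply/asboolP; split=> //; exists chi.
exists g; split=> //; apply: (free _ p) => //.
exact: (torsion_coef hY EY p0 p_min gU' gS' nt' gp).
Qed.

Lemma pev_image_surj Y a b : (pev a @` Y = Y) -> (pev b @` Y = Y) -> pev (a * b) @` Y = Y.
Proof.
move=> ha hb; rewrite predeqE => y; split=> [[x Yx <-]|].
  by rewrite pevM // -ha; exists (pev b x) => //; rewrite -hb; exists x.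
rewrite -{1}ha => -[x Yx <-]; move: Yx; rewrite -{1}hb => -[z Yz <-].
by exists z => //; rewrite pevM.
Qed.

Lemma pev_coboundary n v : pev ('X^n - 1) v = iter n T v - v.
Proof. by rewrite pevD // -[-1]/(-(1%:P)) -polyCN pevC // pevXn // mulrNz mulr1z. Qed.

Definition cob k : {poly int} := \prod_(j < k.+1) ('X^(j.+1) - 1).

Lemma stable_setT : stable T [set: X].
Proof. by split=> //; rewrite predeqE => y; split=> // _; exists (S y) => //; exact: SK. Qed.

Lemma pev0 a : pev a 0 = 0.
Proof. by apply: (addrI (pev a 0)); rewrite -pevDr // !addr0. Qed.

Lemma stable_image Y a : stable T Y -> stable T (pev a @` Y).
Proof.
move=> hY; have [[Y0 YB] TY] := hY; split; first split.
- by exists 0; rewrite ?pev0.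
- move=> _ _ [x Yx <-] [y Yy <-]; exists (x - y); first exact: YB.
  rewrite pevDr //; congr (_ + _).
  by apply: (addrI (pev a y)); rewrite -pevDr // !subrr pev0.
- rewrite predeqE => y; split=> [[_ [x Yx <-] <-]|[x]].
    by exists (T x); [rewrite -TY; exists x | rewrite pev_T].
  by rewrite -{1}TY => -[z Yz <-] <-; exists (pev a z); [exists z | rewrite pev_T].
Qed.

Lemma surj_cob Y k : stable T Y -> surj_coboundary Y -> pev (cob k) @` Y = Y.
Proof.
move=> hY EY; rewrite /cob; apply: (big_ind (fun a : {poly int} => pev a @` Y = Y)).
- by rewrite -[1]/(1%:P); rewrite predeqE => y; split=> [[x Yx <-]|Yy]; [rewrite pevC|exists y; rewrite ?pevC].
- by move=> a b; exact: pev_image_surj.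
- move=> i _; rewrite predeqE => y; split=> [[x Yx <-]|Yy]; first exact: stable_pev.
  by have [v Yv <-] := EY _ (ltn0Sn i) y Yy; exists v; rewrite ?pev_coboundary.
Qed.

Hypothesis hdcc : dcc T.

(* dcc makes the images of [inv_ker] under more and more coboundary polynomials stabilize,
   which restores [surj_coboundary] *)
Lemma descent_step Y : closed Y -> stable T Y -> surj_coboundary Y -> (exists2 y, Y y & y != 0) ->
  exists Y', [/\ closed Y', stable T Y', surj_coboundary Y', Y' `<=` Y & Y' <> Y /\ spec d T Y Y'].
Proof.
move=> cY hY EY [y0 Yy0 y00].
have [chi0 [u0 s0 n0]] := characters_separate hd cX y00.
have [|gam [gU gS [y1 Yy1 gy1] [q hq]]] := good_character hY EY u0 s0; first by exists y0.
pose K0 := inv_ker T S Y gam.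
have K0Y : K0 `<=` Y by exact: inv_ker_sub.
have hK0 : stable T K0 by exact: inv_ker_stable.
have cK0 : closed K0 by exact: (inv_ker_closed hd).
pose Psi k : {poly int} := \prod_(i < k) cob i.
pose Z k := pev (Psi k) @` K0.
have hZ k : stable T (Z k) by exact: stable_image.
have cZ k : closed (Z k).
  by apply: (closed_image hd cX) => //; [exact: pevDr | exact: (sz_pev hd)].
have ZS k : Z k.+1 = pev (cob k) @` Z k.
  rewrite /Z /Psi big_ord_recr /= mulrC predeqE => y; split=> [[x Kx <-]|[_ [x Kx <-] <-]].
    by exists (pev (\prod_(i < k) cob i) x); [exists x | rewrite pevM].
  by exists x; rewrite ?pevM.
have [k|k y|K hK] := hdcc (Xs := Z).
- by split; [|exact: (hZ k).1|exact: (hZ k).2].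
- by rewrite ZS => -[x Zx <-]; apply: stable_pev.
have EZ : surj_coboundary (Z K).
  (* Beyond the stabilization, [cob (K + n)] maps [Z K] onto itself, and ['X^n - 1] is one of its
     factors. *)
  move=> n n0' b Zb; have : Z (K + n).+1 b by rewrite hK // ltnW // ltnS leq_addr.
  rewrite ZS hK ?leq_addr // => -[x Zx <-].
  have nK : (n.-1 < (K + n).+1)%N by rewrite prednK // leqW // leq_addl.
  rewrite /cob (bigD1 (Ordinal nK)) //= prednK // pevM // pev_coboundary.
  by eexists; last reflexivity; exact: stable_pev.
have ZY : Z K `<=` K0 by move=> _ [x Kx <-]; exact: stable_pev.
exists (Z K); split=> //; first exact: subset_trans K0Y.
split.
  move=> E; move: (Yy1); rewrite -E => /ZY[_ /(_ 0%N 0%N)] /= g1.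
  by rewrite g1 eqxx in gy1.
exists q => J; have [P cP sP] := hq J; exists P => //.
(* The coboundary polynomials map [Y] onto itself, so [pev (Psi K)] carries the pair [Y], [K0] to
   the pair [Y], [Z K]. *)
have -> : Y = pev (Psi K) @` Y.
  rewrite /Psi; elim: (K) => [|k IH].
    by rewrite big_ord0 -[1]/(1%:P) predeqE => y; split=> [Yy|[x Yx <-]]; [exists y; rewrite ?pevC|rewrite pevC].
  by rewrite big_ord_recr /=; apply/esym/pev_image_surj => //; exact: surj_cob.
apply: pspec_factor.
- by move=> *; exact: pevDr.
- exact: (sz_pev hd).
- by move=> *; exact: pev_T.
- exact: (shadowable_pspec hd cX TD Tc TK SK hY cY gU gS sP).
Qed.

Lemma descent : surj_coboundary setT -> spec d T [set: X] [set 0].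
Proof.
move=> EX; apply: contrapT => hno.
have hT := stable_setT.
pose good Y := [/\ closed Y, stable T Y, surj_coboundary Y & spec d T [set: X] Y].
have gT : good setT by split=> //; exact: (spec_trivial hd).
have step Y : exists Y', good Y -> [/\ good Y', Y' `<=` Y & Y' <> Y].
  have [gY|gY] := pselect (good Y); last by exists Y => /gY.
  have [cY hY EY sY] := gY.
  have [[y Yy y0]|Y0] := pselect (exists2 y, Y y & y != 0).
    have [Y' [c' h' E' sub [ne sp]]] := descent_step cY hY EY (ex_intro2 _ _ y Yy y0).
    exists Y' => _; split=> //; split=> //.
    by apply: (spec_extension hd TD Tc hT hY) => //; case: h'.
  exfalso; apply: hno; rewrite (_ : [set 0] = Y) // predeqE => y; split=> [->|Yy].
    by have [[]] := hY.
  by apply/eqP/negPn/negP => y0; apply: Y0; exists y.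
have /choice[next hnext] := step.
pose Z k := iter k next setT.
have gZ k : good (Z k) by elim: k => // k IH; have [] := hnext _ IH.
have [k|k|K hK] := hdcc (Xs := Z).
- by have [c [h1 h2] _ _] := gZ k.
- by have [] := hnext _ (gZ k).
by have [_ _ ne] := hnext _ (gZ K); apply: ne; have := hK K.+1 (leqnSn K).
Qed.

Section Ergodicity.
Variable mu : {measure set (borel X) -> \bar R}.
Hypotheses (mu_haar : haar_measure mu) (mu_ergodic : ergodic mu T).
Local Notation borel_set := ((@open (ptd X)).-sigma.-measurable).

Lemma open_borel (U : set X) : open U -> borel_set U.
Proof. by move=> oU; apply: sub_sigma_algebra. Qed.

Lemma open_sz (U : set X) : (forall x, U x -> exists2 e : R, 0 < e & forall y, sz d (x - y) < e -> U y) -> open U.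
Proof. by move=> h; rewrite openE => x /h; rewrite /interior => /(nbhs_szP hd cX). Qed.

Lemma szP_open (U : set X) x : open U -> U x -> exists2 e : R, 0 < e & forall y, sz d (x - y) < e -> U y.
Proof. by rewrite openE => oU /oU; rewrite /interior => /(nbhs_szP hd cX). Qed.

(** Finitely many translates of [U] cover the compact group, which would be null if [U] were. *)
Lemma haar_open_neq0 (U : set X) u : open U -> U u -> mu U <> 0%E.
Proof.
move=> oU Uu mU; have [mT mtr] := mu_haar.
have [e e0 he] := szP_open oU Uu.
have [s hs] := totally_bounded hd cX e0.
pose tr (g : X) := [set (g - u) + a | a in U].
have otr g : open (tr g).
  apply: open_sz => _ [a Ua <-]; have [e' e'0 he'] := szP_open oU Ua; exists e' => // y hy.
  exists (y - (g - u)); last by rewrite addrC subrK.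
  by apply: he'; have -> : a - (y - (g - u)) = g - u + a - y by zmod.
have mtr0 g : mu (tr g) = 0%E by rewrite -mU; apply: mtr; exact: open_borel.
have cover : [set: X] = \bigcup_(g in [set` s]) tr g.
  rewrite predeqE => x; split=> // _; have [g gs hg] := hs x; exists g => //.
  exists (x - (g - u)); last by rewrite addrC subrK.
  apply: he; have -> : u - (x - (g - u)) = g - x by zmod.
  by rewrite -[sz d _]szN opprB.
have s0 (s' : seq X) : open (\bigcup_(g in [set` s']) tr g) /\ mu (\bigcup_(g in [set` s']) tr g) = 0%E.
  elim: s' => [|g s' [ou IH]]; first by rewrite set_nil bigcup_set0 measure0; split=> //; exact: open0.
  have -> : \bigcup_(g' in [set` g :: s']) tr g' = tr g `|` \bigcup_(g' in [set` s']) tr g'.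
    rewrite predeqE => x; split=> [[g' /=]|[tx|[g' gs tx]]].
    - by rewrite inE => /orP[/eqP->|gs] tx; [left|right; exists g'].
    - by exists g; rewrite //= mem_head.
    - by exists g'; rewrite //= inE gs orbT.
  split; first exact: openU.
  rewrite setUC (measureU0 (open_borel ou) (open_borel (otr g))) //.
have : mu [set: X] = 0%E by rewrite {1}cover; case: (s0 s).
by rewrite mT => /eqP; rewrite onee_eq0.
Qed.

(* If [x1] is not of the form [T^n v - v], the points some iterate of which is close to the
   closed subgroup of these elements form an invariant open set missing a neighbourhood of [x1] *)
Lemma ergodic_surj : surj_coboundary [set: X].
Proof.
move=> n n0 x1 _; apply: contrapT => hx1.
pose H := pev ('X^n - 1) @` [set: X].
have hH : stable T H := stable_image _ stable_setT.
have [[H0 HB] TH] := hH.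
have cH : closed H.
  by apply: (closed_image hd cX) => //; [move=> *; exact: pevDr|exact: (sz_pev hd)].
have [e e0 he] : exists2 e : R, 0 < e & forall h, H h -> e <= sz d (x1 - h).
  apply: contrapT => hno; apply: hx1.
  have [v _ <-] : H x1; last by exists v; rewrite ?pev_coboundary.
  apply: cH => B /(nbhs_szP hd cX)[e e0 hB]; apply: contrapT => hB2; apply: hno; exists e => // h Hh.
  by rewrite leNgt; apply/negP => /hB Bh; apply: hB2; exists h.
have [r r0 hr] := sz_sub hd e0; have [t t0 ht] := sz_iter hd TD Tc n r0.
pose V := interior [set x | sz d x < t].
have oV : open V by exact: open_interior.
have V0 : V 0 by exact: (sz_nbhs0 hd t0).
pose A := [set y | exists i h, [/\ (i < n)%N, H h & V (iter i T y - h)]].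
have oA : open A.
  apply: open_sz => y [i [h [ni Hh Vy]]]; have [e' e'0 he'] := szP_open oV Vy.
  have [t' t'0 ht'] := sz_iter hd TD Tc n e'0; exists t' => // z hz; exists i, h; split=> //.
  apply: he'; have -> : iter i T y - h - (iter i T z - h) = iter i T (y - z) by rewrite (iterTB TD); zmod.
  by apply: ht' => //; exact: ltnW.
(* Modulo [H] the map [T] has period [n], since [iter n T y - y] lies in [H]; the index [i] in [A]
   is thus a residue modulo [n]. *)
have TA : T @^-1` A = A.
  rewrite predeqE => y; split=> [[i [h [ni Hh Vy]]]|[i [h [ni Hh Vy]]]].
    move: ni; rewrite leq_eqVlt => /orP[/eqP ni|ni]; last by exists i.+1, h; rewrite iterSr.
    exists 0%N, (h - (iter n T y - y)); split=> //; first by apply: HB => //; exists y; rewrite ?pev_coboundary.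
    by move: Vy; rewrite -iterSr ni; have -> : iter n T y - h = iter 0 T y - (h - (iter n T y - y)) by rewrite /=; zmod.
  case: i ni Vy => [|i] ni Vy; last by exists i, h; split=> //; [exact: ltnW | rewrite -iterSr].
  exists n.-1, (h + (iter n T y - y)); split; first by rewrite prednK.
    by apply: subgroupD; [exact: hH.1| |exists y; rewrite ?pev_coboundary].
  rewrite -iterSr prednK //; have -> // : iter n T y - (h + (iter n T y - y)) = y - h by zmod.
have VA : A 0 by exists 0%N, 0; rewrite /= subr0.
have [mA|mA] := mu_ergodic (open_borel oA) TA; first exact: (haar_open_neq0 oA VA mA).
pose W := [set y | V (y - x1)].
have oW : open W.
  apply: open_sz => y Vy; have [e' e'0 he'] := szP_open oV Vy; exists e' => // z hz.
  by apply: he'; have -> : y - x1 - (z - x1) = y - z by zmod.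
have Wx : W x1 by rewrite /W /= subrr.
have AW : A `&` W = set0.
  rewrite predeqE => y; split=> // -[[i [h [ni Hh Vy]]] Wy].
  have sz1 z : V z -> sz d z < t by move=> /interior_subset.
  have Hk : H (iter (n - i) T h) by exact: stable_iter.
  have Hy : H (iter n T y - y) by exists y; rewrite ?pev_coboundary.
  have := he _ (HB _ _ Hk Hy); apply/negP; rewrite -ltNge.
  have -> : x1 - (iter (n - i) T h - (iter n T y - y)) = iter (n - i) T (iter i T y - h) - (y - x1).
    by rewrite (iterTB TD) -iterD subnK ?(ltnW ni) //; zmod.
  apply: hr; first by apply: (ht _ (sz1 _ Vy)); exact: leq_subr.
  exact: (ht _ (sz1 _ Wy) 0%N).
apply: (haar_open_neq0 oW Wx); have [mT _] := mu_haar.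
have mU : mu (A `|` W) = (mu A + mu W)%E by apply: measureU => //; exact: open_borel.
have le1 : (mu (A `|` W) <= mu [set: X])%E.
  apply: le_measure => //; rewrite inE; last exact: (@measurableT _ (borel X)).
  by apply: open_borel; exact: openU.
have W0 : (0 <= mu W)%E by exact: measure_ge0.
move: le1 W0; rewrite mU mA mT; case: (mu W) => [w||] //=.
by rewrite !lee_fin => h1 h2; congr EFin; apply/eqP; rewrite eq_le h2 andbT; lra.
Qed.

End Ergodicity.

End Descent.

Theorem theorem1p2 (R : realType) (X : topologicalZmodType)
    (d : X -> X -> R) (T : X -> X)
    (mu : {measure set (borel X) -> \bar R}) :
  compact [set: X] ->
  compatible_metric d ->
  cont_automorphism T ->
  haar_measure mu ->
  ergodic mu T ->
  dcc T ->
  partial_spec d T.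
Proof.
move=> cX hd [TD Tbij Tc] mu_haar mu_erg hdcc; have [S TK SK] := Tbij.
apply: (spec_partial_spec hd cX); apply: (descent hd cX TD Tc TK SK hdcc).
exact: (@ergodic_surj _ _ _ _ _ hd cX TD Tc SK _ mu_haar mu_erg).
Qed.
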